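(* Let $K$ be a field. There is an equivalence of categories between the category $\mathsf{X}^2(\mathsf{Hopf}_{K,coc})$ of Hopf crossed squares and the category $\mathsf{cat}^2(\mathsf{Hopf}_{K,coc})$ of cat$^2$-Hopf algebras over $K$.
   Context: All Hopf algebras are cocommutative over $K$; Sweedler notation $\Delta(x)=x_1\otimes x_2$, antipode $S$, counit $\epsilon$; $\mathrm{HKer}(f)=\{a\in A\mid f(a_1)\otimes a_2=1\otimes a\}$ for a Hopf morphism $f\colon A\to B$. A $B$-module Hopf algebra $X$ has a linear map $b\otimes x\mapsto b\triangleright x$ with $(bb')\triangleright x=b\triangleright(b'\triangleright x)$, $1_B\triangleright x=x$, $b\triangleright(xy)=(b_1\triangleright x)(b_2\triangleright y)$, $b\triangleright1_X=\epsilon(b)1_X$, $\Delta(b\triangleright x)=b_1\triangleright x_1\otimes b_2\triangleright x_2$, $\epsilon(b\triangleright x)=\epsilon(b)\epsilon(x)$. A Hopf crossed module $(B,X,d)$: $X$ a $B$-module Hopf algebra and $d\colon X\to B$ a Hopf morphism with $d(b\triangleright x)=b_1d(x)S(b_2)$ and $d(y)\triangleright x=y_1xS(y_2)$. A Hopf crossed square $(L,M,N,P,h,\lambda,\lambda',\mu,\nu)$ is a commutative square of Hopf algebra morphisms $\lambda\colon L\to M$, $\lambda'\colon L\to N$, $\mu\colon M\to P$, $\nu\colon N\to P$, where $L,M,N$ are $P$-module Hopf algebras and $h\colon M\otimes N\to L$ is a coalgebra map such that for all $l\in L$, $m,m'\in M$, $n,n'\in N$, $p\in P$: (CS1) $(P,M,\mu)$,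 $(P,N,\nu)$, $(P,L,\mu\lambda)$ are Hopf crossed modules; (CS2) $\lambda,\lambda'$ are $P$-linear; (CS3) $h(p_1\triangleright m\otimes p_2\triangleright n)=p\triangleright h(m\otimes n)$; (CS4) $\lambda h(m\otimes n)=m_1(\nu(n)\triangleright S(m_2))$, $\lambda'h(m\otimes n)=(\mu(m)\triangleright n_1)S(n_2)$; (CS5) $h(\lambda(l)\otimes n)=l_1(\nu(n)\triangleright S(l_2))$, $h(m\otimes\lambda'(l))=(\mu(m)\triangleright l_1)S(l_2)$; (CS6) $h(m\otimes nn')=h(m_1\otimes n_1)(\nu(n_2)\triangleright h(m_2\otimes n'))$, $h(mm'\otimes n)=(\mu(m_1)\triangleright h(m'\otimes n_1))h(m_2\otimes n_2)$. A morphism of Hopf crossed squares is a quadruple of Hopf morphisms $\alpha\colon L\to\hat L$, $\beta\colon M\to\hat M$, $\gamma\colon N\to\hat N$, $\delta\colon P\to\hat P$ such that all faces of the resulting cube commute, $\alpha(p\triangleright l)=\delta(p)\triangleright\alpha(l)$, $\beta(p\triangleright m)=\delta(p)\triangleright\beta(m)$, $\gamma(p\triangleright n)=\delta(p)\triangleright\gamma(n)$, and $\alpha h=\hat h(\beta\otimes\gamma)$. A cat$^1$-Hopf algebra is a reflexive graph $s_N,t_N\colon H\to N$, $i_N\colon N\to H$ in $\mathsf{Hopf}_{K,coc}$ with $i_N$ regarded as the inclusion of a Hopf subalgebra (so $s_N|_N=t_N|_N=\mathrm{Id}_N$), such that $ab=ba$ for all $a\in\mathrm{HKer}(s_N)$,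 $b\in\mathrm{HKer}(t_N)$. A cat$^2$-Hopf algebra is a 7-tuple $(H,N,M,s_N,t_N,s_M,t_M)$ where $(H,N,s_N,t_N)$ and $(H,M,s_M,t_M)$ are cat$^1$-Hopf algebras such that $s_Ns_M=s_Ms_N$, $t_Nt_M=t_Mt_N$, $s_Nt_M=t_Ms_N$, $t_Ns_M=s_Mt_N$. A morphism of cat$^2$-Hopf algebras is a Hopf morphism $f\colon H\to H'$ with $f(N)\subseteq N'$, $f(M)\subseteq M'$, $s'_{N'}f=f|_Ns_N$, $t'_{N'}f=f|_Nt_N$, $s'_{M'}f=f|_Ms_M$, $t'_{M'}f=f|_Mt_M$. *)

(* Defs.v *)
(* Hopf algebras over a field K, encoded on K-vector spaces
   (lmodType K); tensors are represented by finite lists of pure tensors and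
   compared through the universal property of the tensor product. *)
From HB Require Import structures.
From mathcomp Require Import all_boot all_order all_algebra.
Set Implicit Arguments. Unset Strict Implicit. Unset Printing Implicit Defensive.
Import GRing.Theory.
Local Open Scope ring_scope.

Section Hopf.
Variable K : fieldType.

Definition bilin (V W U : lmodType K) (f : V -> W -> U) :=
  (forall (a : K) v v' w, f (a *: v + v') w = a *: f v w + f v' w) /\
  (forall (a : K) v w w', f v (a *: w + w') = a *: f v w + f v w').

Definition trilin (V W X U : lmodType K) (f : V -> W -> X -> U) :=
  (forall (a : K) v v' w x, f (a *: v + v') w x = a *: f v w x + f v' w x) /\
  (forall (a : K) v w w' x, f v (a *: w + w') x = a *: f v w x + f v w' x) /\
  (forall (a : K) v w x x', f v w (a *: x + x') = a *: f v w x + f v w x').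

(* an element of V (x) W, given as a finite sum of pure tensors *)
Definition tens (V W : lmodType K) := seq (V * W).
Definition tsum (V W U : lmodType K) (f : V -> W -> U) (s : tens V W) : U :=
  \sum_(p <- s) f p.1 p.2.
(* equality in V (x) W (universal property) *)
Definition teq (V W : lmodType K) (s t : tens V W) : Prop :=
  forall (U : lmodType K) (f : V -> W -> U), bilin f -> tsum f s = tsum f t.
Definition teq3 (V W X : lmodType K) (s t : seq (V * W * X)) : Prop :=
  forall (U : lmodType K) (f : V -> W -> X -> U), trilin f ->
    \sum_(p <- s) f p.1.1 p.1.2 p.2 = \sum_(p <- t) f p.1.1 p.1.2 p.2.

Record hopf := Hopf {
  hcar :> lmodType K;
  hmul : hcar -> hcar -> hcar;
  hone : hcar;
  hcomul : hcar -> tens hcar hcar;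
  hcounit : hcar -> K;
  hanti : hcar -> hcar;
  hmul_bilin : bilin hmul;
  hmulA : forall x y z, hmul x (hmul y z) = hmul (hmul x y) z;
  hmul1x : forall x, hmul hone x = x;
  hmulx1 : forall x, hmul x hone = x;
  hcomul_lin : forall (a : K) x y,
    teq (hcomul (a *: x + y)) ([seq (a *: p.1, p.2) | p <- hcomul x] ++ hcomul y);
  hcomulA : forall x,
    teq3 [seq (q.1, q.2, p.2) | p <- hcomul x, q <- hcomul p.1]
         [seq (p.1, q.1, q.2) | p <- hcomul x, q <- hcomul p.2];
  hcounit_lin : forall (a : K) x y, hcounit (a *: x + y) = a * hcounit x + hcounit y;
  hcounitl : forall x, tsum (fun u v => hcounit u *: v) (hcomul x) = x;
  hcounitr : forall x, tsum (fun u v => hcounit v *: u) (hcomul x) = x;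
  hcomulM : forall x y,
    teq (hcomul (hmul x y))
        [seq (hmul p.1 q.1, hmul p.2 q.2) | p <- hcomul x, q <- hcomul y];
  hcomul1 : teq (hcomul hone) [:: (hone, hone)];
  hcounitM : forall x y, hcounit (hmul x y) = hcounit x * hcounit y;
  hcounit1 : hcounit hone = 1;
  hanti_lin : forall (a : K) x y, hanti (a *: x + y) = a *: hanti x + hanti y;
  hantil : forall x, tsum (fun u v => hmul (hanti u) v) (hcomul x) = hcounit x *: hone;
  hantir : forall x, tsum (fun u v => hmul u (hanti v)) (hcomul x) = hcounit x *: hone;
  hcocomm : forall x, teq (hcomul x) [seq (p.2, p.1) | p <- hcomul x]
}.

(* Sweedler sum: sw x f = f(x_1, x_2) *)
Definition sw (H : hopf) (U : lmodType K) (x : H) (f : H -> H -> U) : U :=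
  tsum f (hcomul x).

Definition hopf_mor (A B : hopf) (f : A -> B) : Prop :=
  [/\ forall (a : K) x y, f (a *: x + y) = a *: f x + f y,
      forall x y, f (hmul x y) = hmul (f x) (f y),
      f (hone A) = hone B,
      forall x, teq (hcomul (f x)) [seq (f p.1, f p.2) | p <- hcomul x]
    & forall x, hcounit (f x) = hcounit x].

Definition hker (A B : hopf) (f : A -> B) (a : A) : Prop :=
  teq [seq (f p.1, p.2) | p <- hcomul a] [:: (hone B, a)].

Definition module_hopf (B X : hopf) (act : B -> X -> X) : Prop :=
  [/\ bilin act,
      (forall b b' x, act (hmul b b') x = act b (act b' x)),
      (forall x, act (hone B) x = x),
      (forall b x y, act b (hmul x y) = sw b (fun b1 b2 => hmul (act b1 x) (act b2 y)))
    & [/\ (forall b, act b (hone X) = hcounit b *: hone X),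
        (forall b x, teq (hcomul (act b x))
                      [seq (act p.1 q.1, act p.2 q.2) | p <- hcomul b, q <- hcomul x])
      & (forall b x, hcounit (act b x) = hcounit b * hcounit x)]].

Definition crossed_module (B X : hopf) (act : B -> X -> X) (d : X -> B) : Prop :=
  [/\ module_hopf act, hopf_mor d,
      forall b x, d (act b x) = sw b (fun b1 b2 => hmul (hmul b1 (d x)) (hanti b2))
    & forall y x, act (d y) x = sw y (fun y1 y2 => hmul (hmul y1 x) (hanti y2))].

Record xsquare := XSquare {
  xL : hopf; xM : hopf; xN : hopf; xP : hopf;
  xlam : xL -> xM; xlam' : xL -> xN; xmu : xM -> xP; xnu : xN -> xP;
  actL : xP -> xL -> xL; actM : xP -> xM -> xM; actN : xP -> xN -> xN;
  xh : xM -> xN -> xL;  (* the linear map h : M (x) N -> L, as a bilinear map *)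
  xlam_mor : hopf_mor xlam; xlam'_mor : hopf_mor xlam';
  xmu_mor : hopf_mor xmu; xnu_mor : hopf_mor xnu;
  xcomm : forall l, xmu (xlam l) = xnu (xlam' l);
  xh_bilin : bilin xh;
  xh_comul : forall m n, teq (hcomul (xh m n))
                   [seq (xh p.1 q.1, xh p.2 q.2) | p <- hcomul m, q <- hcomul n];
  xh_counit : forall m n, hcounit (xh m n) = hcounit m * hcounit n;
  CS1M : crossed_module actM xmu;
  CS1N : crossed_module actN xnu;
  CS1L : crossed_module actL (fun l => xmu (xlam l));
  CS2l : forall p l, xlam (actL p l) = actM p (xlam l);
  CS2l' : forall p l, xlam' (actL p l) = actN p (xlam' l);
  CS3 : forall p m n, sw p (fun p1 p2 => xh (actM p1 m) (actN p2 n)) = actL p (xh m n);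
  CS4l : forall m n, xlam (xh m n) = sw m (fun m1 m2 => hmul m1 (actM (xnu n) (hanti m2)));
  CS4l' : forall m n, xlam' (xh m n) = sw n (fun n1 n2 => hmul (actN (xmu m) n1) (hanti n2));
  CS5l : forall l n, xh (xlam l) n = sw l (fun l1 l2 => hmul l1 (actL (xnu n) (hanti l2)));
  CS5l' : forall m l, xh m (xlam' l) = sw l (fun l1 l2 => hmul (actL (xmu m) l1) (hanti l2));
  CS6r : forall m n n', xh m (hmul n n') =
     sw m (fun m1 m2 => sw n (fun n1 n2 => hmul (xh m1 n1) (actL (xnu n2) (xh m2 n'))));
  CS6l : forall m m' n, xh (hmul m m') n =
     sw m (fun m1 m2 => sw n (fun n1 n2 => hmul (actL (xmu m1) (xh m' n1)) (xh m2 n2)))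
}.

Definition xsq_map (A B : xsquare) : Type :=
  ((xL A -> xL B) * (xM A -> xM B) * (xN A -> xN B) * (xP A -> xP B))%type.

Definition is_xsq_mor (A B : xsquare) (f : xsq_map A B) : Prop :=
  let: (al, be, ga, de) := f in
  [/\ [/\ hopf_mor al, hopf_mor be, hopf_mor ga & hopf_mor de],
      [/\ forall l, be (xlam l) = xlam (al l),
          forall l, ga (xlam' l) = xlam' (al l),
          forall m, de (xmu m) = xmu (be m)
        & forall n, de (xnu n) = xnu (ga n)],
      [/\ forall p l, al (actL p l) = actL (de p) (al l),
          forall p m, be (actM p m) = actM (de p) (be m)
        & forall p n, ga (actN p n) = actN (de p) (ga n)]
    & forall m n, al (xh m n) = xh (be m) (ga n)].

Definition xsq_id (A : xsquare) : xsq_map A A :=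
  (fun x => x, fun x => x, fun x => x, fun x => x).
Definition xsq_comp (A B C : xsquare) (g : xsq_map B C) (f : xsq_map A B) : xsq_map A C :=
  let: (a2, b2, c2, d2) := g in let: (a1, b1, c1, d1) := f in
  (fun x => a2 (a1 x), fun x => b2 (b1 x), fun x => c2 (c1 x), fun x => d2 (d1 x)).

(* the Hopf subalgebra N of H is given by a Hopf algebra N with inclusion i *)
Definition cat1 (H N : hopf) (s t : H -> N) (i : N -> H) : Prop :=
  [/\ [/\ hopf_mor s, hopf_mor t & hopf_mor i],
      (forall n, s (i n) = n), (forall n, t (i n) = n)
    & forall a b, hker s a -> hker t b -> hmul a b = hmul b a].

Record cat2 := Cat2 {
  cH : hopf; cN : hopf; cM : hopf;
  sN : cH -> cN; tN : cH -> cN; iN : cN -> cH;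
  sM : cH -> cM; tM : cH -> cM; iM : cM -> cH;
  cat1N : cat1 sN tN iN;
  cat1M : cat1 sM tM iM;
  c_sNsM : forall x, iN (sN (iM (sM x))) = iM (sM (iN (sN x)));
  c_tNtM : forall x, iN (tN (iM (tM x))) = iM (tM (iN (tN x)));
  c_sNtM : forall x, iN (sN (iM (tM x))) = iM (tM (iN (sN x)));
  c_tNsM : forall x, iN (tN (iM (sM x))) = iM (sM (iN (tN x)))
}.

(* raw morphism data (f, f|_N, f|_M) *)
Definition cat2_map (X Y : cat2) : Type :=
  ((cH X -> cH Y) * (cN X -> cN Y) * (cM X -> cM Y))%type.

Definition is_cat2_mor (X Y : cat2) (f : cat2_map X Y) : Prop :=
  let: (f0, fN, fM) := f in
  [/\ [/\ hopf_mor f0, hopf_mor fN & hopf_mor fM],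
      (forall n, iN (fN n) = f0 (iN n)),
      (forall m, iM (fM m) = f0 (iM m)),
      ((forall x, sN (f0 x) = fN (sN x)) /\
          (forall x, tN (f0 x) = fN (tN x)))
    & ((forall x, sM (f0 x) = fM (sM x)) /\
          (forall x, tM (f0 x) = fM (tM x)))].

Definition cat2_id (X : cat2) : cat2_map X X := (fun x => x, fun x => x, fun x => x).
Definition cat2_comp (X Y Z : cat2) (g : cat2_map Y Z) (f : cat2_map X Y) : cat2_map X Z :=
  let: (g0, gN, gM) := g in let: (f0, fN, fM) := f in
  (fun x => g0 (f0 x), fun x => gN (fN x), fun x => gM (fM x)).

End Hopf.

(* morphisms are raw data satisfying a predicate; equality of morphisms is
   Leibniz equality of the tuples of maps (extensional under funext) *)
Record ccat := CCat {
  Ob : Type;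
  Mor : Ob -> Ob -> Type;
  IsMor : forall a b, Mor a b -> Prop;
  idm : forall a, Mor a a;
  comp : forall x y z, Mor y z -> Mor x y -> Mor x z
}.
Arguments IsMor {_ _ _}.
Arguments idm {_}.
Arguments Mor : clear implicits.
Arguments comp {_ _ _ _}.

Definition is_functor (C D : ccat) (Fo : Ob C -> Ob D)
    (Fm : forall a b, Mor C a b -> Mor D (Fo a) (Fo b)) : Prop :=
  [/\ forall a b (f : Mor C a b), IsMor f -> IsMor (Fm a b f),
      forall a, Fm a a (idm a) = idm (Fo a)
    & forall a b c (f : Mor C a b) (g : Mor C b c), IsMor f -> IsMor g ->
        Fm a c (comp g f) = comp (Fm b c g) (Fm a b f)].

Definition is_nat_iso (C D : ccat) (Fo Go : Ob C -> Ob D)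
    (Fm : forall a b, Mor C a b -> Mor D (Fo a) (Fo b))
    (Gm : forall a b, Mor C a b -> Mor D (Go a) (Go b))
    (eta : forall a, Mor D (Fo a) (Go a)) (eta' : forall a, Mor D (Go a) (Fo a)) : Prop :=
  [/\ forall a, IsMor (eta a),
      forall a, IsMor (eta' a),
      forall a, comp (eta' a) (eta a) = idm (Fo a),
      forall a, comp (eta a) (eta' a) = idm (Go a)
    & forall a b (f : Mor C a b), IsMor f -> comp (Gm a b f) (eta a) = comp (eta b) (Fm a b f)].

Definition cat_equivalence (C D : ccat) : Prop :=
  exists (Fo : Ob C -> Ob D) (Fm : forall a b, Mor C a b -> Mor D (Fo a) (Fo b))
         (Go : Ob D -> Ob C) (Gm : forall a b, Mor D a b -> Mor C (Go a) (Go b))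
         (eta : forall a, Mor C a (Go (Fo a))) (eta' : forall a, Mor C (Go (Fo a)) a)
         (eps : forall x, Mor D (Fo (Go x)) x) (eps' : forall x, Mor D x (Fo (Go x))),
    [/\ is_functor Fm, is_functor Gm,
        @is_nat_iso C C (fun a => a) (fun a => Go (Fo a)) (fun a b f => f)
                   (fun a b f => Gm _ _ (Fm a b f)) eta eta'
      & @is_nat_iso D D (fun x => Fo (Go x)) (fun x => x) (fun x y f => Fm _ _ (Gm x y f))
                   (fun x y f => f) eps eps'].

Definition XSq_cat (K : fieldType) : ccat :=
  @CCat (xsquare K) (@xsq_map K) (@is_xsq_mor K) (@xsq_id K) (@xsq_comp K).
Definition Cat2_cat (K : fieldType) : ccat :=
  @CCat (cat2 K) (@cat2_map K) (@is_cat2_mor K) (@cat2_id K) (@cat2_comp K).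

(* Main.v *)
Require Import Defs.
From HB Require Import structures.
From mathcomp Require Import all_boot all_algebra generic_quotient boolp.
Set Implicit Arguments. Unset Strict Implicit. Unset Printing Implicit Defensive.
Import GRing.Theory.
Local Open Scope ring_scope.

(** Cocommutative coalgebras form a category with finite products, given by the
    tensor product, and cocommutative Hopf algebras are its group objects.
    Hence for every cocommutative coalgebra [E] the coalgebra morphisms
    [E -> H] (the "points" of [H]) form a group under convolution, and a
    Sweedler identity holds if and only if the corresponding group identity
    holds for all points, the universal point of a tensor product giving the
    converse.  This reduces the theorem to Loday's equivalence for groups: a
    crossed square [(L, M, N, P)] goes to [(L x| N) x| (M x| P)], where [(m, p)]
    acts by [(l, n) |-> (mu(m) p |> l . h(m, p |> n), p |> n)].  A cat2-object with
    idempotents [eN = iN sN] and [eM = iM sM] goes to the images of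
      [x eM(x)^-1 eN(eM(x)) eN(x)^-1], [eM(x) eN(eM(x))^-1], [eN(x) eN(eM(x))^-1]
    and [eN(eM(x))], which are the intersections of kernels and images of [eN]
    and [eM] and have product [x] (in the order [L, N, M, P]); the action is
    conjugation and [h] is the commutator.  Being images of idempotent coalgebra
    maps, these subspaces inherit a coalgebra structure without any flatness
    argument. *)
(** * Multilinear maps *)

(** The statement contains no tensor space: a comultiplication returns a list, and lists are
    compared by evaluating bilinear maps. The computations stay on that level, so every Sweedler
    rewriting owes a multilinearity side condition, which [mlin] discharges; an actual space
    [tensor] serves to carry universal pairs of points and semidirect products. Cocommutativity
    enters before any group law can be stated, since it makes the convolution of two coalgebra maps
    a coalgebra map again. The second obstacle is that a subspace such as a Hopf kernel does not
    come with a Hopf algebra structure. The projections onto [L], [M] and [N] are in general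
    coalgebra maps only, not Hopf morphisms; what holds is that their fixed points are closed under
    products and inverses, and the construction on images asks for exactly that. *)

Section Linear.
Variable K : fieldType.
Implicit Types U V W X Y Z : lmodType K.

Definition lin V U (f : V -> U) := forall (a : K) x y, f (a *: x + y) = a *: f x + f y.

Definition quadlin V W X Y U (f : V -> W -> X -> Y -> U) :=
  (forall v, trilin (f v)) /\ (forall w x y, lin (fun v => f v w x y)).

Lemma linD V U (f : V -> U) : lin f -> {morph f : x y / x + y}.
Proof. by move=> fl x y; have := fl 1 x y; rewrite !scale1r. Qed.

Lemma lin0 V U (f : V -> U) : lin f -> f 0 = 0.
Proof. by move=> fl; have := fl (-1) 0 0; rewrite scaler0 addr0 scaleN1r addNr. Qed.

Lemma linZ V U (f : V -> U) : lin f -> forall a x, f (a *: x) = a *: f x.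
Proof. by move=> fl a x; have := fl a x 0; rewrite !addr0 lin0 // addr0. Qed.

Lemma lin_sum V U (f : V -> U) I (r : seq I) (F : I -> V) : lin f ->
  f (\sum_(i <- r) F i) = \sum_(i <- r) f (F i).
Proof. by move=> fl; apply: (big_morph f (linD fl) (lin0 fl)). Qed.

Lemma bilinP V W U (f : V -> W -> U) :
  (forall w, lin (fun v => f v w)) -> (forall v, lin (f v)) -> bilin f.
Proof. by move=> fl fr; split=> *; [apply: fl | apply: fr]. Qed.

Lemma trilinP V W X U (f : V -> W -> X -> U) :
  (forall w x, lin (fun v => f v w x)) -> (forall v x, lin (fun w => f v w x)) ->
  (forall v w, lin (f v w)) -> trilin f.
Proof. by move=> f1 f2 f3; split; [|split] => *; [apply: f1 | apply: f2 | apply: f3]. Qed.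

Lemma quadlinP V W X Y U (f : V -> W -> X -> Y -> U) :
  (forall w x y, lin (fun v => f v w x y)) -> (forall v x y, lin (fun w => f v w x y)) ->
  (forall v w y, lin (fun x => f v w x y)) -> (forall v w x, lin (f v w x)) -> quadlin f.
Proof. by move=> f1 f2 f3 f4; split=> //= v; apply: trilinP. Qed.

Lemma bilin_l V W U (f : V -> W -> U) X (g : X -> V) w :
  bilin f -> lin g -> lin (fun x => f (g x) w).
Proof. by move=> [fl _] gl a x y; rewrite gl fl. Qed.
Lemma bilin_r V W U (f : V -> W -> U) X (g : X -> W) v :
  bilin f -> lin g -> lin (fun x => f v (g x)).
Proof. by move=> [_ fl] gl a x y; rewrite gl fl. Qed.

Lemma trilin_1 V W X U (f : V -> W -> X -> U) Y (g : Y -> V) w x :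
  trilin f -> lin g -> lin (fun y => f (g y) w x).
Proof. by move=> [fl _] gl a y y'; rewrite gl fl. Qed.
Lemma trilin_2 V W X U (f : V -> W -> X -> U) Y (g : Y -> W) v x :
  trilin f -> lin g -> lin (fun y => f v (g y) x).
Proof. by move=> [_ [fl _]] gl a y y'; rewrite gl fl. Qed.
Lemma trilin_3 V W X U (f : V -> W -> X -> U) Y (g : Y -> X) v w :
  trilin f -> lin g -> lin (fun y => f v w (g y)).
Proof. by move=> [_ [_ fl]] gl a y y'; rewrite gl fl. Qed.

Lemma quadlin_1 V W X Y U (f : V -> W -> X -> Y -> U) Z (g : Z -> V) w x y :
  quadlin f -> lin g -> lin (fun z => f (g z) w x y).
Proof. by move=> [_ fl] gl a z z'; rewrite gl fl. Qed.
Lemma quadlin_2 V W X Y U (f : V -> W -> X -> Y -> U) Z (g : Z -> W) v x y :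
  quadlin f -> lin g -> lin (fun z => f v (g z) x y).
Proof. by move=> [/(_ v) [fl _] _] gl a z z'; rewrite gl fl. Qed.
Lemma quadlin_3 V W X Y U (f : V -> W -> X -> Y -> U) Z (g : Z -> X) v w y :
  quadlin f -> lin g -> lin (fun z => f v w (g z) y).
Proof. by move=> [/(_ v) [_ [fl _]] _] gl a z z'; rewrite gl fl. Qed.
Lemma quadlin_4 V W X Y U (f : V -> W -> X -> Y -> U) Z (g : Z -> Y) v w x :
  quadlin f -> lin g -> lin (fun z => f v w x (g z)).
Proof. by move=> [/(_ v) [_ [_ fl]] _] gl a z z'; rewrite gl fl. Qed.

Lemma lin_id V : lin (fun x : V => x). Proof. by []. Qed.

Lemma lin_comp V W U (f : W -> U) (g : V -> W) : lin f -> lin g -> lin (fun x => f (g x)).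
Proof. by move=> fl gl a x y; rewrite gl fl. Qed.

Lemma lin_scale V U (c : K) (g : V -> U) : lin g -> lin (fun x => c *: g x).
Proof. by move=> gl a x y; rewrite gl scalerDr !scalerA mulrC. Qed.

Lemma lin_scalel V U (g : V -> K^o) (u : U) : lin g -> lin (fun x => (g x : K) *: u).
Proof. by move=> gl a x y; rewrite gl scalerDl -scalerA. Qed.

End Linear.

(** * Tensor product *)

Section Tensor.
Variables (K : fieldType) (V W : lmodType K).

(** Classical logic ([asbool]) turns an equality that quantifies over all vector spaces into a
    boolean relation, as the quotient construction requires. *)
Definition tens_eqb (s t : seq (V * W)) : bool := `[< teq s t >].

Lemma tens_eqb_refl : reflexive tens_eqb.
Proof. by move=> s; apply/asboolP=> U f _. Qed.
Lemma tens_eqb_sym : symmetric tens_eqb.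
Proof. by move=> s t; apply/asboolP/asboolP=> st U f fb; rewrite st. Qed.
Lemma tens_eqb_trans : transitive tens_eqb.
Proof.
by move=> s t u /asboolP ts /asboolP su; apply/asboolP=> U f fb; rewrite ts // su.
Qed.

Canonical tens_equiv := EquivRel tens_eqb tens_eqb_refl tens_eqb_sym tens_eqb_trans.

Definition tensor := {eq_quot tens_equiv}%qT.
HB.instance Definition _ := Choice.on tensor.
HB.instance Definition _ := EqQuotient.on tensor.

(** The linear map induced by [f], computed on a chosen representative; for bilinear [f] the choice
    is immaterial, which is the content of [textE]. *)
Definition text (U : lmodType K) (f : V -> W -> U) (x : tensor) : U := tsum f (repr x).

Lemma textE (U : lmodType K) (f : V -> W -> U) s :
  bilin f -> text f (\pi_tensor s)%qT = tsum f s.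
Proof.
move=> fb; rewrite /text; suff: teq (repr (\pi_tensor s)%qT) s by apply.
by apply/asboolP; have /eqmodP : (repr (\pi_tensor s) = s %[mod tensor])%qT by rewrite reprK.
Qed.

Lemma tensor_eq (x y : tensor) :
  (forall (U : lmodType K) (f : V -> W -> U), bilin f -> text f x = text f y) -> x = y.
Proof.
move=> xy; rewrite -[x]reprK -[y]reprK; apply/eqmodP/asboolP => U f fb.
exact: xy.
Qed.

(** The operations work on representatives. By [tensor_eq] each vector space axiom is checked after
    applying [text f], where it becomes an axiom of the target. *)
Definition tadd (x y : tensor) : tensor := (\pi_tensor (repr x ++ repr y))%qT.
Definition tscale (a : K) (x : tensor) : tensor :=
  (\pi_tensor [seq (a *: p.1, p.2) | p <- repr x])%qT.
Definition tzero : tensor := (\pi_tensor [::])%qT.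
Definition topp (x : tensor) := tscale (-1) x.

Section Text.
Variables (U : lmodType K) (f : V -> W -> U).
Hypothesis fb : bilin f.
Lemma text_add x y : text f (tadd x y) = text f x + text f y.
Proof. by rewrite textE // /tsum big_cat. Qed.
Lemma text_scale a x : text f (tscale a x) = a *: text f x.
Proof.
rewrite textE // /text /tsum big_map scaler_sumr; apply: eq_bigr => p _.
exact: (linZ (bilin_l p.2 fb (@lin_id _ _))).
Qed.
Lemma text_zero : text f tzero = 0.
Proof. by rewrite textE // /tsum big_nil. Qed.
Lemma text_opp x : text f (topp x) = - text f x.
Proof. by rewrite text_scale scaleN1r. Qed.
End Text.

Lemma taddA : associative tadd.
Proof. by move=> x y z; apply: tensor_eq => U f fb; rewrite !text_add // addrA. Qed.
Lemma taddC : commutative tadd.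
Proof. by move=> x y; apply: tensor_eq => U f fb; rewrite !text_add // addrC. Qed.
Lemma tadd0x : left_id tzero tadd.
Proof. by move=> x; apply: tensor_eq => U f fb; rewrite !text_add // text_zero // add0r. Qed.
Lemma taddNx : left_inverse tzero topp tadd.
Proof.
by move=> x; apply: tensor_eq => U f fb; rewrite !text_add // text_opp // text_zero // addNr.
Qed.
HB.instance Definition _ := GRing.isZmodule.Build tensor taddA taddC tadd0x taddNx.

Lemma tscaleA a b x : tscale a (tscale b x) = tscale (a * b) x.
Proof. by apply: tensor_eq => U f fb; rewrite !text_scale // scalerA. Qed.
Lemma tscale1 : left_id 1 tscale.
Proof. by move=> x; apply: tensor_eq => U f fb; rewrite !text_scale // scale1r. Qed.
Lemma tscaleDr : right_distributive tscale +%R.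
Proof.
move=> a x y; apply: tensor_eq => U f fb.
by rewrite !(text_scale, text_add) // scalerDr.
Qed.
Lemma tscaleDl x : {morph tscale^~ x : a b / a + b}.
Proof.
move=> a b; apply: tensor_eq => U f fb.
by rewrite !(text_scale, text_add) // scalerDl.
Qed.
HB.instance Definition _ :=
  GRing.Zmodule_isLmodule.Build K tensor tscaleA tscale1 tscaleDr tscaleDl.

Definition tns (v : V) (w : W) : tensor := (\pi_tensor [:: (v, w)])%qT.

Lemma text_lin (U : lmodType K) (f : V -> W -> U) : bilin f -> lin (text f).
Proof. by move=> fb a x y; rewrite text_add // text_scale. Qed.

Lemma text_tns (U : lmodType K) (f : V -> W -> U) v w : bilin f -> text f (tns v w) = f v w.
Proof. by move=> fb; rewrite textE // /tsum big_seq1. Qed.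

Lemma tns_bilin : bilin tns.
Proof.
split=> *; apply: tensor_eq => U f fb; rewrite text_lin // !text_tns //.
  by case: fb => ->.
by case: fb => _ ->.
Qed.

(** Pure tensors span, because a representative is a finite list of them. *)
Lemma tensor_ext (U : lmodType K) (f g : tensor -> U) : lin f -> lin g ->
  (forall v w, f (tns v w) = g (tns v w)) -> forall x, f x = g x.
Proof.
move=> fl gl fg x.
have -> : x = \sum_(p <- repr x) tns p.1 p.2.
  apply: tensor_eq => U' h hb; rewrite lin_sum; last exact: text_lin.
  by rewrite {1}/text /tsum; apply: eq_bigr => p _; rewrite text_tns.
by rewrite !lin_sum //; apply: eq_bigr => p _.
Qed.

End Tensor.

(** * Cocommutative coalgebras *)

Section Coalgebra.
Variable K : fieldType.
Implicit Types U V W : lmodType K.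

(** The laws are phrased as sums against multilinear maps, the form in which they are used for
    rewriting. The second counit law comes from cocommutativity ([csw_epsr]). *)
Record coalg := Coalg {
  ccar :> lmodType K;
  cdelta : ccar -> seq (ccar * ccar);
  ceps : ccar -> K;
  cdelta_lin : forall U (F : ccar -> ccar -> U), bilin F -> lin (fun x => tsum F (cdelta x));
  cdeltaA : forall x U (F : ccar -> ccar -> ccar -> U), trilin F ->
    tsum (fun u v => tsum (fun a b => F a b v) (cdelta u)) (cdelta x) =
    tsum (fun u v => tsum (fun a b => F u a b) (cdelta v)) (cdelta x);
  cdeltaC : forall x U (F : ccar -> ccar -> U), bilin F ->
    tsum F (cdelta x) = tsum (fun u v => F v u) (cdelta x);
  ceps_lin : lin (ceps : ccar -> K^o);
  cdelta_eps : forall x, tsum (fun u v => ceps u *: v) (cdelta x) = x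
}.

Definition csw (C : coalg) U (x : C) (F : C -> C -> U) : U := tsum F (cdelta x).

Lemma eq_csw (C : coalg) U (x : C) (F G : C -> C -> U) :
  (forall u v, F u v = G u v) -> csw x F = csw x G.
Proof. by move=> FG; apply: eq_bigr. Qed.

Lemma csw_lin (C : coalg) U (F : C -> C -> U) : bilin F -> lin (fun x => csw x F).
Proof. exact: cdelta_lin. Qed.

Lemma lin_cswr (C : coalg) V U (x : C) (F : V -> C -> C -> U) :
  (forall u v, lin (fun w => F w u v)) -> lin (fun w => csw x (F w)).
Proof.
move=> Fl a w w'; rewrite /csw /tsum scaler_sumr -big_split /=.
by apply: eq_bigr => p _; apply: Fl.
Qed.

Record cmor (C D : coalg) := Cmor {
  cfun :> C -> D;
  cmor_lin : lin cfun;
  cmor_sw : forall x U (F : D -> D -> U), bilin F ->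
    csw (cfun x) F = csw x (fun u v => F (cfun u) (cfun v));
  cmor_eps : forall x, ceps (cfun x) = ceps x
}.

Record bimor (A B D : coalg) := Bimor {
  bfun :> A -> B -> D;
  bimor_bilin : bilin bfun;
  bimor_sw : forall a b U (F : D -> D -> U), bilin F ->
    csw (bfun a b) F = csw a (fun u v => csw b (fun u' v' => F (bfun u u') (bfun v v')));
  bimor_eps : forall a b, ceps (bfun a b) = ceps a * ceps b
}.

End Coalgebra.

(** Multilinearity is settled by syntax: fix all arguments but one, then peel off the outermost
    coalgebra map, multilinear map or Sweedler sum until the variable is bare. *)
Ltac mlin_step := match goal with
  | |- bilin (bfun ?f) => exact (bimor_bilin f)
  | |- lin (cfun ?f) => exact (cmor_lin f)
  | |- lin (@ceps _ ?C) => exact (@ceps_lin _ C)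
  | H : bilin ?F |- bilin ?F => exact H
  | H : trilin ?F |- trilin ?F => exact H
  | H : quadlin ?F |- quadlin ?F => exact H
  | H : lin ?F |- lin ?F => exact H
  | |- bilin _ => apply: bilinP => ?; cbv beta
  | |- trilin _ => apply: trilinP => ? ?; cbv beta
  | |- quadlin _ => apply: quadlinP => ? ? ?; cbv beta
  | |- lin (fun v => v) => exact: lin_id
  | |- lin (fun v => csw (@?e v) ?F) =>
      refine (@lin_comp _ _ _ _ (fun z => csw z F) e _ _); [apply: csw_lin |]
  | |- lin (fun v => csw ?e (@?F v)) =>
      refine (@lin_cswr _ _ _ _ e F _) => ? ?; cbv beta
  | |- lin (fun v => ?c *: (@?g v)) => refine (@lin_scale _ _ _ c g _)
  | |- lin (fun v => (@?c v) *: ?u) => refine (@lin_scalel _ _ _ c u _)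
  | |- lin (fun v => cfun ?f (@?g v)) =>
      refine (@lin_comp _ _ _ _ (cfun f) g _ _)
  | |- lin (fun v => @ceps _ ?C v) => exact (@ceps_lin _ C)
  | |- lin (fun v => ceps (@?g v)) =>
      refine (@lin_comp _ _ _ (GRing.regular _) (@ceps _ _) g _ _)
  | |- lin (fun v => bfun ?f (@?g v) ?w) => refine (@bilin_l _ _ _ _ (bfun f) _ g w _ _)
  | |- lin (fun v => bfun ?f ?w (@?g v)) => refine (@bilin_r _ _ _ _ (bfun f) _ g w _ _)
  | H : lin ?f |- lin (fun v => ?f (@?g v)) => refine (@lin_comp _ _ _ _ f g _ _)
  | |- lin (bfun ?f ?w) => refine (@bilin_r _ _ _ _ (bfun f) _ (fun z => z) w _ _)
  | H : bilin ?f |- lin (?f ?w) => refine (@bilin_r _ _ _ _ f _ (fun z => z) w _ _)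
  | H : trilin ?f |- lin (?f ?w ?x) => refine (@trilin_3 _ _ _ _ _ f _ (fun z => z) w x _ _)
  | H : bilin ?f |- lin (fun v => ?f (@?g v) ?w) => refine (@bilin_l _ _ _ _ f _ g w _ _)
  | H : bilin ?f |- lin (fun v => ?f ?w (@?g v)) => refine (@bilin_r _ _ _ _ f _ g w _ _)
  | H : trilin ?f |- lin (fun v => ?f (@?g v) ?w ?x) => refine (@trilin_1 _ _ _ _ _ f _ g w x _ _)
  | H : trilin ?f |- lin (fun v => ?f ?w (@?g v) ?x) => refine (@trilin_2 _ _ _ _ _ f _ g w x _ _)
  | H : trilin ?f |- lin (fun v => ?f ?w ?x (@?g v)) => refine (@trilin_3 _ _ _ _ _ f _ g w x _ _)
  | H : quadlin ?f |- lin (fun v => ?f (@?g v) ?w ?x ?y) =>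
      refine (@quadlin_1 _ _ _ _ _ _ f _ g w x y _ _)
  | H : quadlin ?f |- lin (fun v => ?f ?w (@?g v) ?x ?y) =>
      refine (@quadlin_2 _ _ _ _ _ _ f _ g w x y _ _)
  | H : quadlin ?f |- lin (fun v => ?f ?w ?x (@?g v) ?y) =>
      refine (@quadlin_3 _ _ _ _ _ _ f _ g w x y _ _)
  | H : quadlin ?f |- lin (fun v => ?f ?w ?x ?y (@?g v)) =>
      refine (@quadlin_4 _ _ _ _ _ _ f _ g w x y _ _)
  end.
Ltac mlin := try solve [repeat (cbv beta; mlin_step)].

Section CoalgebraTheory.
Variable K : fieldType.
Implicit Types U V W : lmodType K.
Implicit Types A B C D E : coalg K.

(** Function extensionality and proof irrelevance make such points equal in the Leibniz sense, so
    that identities between points can be rewritten with. *)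
Lemma cmor_ext C D (f g : cmor C D) : f =1 g -> f = g.
Proof.
case: f => f fl fs fe; case: g => g gl gs ge /= /funext fg.
by case: _ / fg gl gs ge => gl gs ge; congr Cmor; apply: Prop_irrelevance.
Qed.

Lemma lin_csw C V U (g : V -> U) (x : C) (F : C -> C -> V) :
  lin g -> g (csw x F) = csw x (fun u v => g (F u v)).
Proof. by move=> gl; rewrite /csw /tsum lin_sum. Qed.

Lemma csw_exch C D U (x : C) (y : D) (F : C -> C -> D -> D -> U) :
  csw x (fun u v => csw y (F u v)) = csw y (fun u' v' => csw x (fun u v => F u v u' v')).
Proof. exact: exchange_big. Qed.

Lemma cswA C U (x : C) (F : C -> C -> C -> U) : trilin F ->
  csw x (fun u v => csw u (fun a b => F a b v)) = csw x (fun u v => csw v (F u)).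
Proof. exact: cdeltaA. Qed.

Lemma cswC C U (x : C) (F : C -> C -> U) : bilin F -> csw x F = csw x (fun u v => F v u).
Proof. exact: cdeltaC. Qed.

Lemma csw_epsl C U (x : C) (g : C -> U) :
  lin g -> csw x (fun u v => ceps u *: g v) = g x.
Proof.
move=> gl; rewrite -[in RHS](cdelta_eps x) -/(csw x _) lin_csw //.
by apply: eq_csw => u v; rewrite linZ.
Qed.

Lemma csw_epsr C U (x : C) (g : C -> U) :
  lin g -> csw x (fun u v => ceps v *: g u) = g x.
Proof. by move=> gl; rewrite cswC; last mlin; exact: (csw_epsl x gl). Qed.

(** Coassociativity brings the two middle legs of the fourfold coproduct next to each other, and
    cocommutativity exchanges them. *)
Lemma csw_swap C U (x : C) (F : C -> C -> C -> C -> U) : quadlin F ->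
  csw x (fun u v => csw u (fun a b => csw v (fun c d => F a b c d))) =
  csw x (fun u v => csw u (fun a b => csw v (fun c d => F a c b d))).
Proof.
move=> Fq; rewrite (cswA x (F := fun a b v => csw v (fun c d => F a b c d))); last mlin.
rewrite (cswA x (F := fun a b v => csw v (fun c d => F a c b d))); last mlin.
apply: eq_csw => u v; rewrite -(cswA v (F := fun b c d => F u b c d)); last mlin.
rewrite -(cswA v (F := fun b c d => F u c b d)); last mlin.
by apply: eq_csw => b d; rewrite cswC; mlin.
Qed.

Definition cidm C : cmor C C.
Proof. by exists (fun x => x). Defined.

Definition ccomp A B C (g : cmor B C) (f : cmor A B) : cmor A C.
Proof.
exists (fun x => g (f x)); first mlin.
  by move=> x U F Fb; rewrite cmor_sw // cmor_sw //; mlin.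
by move=> x; rewrite !cmor_eps.
Defined.

(** The composite of the coproduct of [E], of [x] tensor [y], and of [f]. It is comultiplicative
    because the middle legs of [e] can be exchanged ([csw_swap]): this is where cocommutativity of
    [E] is spent. *)
Definition ap A B D E (f : bimor A B D) (x : cmor E A) (y : cmor E B) : cmor E D.
Proof.
exists (fun e => csw e (fun u v => f (x u) (y v))); first mlin.
- move=> e U F Fb; rewrite (lin_csw (g := fun z => csw z F)); last mlin.
  transitivity (csw e (fun u v => csw u (fun a b => csw v (fun c d =>
    F (f (x a) (y c)) (f (x b) (y d)))))).
    apply: eq_csw => u v; rewrite bimor_sw // cmor_sw; last mlin.
    by apply: eq_csw => a b; rewrite cmor_sw //; mlin.
  rewrite csw_swap; last mlin.
  apply: eq_csw => u v; rewrite (lin_csw (g := fun z => F z _)); last mlin.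
  apply: eq_csw => a b.
  by rewrite (lin_csw (g := fun z => F _ z)) //; mlin.
- move=> e; rewrite (lin_csw (g := (@ceps _ D : D -> K^o))); last mlin.
  transitivity (csw e (fun u v => ceps u *: (ceps v : K^o))).
    by apply: (@eq_csw _ _ K^o) => u v; rewrite bimor_eps !cmor_eps.
  by rewrite (csw_epsl (U := K^o)) //; mlin.
Defined.

Lemma apE A B D E (f : bimor A B D) (x : cmor E A) (y : cmor E B) e :
  ap f x y e = csw e (fun u v => f (x u) (y v)).
Proof. by []. Qed.

Lemma ap_comp A B D E E' (f : bimor A B D) (x : cmor E A) (y : cmor E B) (g : cmor E' E) :
  ccomp (ap f x y) g = ap f (ccomp x g) (ccomp y g).
Proof. by apply: cmor_ext => e /=; rewrite cmor_sw //; mlin. Qed.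

Lemma ccompA A B C D (f : cmor A B) (g : cmor B C) (h : cmor C D) :
  ccomp h (ccomp g f) = ccomp (ccomp h g) f.
Proof. exact: cmor_ext. Qed.

Lemma ccomp1f A B (f : cmor A B) : ccomp (cidm B) f = f.
Proof. exact: cmor_ext. Qed.
Lemma ccompf1 A B (f : cmor A B) : ccomp f (cidm A) = f.
Proof. exact: cmor_ext. Qed.

Lemma ccompK A B E (f : cmor A B) (g : cmor B A) (x : cmor E A) :
  ccomp g f = cidm A -> ccomp g (ccomp f x) = x.
Proof. by move=> gf; rewrite ccompA gf ccomp1f. Qed.

End CoalgebraTheory.

(** * The coalgebra structure on a tensor product *)

Section TensorCoalgebra.
Variable K : fieldType.
Variables A B : coalg K.
Implicit Types U : lmodType K.

(** The list itself depends on the representative; the laws are therefore proved through [tdeltaE],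
    which evaluates a map on it. *)
Let tdelta (x : tensor A B) : seq (tensor A B * tensor A B) :=
  flatten [seq flatten [seq [seq (tns u u', tns v v') | '(u', v') <- cdelta p.2] | '(u, v) <- cdelta p.1]
          | p <- repr x].
Let teps (x : tensor A B) : K := @text K A B K^o (fun a b => ceps a * ceps b) x.
Let dF U (F : tensor A B -> tensor A B -> U) a b :=
  csw a (fun u v => csw b (fun u' v' => F (tns u u') (tns v v'))).

Let dF_bilin U F : bilin F -> bilin (@dF U F).
Proof. by move=> Fb; have tb := @tns_bilin K A B; rewrite /dF; mlin. Qed.

Let tdeltaE U F x : @tsum _ _ _ U F (tdelta x) = text (dF F) x.
Proof.
rewrite /tsum big_flatten big_map /text /tsum; apply: eq_bigr => p _.
rewrite big_flatten big_map; apply: eq_bigr => -[u v] _.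
by rewrite big_map; apply: eq_bigr => -[u' v'] _.
Qed.

Let teps_bilin : @bilin K A B K^o (fun a b => ceps a * ceps b).
Proof.
split=> c *; rewrite (@ceps_lin K _) /GRing.scale /=; first by rewrite mulrDl mulrA.
by rewrite mulrDr mulrCA.
Qed.

Let lin_textr U (V : lmodType K) (F : V -> A -> B -> U) x :
  (forall a b, lin (fun w => F w a b)) -> lin (fun w => text (F w) x).
Proof.
move=> Fl a w w'; rewrite /text /tsum scaler_sumr -big_split /=.
by apply: eq_bigr => p _; apply: Fl.
Qed.

Let tb := @tns_bilin K A B.

Let dFt U F a b : bilin F -> text (@dF U F) (tns a b) = dF F a b.
Proof. by move=> /dF_bilin ?; rewrite text_tns. Qed.

Let tdelta_lin U (F : tensor A B -> tensor A B -> U) :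
  bilin F -> lin (fun x => tsum F (tdelta x)).
Proof. by move=> Fb a x y; rewrite !tdeltaE text_lin //; exact: dF_bilin. Qed.

Let tdeltaA x U (F : tensor A B -> tensor A B -> tensor A B -> U) : trilin F ->
  tsum (fun u v => tsum (fun a b => F a b v) (tdelta u)) (tdelta x) =
  tsum (fun u v => tsum (fun a b => F u a b) (tdelta v)) (tdelta x).
Proof.
move=> Ft; rewrite !tdeltaE.
have B1 : bilin (fun u v => tsum (fun a b => F a b v) (tdelta u)).
  apply: bilinP => w; first by move=> a u v; rewrite !tdeltaE text_lin //; apply: dF_bilin; mlin.
  move=> a u v; rewrite !tdeltaE; move: a u v.
  by apply: (lin_textr (F := fun v a b => dF (fun a b => F a b v) a b)); rewrite /dF => *; mlin.
have B2 : bilin (fun u v => tsum (fun a b => F u a b) (tdelta v)).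
  apply: bilinP => w; last by move=> a u v; rewrite !tdeltaE text_lin //; apply: dF_bilin; mlin.
  move=> a u v; rewrite !tdeltaE; move: a u v.
  by apply: (lin_textr (F := fun v a b => dF (F v) a b)); rewrite /dF => *; mlin.
(* On a pure tensor the sum splits into a part for [a] and a part for [b], and coassociativity is
   applied to each separately. *)
apply: (tensor_ext (text_lin (dF_bilin B1)) (text_lin (dF_bilin B2))) => {x} a b.
rewrite !dFt // /dF.
transitivity (csw a (fun u v => csw u (fun c d => csw b (fun u' v' => csw u' (fun c' d' =>
   F (tns c c') (tns d d') (tns v v')))))).
  apply: eq_csw => u v; rewrite csw_exch; apply: eq_csw => u' v'.
  by rewrite tdeltaE dFt //; mlin.
transitivity (csw a (fun u v => csw v (fun c d => csw b (fun u' v' => csw v' (fun c' d' =>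
   F (tns u u') (tns c c') (tns d d')))))); last first.
  apply: eq_csw => u v; rewrite csw_exch; apply: eq_csw => u' v'.
  by rewrite tdeltaE dFt //; mlin.
rewrite (cswA a (F := fun c d v => csw b (fun u' v' => csw u' (fun c' d' =>
   F (tns c c') (tns d d') (tns v v'))))); last mlin.
apply: eq_csw => u v; apply: eq_csw => c d.
by rewrite (cswA b (F := fun c' d' v' => F (tns u c') (tns c d') (tns d v'))) //; mlin.
Qed.

Let tdeltaC x U (F : tensor A B -> tensor A B -> U) : bilin F ->
  tsum F (tdelta x) = tsum (fun u v => F v u) (tdelta x).
Proof.
move=> Fb; rewrite !tdeltaE; move: x.
have Fb' : bilin (fun u v => F v u) by mlin.
apply: (tensor_ext (text_lin (dF_bilin Fb)) (text_lin (dF_bilin Fb'))) => a b.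
rewrite !dFt // /dF cswC; last mlin.
by apply: eq_csw => u v; rewrite cswC //; mlin.
Qed.

Let teps_lin : @lin K (tensor A B) K^o teps.
Proof. exact: text_lin. Qed.

Let tdelta_eps x : tsum (fun u v => teps u *: v) (tdelta x) = x.
Proof.
rewrite tdeltaE; move: x.
have te a b : teps (tns a b) = ceps a * ceps b by rewrite /teps text_tns.
have tl : lin (teps : tensor A B -> K^o) by exact: text_lin.
pose T : lmodType K := tensor A B.
have Fb : @bilin K T T T (fun u v => teps u *: v) by mlin.
apply: (tensor_ext (g := fun x => x) (text_lin (dF_bilin Fb))); first exact: lin_id.
move=> a b; rewrite dFt // /dF.
transitivity (csw a (fun u v => ceps u *: csw b (fun u' v' => ceps u' *: tns v v'))).
  apply: eq_csw => u v; rewrite (lin_csw (g := fun z => _ *: z)); last mlin.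
  by apply: eq_csw => u' v'; rewrite te scalerA.
rewrite csw_epsl; last mlin.
by rewrite csw_epsl; mlin.
Qed.

Definition tcoalg : coalg K := Coalg tdelta_lin tdeltaA tdeltaC teps_lin tdelta_eps.

Definition tpure : bimor A B tcoalg.
Proof.
exists (fun (a : A) (b : B) => tns a b : tcoalg).
- exact: tns_bilin.
- by move=> a b U F Fb; rewrite /csw tdeltaE text_tns //; exact: dF_bilin.
- by move=> a b; rewrite /ceps /= /teps text_tns.
Defined.

Section Lift.
Variables (D : coalg K) (f : bimor A B D).
Let fb := bimor_bilin f.
Let fl := text_lin fb.

Let tlift_sw x U (F : D -> D -> U) : bilin F ->
  csw (text f x) F = @csw K tcoalg U x (fun u v => F (text f u) (text f v)).
Proof.
move=> Fb; move: x.
have Gb : @bilin K tcoalg tcoalg U (fun u v => F (text f u) (text f v)) by mlin.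
apply: (tensor_ext (lin_comp (csw_lin Fb) fl) (csw_lin Gb)) => a b.
rewrite text_tns // bimor_sw // (bimor_sw tpure) //.
by apply: eq_csw => u v; apply: eq_csw => u' v'; rewrite /= !text_tns.
Qed.

Let tlift_eps x : ceps (text f x) = @ceps K tcoalg x.
Proof.
have el := @ceps_lin K D; move: x.
apply: (tensor_ext (lin_comp el fl) (@ceps_lin K tcoalg)) => a b.
by rewrite text_tns // bimor_eps (bimor_eps tpure).
Qed.

Definition tlift : cmor tcoalg D := @Cmor K tcoalg D (text f) fl tlift_sw tlift_eps.

Lemma tlift_pure a b : tlift (tpure a b) = f a b.
Proof. by rewrite /= text_tns. Qed.
End Lift.

Lemma tcoalg_ext (D : coalg K) (f g : cmor tcoalg D) :
  (forall a b, f (tpure a b) = g (tpure a b)) -> f = g.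
Proof. by move=> fg; apply: cmor_ext; apply: (tensor_ext (cmor_lin f) (cmor_lin g)). Qed.

End TensorCoalgebra.

(** Such an element amounts to a coalgebra map from the base field; composed with the counit of [E]
    it becomes the constant point [cone], which provides the units of the groups below. *)
Definition grouplike (K : fieldType) (C : coalg K) (x : C) :=
  ceps x = 1 /\ forall (U : lmodType K) (F : C -> C -> U), bilin F -> csw x F = F x x.

Section Product.
Variable K : fieldType.
Variables A B : coalg K.
Implicit Types U : lmodType K.

Definition bproj1 : bimor A B A.
Proof.
exists (fun a b => ceps b *: a); first mlin.
- move=> a b U F Fb; rewrite (linZ (csw_lin Fb)) (lin_csw (g := fun z => _ *: z)); last mlin.
  apply: eq_csw => u v.
  rewrite -(csw_epsl b (g := fun z => ceps z *: F u v)); last mlin.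
  apply: eq_csw => u' v'.
  by rewrite (linZ (bilin_l _ Fb (@lin_id _ _))) (linZ (bilin_r _ Fb (@lin_id _ _))).
- by move=> a b; rewrite (linZ (@ceps_lin _ A : lin (@ceps K A : A -> K^o))) mulrC.
Defined.

Definition bproj2 : bimor A B B.
Proof.
exists (fun a b => ceps a *: b); first mlin.
- move=> a b U F Fb; rewrite (linZ (csw_lin Fb)).
  rewrite -(csw_epsl a (g := fun z => ceps z *: csw b F)); last mlin.
  apply: eq_csw => u' v'.
  rewrite (lin_csw (g := fun z => _ *: z)); last mlin.
  rewrite (lin_csw (g := fun z => _ *: z)); last mlin.
  apply: eq_csw => u v.
  by rewrite (linZ (bilin_l _ Fb (@lin_id _ _))) (linZ (bilin_r _ Fb (@lin_id _ _))).
- by move=> a b; rewrite (linZ (@ceps_lin _ B : lin (@ceps K B : B -> K^o))).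
Defined.

(* The tensor product is the cartesian product of cocommutative coalgebras. *)
Record prodspec := Prodspec {
  pcar :> coalg K;
  pfst : cmor pcar A;
  psnd : cmor pcar B;
  ppair : forall E, cmor E A -> cmor E B -> cmor E pcar;
  ppure : bimor A B pcar;
  ppairE : forall E (x : cmor E A) (y : cmor E B), ppair x y = ap ppure x y;
  pfst_pair : forall E (x : cmor E A) (y : cmor E B), ccomp pfst (ppair x y) = x;
  psnd_pair : forall E (x : cmor E A) (y : cmor E B), ccomp psnd (ppair x y) = y;
  ppair_eta : forall E (z : cmor E pcar), ppair (ccomp pfst z) (ccomp psnd z) = z;
  psw_pure : forall (U : lmodType K) (F : A -> B -> U) a b, bilin F ->
    csw (ppure a b) (fun u v => F (pfst u) (psnd v)) = F a b;
  ppure_grouplike : forall a b, grouplike a -> grouplike b -> grouplike (ppure a b)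
}.

(** Closed by [Qed], so that the tensor product is known afterwards only through the fields of
    [prodspec]. *)
Definition product : prodspec.
Proof.
pose P := tcoalg A B.
pose p1 : cmor P A := tlift bproj1.
pose p2 : cmor P B := tlift bproj2.
have p1E a b : p1 (tpure A B a b) = ceps b *: a by rewrite tlift_pure.
have p2E a b : p2 (tpure A B a b) = ceps a *: b by rewrite tlift_pure.
have tb := bimor_bilin (tpure A B).
(* The coproduct followed by both projections gives a pure tensor back. This one computation yields
   the uniqueness of pairings as well as the evaluation at the universal point. *)
have psw U (F : A -> B -> U) a b : bilin F ->
    csw (tpure A B a b) (fun u v => F (p1 u) (p2 v)) = F a b.
  move=> Fb; rewrite (bimor_sw (tpure A B)); last mlin.
  rewrite -[RHS](csw_epsr a (g := fun z => F z b)); last mlin.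
  apply: eq_csw => u v.
  rewrite -(csw_epsl b (g := fun z => F u z)); last mlin.
  rewrite (lin_csw (g := fun z => _ *: z)); last mlin.
  apply: eq_csw => u' v'.
  rewrite p1E p2E (linZ (bilin_l _ Fb (@lin_id _ _))) (linZ (bilin_r _ Fb (@lin_id _ _))).
  by rewrite !scalerA mulrC.
exists P p1 p2 (fun E x y => ap (tpure A B) x y) (tpure A B) => //.
- move=> E x y; apply: cmor_ext => e.
  rewrite -[LHS]/(p1 (csw e (fun u v => tpure A B (x u) (y v)))).
  rewrite (lin_csw (g := p1)); last mlin.
  transitivity (csw e (fun u v => ceps v *: x u)); last by apply: csw_epsr; mlin.
  by apply: eq_csw => u v; rewrite p1E cmor_eps.
- move=> E x y; apply: cmor_ext => e.
  rewrite -[LHS]/(p2 (csw e (fun u v => tpure A B (x u) (y v)))).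
  rewrite (lin_csw (g := p2)); last mlin.
  transitivity (csw e (fun u v => ceps u *: y v)); last by apply: csw_epsl; mlin.
  by apply: eq_csw => u v; rewrite p2E cmor_eps.
- move=> E z; rewrite -ap_comp -[RHS]ccomp1f; congr (ccomp _ z).
  apply: tcoalg_ext => a b; rewrite apE.
  exact: (psw _ (tpure A B)).
- move=> a b [ea ag] [eb bg]; split; first by rewrite (bimor_eps (tpure A B)) ea eb mulr1.
  move=> U F Fb; rewrite (bimor_sw (tpure A B)) // ag; last mlin.
  by rewrite bg //; mlin.
Qed.

End Product.

(** * Cocommutative Hopf algebras as group objects *)

Section HopfCoalgebra.
Variables (K : fieldType) (H : hopf K).
Implicit Types U : lmodType K.

Let hdelta_lin U (F : H -> H -> U) : bilin F -> lin (fun x => tsum F (hcomul x)).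
Proof.
move=> Fb a x y; rewrite (hcomul_lin a x y Fb) /tsum big_cat /= big_map scaler_sumr.
by congr (_ + _); apply: eq_bigr => p _; apply: (linZ (bilin_l p.2 Fb (@lin_id _ _))).
Qed.

Let hdeltaA x U (F : H -> H -> H -> U) : trilin F ->
  tsum (fun u v => tsum (fun a b => F a b v) (hcomul u)) (hcomul x) =
  tsum (fun u v => tsum (fun a b => F u a b) (hcomul v)) (hcomul x).
Proof. by move=> /(hcomulA x); rewrite !big_allpairs_dep. Qed.

Let hdeltaC x U (F : H -> H -> U) : bilin F ->
  tsum F (hcomul x) = tsum (fun u v => F v u) (hcomul x).
Proof. by move=> Fb; rewrite (hcocomm x Fb) /tsum big_map. Qed.

Let heps_lin : @lin K H K^o (@hcounit K H).
Proof. exact: hcounit_lin. Qed.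

Definition hopf_coalg : coalg K :=
  Coalg hdelta_lin hdeltaA hdeltaC heps_lin (@hcounitl K H).

End HopfCoalgebra.
Canonical hopf_coalg.
Coercion hopf_coalg : hopf >-> coalg.

Section HopfMaps.
Variables (K : fieldType) (H : hopf K).
Implicit Types U : lmodType K.

Let hmul_sw (a b : H) U (F : H -> H -> U) : bilin F ->
  csw (hmul a b) F = csw a (fun u v => csw b (fun u' v' => F (hmul u u') (hmul v v'))).
Proof. by move=> Fb; rewrite /csw /= (hcomulM a b Fb) /tsum big_allpairs_dep. Qed.

Definition hmulb : bimor H H H := @Bimor K H H H _ (@hmul_bilin K H) hmul_sw (@hcounitM K H).

Lemma hone_grouplike : @grouplike K H (hone H).
Proof.
split; first exact: hcounit1.
by move=> U F Fb; rewrite /csw /= (hcomul1 Fb) /tsum big_seq1.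
Qed.

Let S : H -> H := @hanti K H.
Let Sl : lin S. Proof. exact: hanti_lin. Qed.
Let m := hmulb.

Let mS x : csw x (fun u v => m u (S v)) = ceps x *: hone H.
Proof. exact: hantir. Qed.
Let Sm x : csw x (fun u v => m (S u) v) = ceps x *: hone H.
Proof. exact: hantil. Qed.

(** Apply the counit to [S(x_1) x_2 = eps(x) 1] and use its multiplicativity. *)
Let hanti_eps (x : H) : ceps (S x) = ceps x.
Proof.
have el := @ceps_lin K H.
rewrite -[LHS](csw_epsr x (lin_comp el Sl)).
transitivity (ceps (csw x (fun u v => m (S u) v))); last first.
  by rewrite Sm (linZ el) (proj1 hone_grouplike) -[LHS]/(_ * _) mulr1.
rewrite (lin_csw (g := (@ceps K H : H -> K^o))) //.
by apply: (@eq_csw _ _ K^o) => u v; rewrite bimor_eps mulrC.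
Qed.

(* [Delta S] and [(S (x) S) Delta] are both convolution inverse to [Delta]. *)
Let hanti_sw (x : H) U (F : H -> H -> U) : bilin F ->
  csw (S x) F = csw x (fun u v => F (S u) (S v)).
Proof.
move=> Fb.
(* [G] evaluates [F] on [(p (x) q) Delta(y) (S (x) S)Delta(z)]. With [p (x) q = Delta(S x_1)],
   [y = x_2] and [z = x_3], cancelling the last two factors leaves [Delta(S x)], while cancelling
   the first two leaves [(S (x) S)Delta(x)]. *)
pose G p q y z := csw y (fun a b => csw z (fun c d => F (m (m p a) (S c)) (m (m q b) (S d)))).
transitivity (csw x (fun x1 y => csw y (fun x2 x3 => csw (S x1) (fun p q => G p q x2 x3)))).
  rewrite -[LHS](csw_epsr x (g := fun z => csw (S z) F)); last mlin.
  apply: eq_csw => x1 y; rewrite csw_exch (lin_csw (g := fun z => _ *: z)); last mlin.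
  apply: eq_csw => p q; rewrite /G csw_swap; last mlin.
  transitivity (csw y (fun x2 x3 => ceps x2 *: (ceps x3 *: F p q))).
    by rewrite csw_epsl; mlin.
  apply: eq_csw => x2 x3.
  transitivity (csw x2 (fun a c => F (m p (m a (S c))) (ceps x3 *: q))).
    rewrite -(lin_csw (g := fun z => F (m p z) _)); last mlin.
    rewrite mS (linZ (bilin_r _ (bimor_bilin m) (@lin_id _ _))) -[m p _]/(hmul p _) hmulx1.
    by rewrite (linZ (bilin_l _ Fb (@lin_id _ _))) (linZ (bilin_r _ Fb (@lin_id _ _))).
  apply: eq_csw => a c.
  transitivity (F (m p (m a (S c))) (csw x3 (fun b d => m q (m b (S d))))).
    rewrite -(lin_csw (g := fun z => m q z)); last mlin.
    by rewrite mS (linZ (bilin_r _ (bimor_bilin m) (@lin_id _ _))) -[m q _]/(hmul q _) hmulx1.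
  rewrite (lin_csw (g := fun z => F _ z)); last mlin.
  by apply: eq_csw => b d; rewrite /m /= !hmulA.
rewrite -(cswA x (F := fun x1 x2 x3 => csw (S x1) (fun p q => G p q x2 x3))); last first.
  by rewrite /G; mlin.
transitivity (csw x (fun y x3 => ceps y *: csw x3 (fun c d => F (S c) (S d)))); last first.
  by rewrite csw_epsl; mlin.
apply: eq_csw => y x3.
pose J := fun p q => csw x3 (fun c d => F (m p (S c)) (m q (S d))).
have Jb : bilin J by rewrite /J; mlin.
transitivity (csw (csw y (fun x1 x2 => m (S x1) x2)) J).
  rewrite (lin_csw (g := fun z => csw z J)); last mlin.
  by apply: eq_csw => x1 x2; rewrite bimor_sw.
rewrite Sm (linZ (csw_lin Jb)) (proj2 hone_grouplike) // /J.
by congr (_ *: _); apply: eq_csw => c d; rewrite /m /= !hmul1x.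
Qed.

Definition hS : cmor H H := @Cmor K H H S Sl hanti_sw hanti_eps.

End HopfMaps.

Definition cone (K : fieldType) (E C : coalg K) (o : C) (og : grouplike o) : cmor E C.
Proof.
exists (fun e => ceps e *: o); first mlin.
- move=> x U F Fb; rewrite (linZ (csw_lin Fb)) (proj2 og) //.
  rewrite -(csw_epsl x (g := fun z => ceps z *: F o o)); last mlin.
  apply: eq_csw => u v.
  by rewrite (linZ (bilin_l _ Fb (@lin_id _ _))) (linZ (bilin_r _ Fb (@lin_id _ _))).
- by move=> x; rewrite (linZ (@ceps_lin K C)) (proj1 og) -[LHS]/(_ * _) mulr1.
Defined.

(** * Sweedler identities and points *)

Section Points.
Variable K : fieldType.
Implicit Types (U : lmodType K) (A B C D E : coalg K).

(** The value at [e] of an expression whose variables are replaced by points. A variable that an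
    identity uses twice is comultiplied inside [F], not here. *)
Definition bisw A B U E (F : A -> B -> U) (x : cmor E A) (y : cmor E B) (e : E) : U :=
  csw e (fun u v => F (x u) (y v)).

Definition trisw A B C U E (F : A -> B -> C -> U) (x : cmor E A) (y : cmor E B) (z : cmor E C)
    (e : E) : U :=
  csw e (fun u v => csw v (fun v1 v2 => F (x u) (y v1) (z v2))).

Lemma eq_bisw A B U E (F G : A -> B -> U) (x : cmor E A) (y : cmor E B) e :
  (forall a b, F a b = G a b) -> bisw F x y e = bisw G x y e.
Proof. by move=> FG; apply: eq_csw => u v. Qed.

Lemma eq_trisw A B C U E (F G : A -> B -> C -> U) (x : cmor E A) (y : cmor E B)
    (z : cmor E C) e :
  (forall a b c, F a b c = G a b c) -> trisw F x y z e = trisw G x y z e.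
Proof. by move=> FG; apply: eq_csw => u v; apply: eq_csw => v1 v2. Qed.

(* Evaluating at the universal point of [A (x) B]. *)
Lemma bisw_ext A B U (F G : A -> B -> U) : bilin F -> bilin G ->
  (forall E (x : cmor E A) (y : cmor E B) e, bisw F x y e = bisw G x y e) ->
  forall a b, F a b = G a b.
Proof.
move=> Fb Gb FG a b.
have := FG _ (pfst (product A B)) (psnd (product A B)) (ppure (product A B) a b).
by rewrite /bisw !psw_pure.
Qed.

Lemma trisw_ext A B C U (F G : A -> B -> C -> U) : trilin F -> trilin G ->
  (forall E (x : cmor E A) (y : cmor E B) (z : cmor E C) e, trisw F x y z e = trisw G x y z e) ->
  forall a b c, F a b c = G a b c.
Proof.
move=> Ft Gt FG a b c; pose P := product B C; pose Q := product A P.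
(* The three coordinates of the iterated product form the universal triple of points; evaluated on a
   pure tensor, they return [H a b c]. *)
have ev (H : A -> B -> C -> U) : trilin H ->
    trisw H (pfst Q) (ccomp (pfst P) (psnd Q)) (ccomp (psnd P) (psnd Q))
      (ppure Q a (ppure P b c)) = H a b c.
  move=> Ht; rewrite /trisw.
  transitivity (csw (ppure Q a (ppure P b c)) (fun u v =>
      csw (psnd Q v) (fun v1 v2 => H (pfst Q u) (pfst P v1) (psnd P v2)))).
    by apply: eq_csw => u v; rewrite cmor_sw //; mlin.
  rewrite (psw_pure Q (F := fun a w => csw w (fun v1 v2 => H a (pfst P v1) (psnd P v2)))).
    by rewrite psw_pure //; mlin.
  by mlin.
by rewrite -ev // FG ev.
Qed.

Definition bcomp A B D A' B' (f : bimor A B D) (g : cmor A' A) (g' : cmor B' B) :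
  bimor A' B' D.
Proof.
exists (fun a b => f (g a) (g' b)); first mlin.
- move=> a b U F Fb; rewrite bimor_sw // cmor_sw; last mlin.
  by apply: eq_csw => u v; rewrite cmor_sw //; mlin.
- by move=> a b; rewrite bimor_eps !cmor_eps.
Defined.

Lemma ap_bcomp A B D A' B' (f : bimor A B D) (g : cmor A' A) (g' : cmor B' B)
    E (x : cmor E A') (y : cmor E B') :
  ap (bcomp f g g') x y = ap f (ccomp g x) (ccomp g' y).
Proof. exact: cmor_ext. Qed.

Lemma ap_ap_l A B C D D' E (f : bimor D C D') (g : bimor A B D)
    (x : cmor E A) (y : cmor E B) (z : cmor E C) e :
  ap f (ap g x y) z e = trisw (fun a b c => f (g a b) c) x y z e.
Proof.
rewrite /trisw -(cswA e (F := fun a b c => f (g (x a) (y b)) (z c))); last mlin.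
rewrite apE; apply: eq_csw => u v; rewrite apE.
by rewrite (lin_csw (g := fun t => f t _)) //; mlin.
Qed.

Lemma ap_ap_r A B C D D' E (f : bimor A D D') (g : bimor B C D)
    (x : cmor E A) (y : cmor E B) (z : cmor E C) e :
  ap f x (ap g y z) e = trisw (fun a b c => f a (g b c)) x y z e.
Proof.
rewrite apE; apply: eq_csw => u v; rewrite apE.
by rewrite (lin_csw (g := fun t => f _ t)) //; mlin.
Qed.

(** Each occurrence of a repeated point receives its own leg of [e]. Coassociativity and
    cocommutativity of [E] bring these legs together, and comultiplicativity of the point turns them
    into Sweedler legs of its value. The digits in this family name the repeated arguments. *)
Lemma ap_dup1 A B C D D' D'' E (f : bimor D D' D'') (g : bimor A B D) (h : bimor A C D')
    (x : cmor E A) (y : cmor E B) (z : cmor E C) e :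
  ap f (ap g x y) (ap h x z) e =
  trisw (fun a b c => csw a (fun a1 a2 => f (g a1 b) (h a2 c))) x y z e.
Proof.
transitivity (csw e (fun u v => csw u (fun u1 u2 => csw v (fun v1 v2 =>
   f (g (x u1) (y u2)) (h (x v1) (z v2)))))).
  rewrite apE; apply: eq_csw => u v; rewrite !apE.
  rewrite (lin_csw (g := fun t => f t _)); last mlin.
  by apply: eq_csw => u1 u2; rewrite (lin_csw (g := fun t => f _ t)) //; mlin.
rewrite csw_swap; last mlin.
apply: eq_csw => u v; rewrite csw_exch; apply: eq_csw => v1 v2.
by rewrite cmor_sw //; mlin.
Qed.

(** The pattern of a conjugation [b x b^-1]: the two legs of the first argument stand on either side
    of the second. *)
Lemma ap_dup_l A B D D' A' E (f : bimor D A' D') (g : bimor A B D) (h : cmor A A')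
    (x : cmor E A) (y : cmor E B) e :
  ap f (ap g x y) (ccomp h x) e =
  bisw (fun a b => csw a (fun a1 a2 => f (g a1 b) (h a2))) x y e.
Proof.
transitivity (csw e (fun u v => csw v (fun v1 v2 => f (g (x u) (y v1)) (h (x v2))))).
  by rewrite ap_ap_l.
transitivity (csw e (fun u v => csw v (fun v1 v2 => f (g (x u) (y v2)) (h (x v1))))).
  by apply: eq_csw => u v; rewrite cswC //; mlin.
rewrite -(cswA e (F := fun u v1 v2 => f (g (x u) (y v2)) (h (x v1)))); last mlin.
by apply: eq_csw => u v; rewrite cmor_sw //; mlin.
Qed.

Lemma ap_dup_r A B D D' B' E (f : bimor D B' D') (g : bimor A B D) (h : cmor B B')
    (x : cmor E A) (y : cmor E B) e :
  ap f (ap g x y) (ccomp h y) e =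
  bisw (fun a b => csw b (fun b1 b2 => f (g a b1) (h b2))) x y e.
Proof.
rewrite ap_ap_l; apply: eq_csw => u v; rewrite cmor_sw //; mlin.
Qed.

(** The pattern of [m (nu(n) |> m)^-1]. *)
Lemma ap_dup_m A B D D' E (f : bimor A D D') (g : bimor B A D)
    (x : cmor E A) (y : cmor E B) e :
  ap f x (ap g y x) e =
  bisw (fun a b => csw a (fun a1 a2 => f a1 (g b a2))) x y e.
Proof.
transitivity (csw e (fun u v => csw v (fun v1 v2 => f (x u) (g (y v2) (x v1))))).
  rewrite ap_ap_r; apply: eq_csw => u v.
  by rewrite cswC //; mlin.
rewrite -(cswA e (F := fun u v1 v2 => f (x u) (g (y v2) (x v1)))); last mlin.
by apply: eq_csw => u v; rewrite cmor_sw //; mlin.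
Qed.

Lemma csw_perm12 C U (x : C) (F : C -> C -> C -> U) : trilin F ->
  csw x (fun u v => csw v (F u)) = csw x (fun u v => csw v (fun a b => F a u b)).
Proof.
move=> Ft; rewrite -(cswA x Ft) -(cswA x (F := fun a b c => F b a c)); last mlin.
by apply: eq_csw => u v; rewrite cswC //; mlin.
Qed.

(** The pattern of the expansion of [h(m, n n')], where both [m] and [n] occur twice. *)
Lemma ap_dup12_r A B C D L E (f : bimor D D L) (g : bimor B D D) (h : bimor A B D)
    (h' : bimor A C D) (x : cmor E A) (y : cmor E B) (z : cmor E C) e :
  ap f (ap h x y) (ap g y (ap h' x z)) e =
  trisw (fun a b c => csw a (fun a1 a2 => csw b (fun b1 b2 => f (h a1 b1) (g b2 (h' a2 c)))))
    x y z e.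
Proof.
pose R u1 u2 p q r := f (h (x u1) (y u2)) (g (y p) (h' (x q) (z r))).
transitivity (csw e (fun u v => csw u (fun u1 u2 => csw v (fun w1 v' => csw v' (fun w2 r =>
  R u1 u2 w2 w1 r))))).
  rewrite apE; apply: eq_csw => u v; rewrite !apE.
  rewrite (lin_csw (g := fun t => f t _)); last mlin.
  apply: eq_csw => u1 u2; rewrite -csw_perm12; last by rewrite /R; mlin.
  rewrite (lin_csw (g := fun t => f _ t)); last mlin.
  apply: eq_csw => v1 v2; rewrite apE (lin_csw (g := fun t => f _ (g _ t))) //; mlin.
rewrite (csw_swap e (F := fun u1 u2 w1 v' => csw v' (fun w2 r => R u1 u2 w2 w1 r))); last first.
  by rewrite /R; mlin.
apply: eq_csw => u v.
transitivity (csw v (fun v1 v2 => csw u (fun u1 u2 => csw v1 (fun w1 w2 => R u1 w1 w2 u2 v2)))).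
  rewrite [RHS]csw_exch; apply: eq_csw => u1 u2.
  by rewrite (cswA v (F := fun w1 w2 v2 => R u1 w1 w2 u2 v2)) //; rewrite /R; mlin.
apply: eq_csw => v1 v2; rewrite cmor_sw; last mlin.
by apply: eq_csw => u1 u2; rewrite cmor_sw //; mlin.
Qed.

(** The mirror pattern, for the expansion of [h(m m', n)]. *)
Lemma ap_dup13_l A B C D L E (f : bimor D D L) (g : bimor A D D) (h : bimor B C D)
    (h' : bimor A C D) (x : cmor E A) (y : cmor E B) (z : cmor E C) e :
  ap f (ap g x (ap h y z)) (ap h' x z) e =
  trisw (fun a b c => csw a (fun a1 a2 => csw c (fun c1 c2 => f (g a1 (h b c1)) (h' a2 c2))))
    x y z e.
Proof.
pose R p q r u v := f (g (x p) (h (y q) (z r))) (h' (x u) (z v)).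
transitivity (csw e (fun u v => csw u (fun u1 u2 => csw v (fun v' w2 => csw u2 (fun v1 w1 =>
  R u1 v1 w1 v' w2))))).
  rewrite apE; apply: eq_csw => u v; rewrite !apE.
  rewrite (lin_csw (g := fun t => f t _)); last mlin.
  apply: eq_csw => u1 u2; rewrite (lin_csw (g := fun t => f _ t)); last mlin.
  apply: eq_csw => v1 v2; rewrite apE (lin_csw (g := fun t => f (g _ t) _)) //; mlin.
rewrite (csw_swap e (F := fun u1 u2 v' w2 => csw u2 (fun v1 w1 => R u1 v1 w1 v' w2))); last first.
  by rewrite /R; mlin.
apply: eq_csw => u v.
transitivity (csw v (fun v1 v2 => csw u (fun u1 u2 => csw v2 (fun w1 w2 => R u1 v1 w1 u2 w2)))).
  rewrite [RHS]csw_exch; apply: eq_csw => u1 u2.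
  by rewrite (cswA v (F := fun v1 w1 w2 => R u1 v1 w1 u2 w2)) //; rewrite /R; mlin.
apply: eq_csw => v1 v2; rewrite cmor_sw; last mlin.
by apply: eq_csw => u1 u2; rewrite cmor_sw //; mlin.
Qed.

(* Yoneda: a natural operation on points is given by a morphism. *)
Section Yoneda.
Variables (A B D : coalg K) (op : forall E, cmor E A -> cmor E B -> cmor E D).
Hypothesis op_nat : forall E E' (g : cmor E' E) x y,
  ccomp (op x y) g = op (ccomp x g) (ccomp y g).
Let P := product A B.
Let f : cmor P D := op (pfst P) (psnd P).

Let ybi_sw a b U (F : D -> D -> U) : bilin F ->
  csw (f (ppure P a b)) F =
  csw a (fun u v => csw b (fun u' v' => F (f (ppure P u u')) (f (ppure P v v')))).
Proof. by move=> Fb; rewrite cmor_sw // bimor_sw //; mlin. Qed.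

Let ybi_bilin : bilin (fun a b => f (ppure P a b)). Proof. mlin. Qed.
Let ybi_eps a b : ceps (f (ppure P a b)) = ceps a * ceps b.
Proof. by rewrite cmor_eps bimor_eps. Qed.

Definition ybi : bimor A B D := Bimor ybi_bilin ybi_sw ybi_eps.

(** Every pair of points is the universal pair precomposed with [ppair P x y], so naturality
    determines the operation by its universal value [f]. *)
Lemma ap_ybi E (x : cmor E A) (y : cmor E B) : ap ybi x y = op x y.
Proof.
transitivity (ccomp f (ppair P x y)); last by rewrite op_nat pfst_pair psnd_pair.
apply: cmor_ext => e; rewrite apE /ccomp /= ppairE apE.
by rewrite (lin_csw (g := f)) //; mlin.
Qed.
End Yoneda.

End Points.

Declare Scope point_scope.
Delimit Scope point_scope with pt.

Definition pmul (K : fieldType) (E : coalg K) (H : hopf K) (x y : cmor E H) : cmor E H :=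
  ap (hmulb H) x y.
Definition pinv (K : fieldType) (E : coalg K) (H : hopf K) (x : cmor E H) : cmor E H :=
  ccomp (hS H) x.
Definition pone (K : fieldType) (E : coalg K) (H : hopf K) : cmor E H :=
  cone E (hone_grouplike H).

Notation "x * y" := (pmul x y) : point_scope.
Notation "x ^-1" := (pinv x) : point_scope.
Notation "1" := (pone _ _) : point_scope.
Notation "f @@ x" := (ccomp f x) (at level 35, right associativity) : point_scope.
Local Open Scope point_scope.

(** * The convolution group of points of a Hopf algebra *)

Section PointGroup.
Variables (K : fieldType) (E : coalg K) (H : hopf K).
Implicit Types x y z : cmor E H.

Lemma pmulE x y e : (x * y) e = csw e (fun u v => hmulb H (x u) (y v)).
Proof. by []. Qed.

Lemma pmulA x y z : (x * y) * z = x * (y * z).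
Proof.
apply: cmor_ext => e; rewrite /pmul ap_ap_l ap_ap_r.
by apply: eq_trisw => a b c; rewrite /= hmulA.
Qed.

Lemma pmul1 x : 1 * x = x.
Proof.
apply: cmor_ext => e; rewrite pmulE -[RHS](csw_epsl e (cmor_lin x)).
apply: eq_csw => u v /=.
by rewrite (linZ (bilin_l _ (@hmul_bilin K H) (@lin_id _ _))) hmul1x.
Qed.

Lemma pmulx1 x : x * 1 = x.
Proof.
apply: cmor_ext => e; rewrite pmulE -[RHS](csw_epsr e (cmor_lin x)).
apply: eq_csw => u v /=.
by rewrite (linZ (bilin_r _ (@hmul_bilin K H) (@lin_id _ _))) hmulx1.
Qed.

Lemma pmulV x : x * x^-1 = 1.
Proof.
apply: cmor_ext => e; rewrite pmulE.
have := hantir (x e); rewrite -[tsum _ _]/(csw (x e) (fun u v => hmulb H u (hS H v))).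
by rewrite cmor_sw; [rewrite -[hcounit _]/(ceps (x e)) cmor_eps | mlin].
Qed.

Lemma pmulVx x : x^-1 * x = 1.
Proof.
apply: cmor_ext => e; rewrite pmulE.
have := hantil (x e); rewrite -[tsum _ _]/(csw (x e) (fun u v => hmulb H (hS H u) v)).
by rewrite cmor_sw; [rewrite -[hcounit _]/(ceps (x e)) cmor_eps | mlin].
Qed.

Lemma pmulVK x y : x^-1 * (x * y) = y.
Proof. by rewrite -pmulA pmulVx pmul1. Qed.
Lemma pmulKV x y : x * (x^-1 * y) = y.
Proof. by rewrite -pmulA pmulV pmul1. Qed.

Lemma pmulI x y z : x * y = x * z -> y = z.
Proof. by move=> xyz; rewrite -(pmulVK x y) xyz pmulVK. Qed.
Lemma pmulIr x y z : y * x = z * x -> y = z.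
Proof. by move=> xyz; rewrite -(pmulx1 y) -(pmulV x) -pmulA xyz pmulA pmulV pmulx1. Qed.

Lemma pinvE x y : x * y = 1 -> y = x^-1.
Proof. by move=> xy; apply: (@pmulI x); rewrite xy pmulV. Qed.

Lemma pinvK x : x^-1^-1 = x.
Proof. by apply/esym/pinvE; rewrite pmulVx. Qed.
Lemma pinvM x y : (x * y)^-1 = y^-1 * x^-1.
Proof. by apply/esym/pinvE; rewrite pmulA pmulKV pmulV. Qed.
Lemma pinv1 : (1 : cmor E H)^-1 = 1.
Proof. by apply/esym/pinvE; rewrite pmul1. Qed.

Lemma pmul_id x : x * x = x -> x = 1.
Proof. by move=> xx; apply: (@pmulI x); rewrite xx pmulx1. Qed.

Lemma pmul_comp E' (g : cmor E' E) x y : (x * y) @@ g = (x @@ g) * (y @@ g).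
Proof. exact: ap_comp. Qed.
Lemma pinv_comp E' (g : cmor E' E) x : x^-1 @@ g = (x @@ g)^-1.
Proof. by rewrite /pinv ccompA. Qed.
Lemma pone_comp E' (g : cmor E' E) : (1 : cmor E H) @@ g = 1.
Proof. by apply: cmor_ext => e; rewrite /= cmor_eps. Qed.

End PointGroup.

(** The ten rules of the Knuth-Bendix completion of the group axioms: rewriting with them brings
    both sides of an identity between words to reduced form, so most group computations below end
    with [ptE]. *)
Definition ptE := (pmulA, pmul1, pmulx1, pmulV, pmulVx, pmulVK, pmulKV, pinvK, pinvM, pinv1).
Definition ptnat := (pmul_comp, pinv_comp, pone_comp, ap_comp, ccompf1).

(** Compatibility with unit and antipode is that of a group homomorphism, see [hm1] and [hmV]. *)
Record hmor (K : fieldType) (A B : hopf K) := Hmor {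
  hm :> cmor A B;
  hmM : forall E (x y : cmor E A), hm @@ (x * y) = (hm @@ x) * (hm @@ y)
}.

(** A module Hopf algebra seen on points: the group of points of [B] acts by automorphisms on that
    of [X]. *)
Record hact (K : fieldType) (B X : hopf K) := Hact {
  ha :> bimor B X X;
  haM : forall E (b b' : cmor E B) (x : cmor E X), ap ha (b * b') x = ap ha b (ap ha b' x);
  ha1 : forall E (x : cmor E X), ap ha 1 x = x;
  haD : forall E (b : cmor E B) (x y : cmor E X), ap ha b (x * y) = ap ha b x * ap ha b y
}.

Section HmorTheory.
Variable K : fieldType.
Implicit Types (A B X : hopf K) (E : coalg K).

Lemma hm1 A B (f : hmor A B) E : f @@ (1 : cmor E A) = 1.
Proof. by apply: pmul_id; rewrite -hmM pmul1. Qed.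

Lemma hmV A B (f : hmor A B) E (x : cmor E A) : f @@ x^-1 = (f @@ x)^-1.
Proof. by apply: pinvE; rewrite -hmM pmulV hm1. Qed.

Lemma haN B X (a : hact B X) E (b : cmor E B) : ap a b 1 = 1.
Proof. by apply: pmul_id; rewrite -haD pmul1. Qed.

Lemma haV B X (a : hact B X) E (b : cmor E B) x : ap a b x^-1 = (ap a b x)^-1.
Proof. by apply: pinvE; rewrite -haD pmulV haN. Qed.

Lemma haK B X (a : hact B X) E (b : cmor E B) x : ap a b (ap a b^-1 x) = x.
Proof. by rewrite -haM pmulV ha1. Qed.
Lemma haKV B X (a : hact B X) E (b : cmor E B) x : ap a b^-1 (ap a b x) = x.
Proof. by rewrite -haM pmulVx ha1. Qed.

Definition hid A : hmor A A.
Proof. by exists (cidm A) => E x y; rewrite !ccomp1f. Defined.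
Definition hcomp A B C (g : hmor B C) (f : hmor A B) : hmor A C.
Proof. by exists (g @@ f) => E x y; rewrite -!ccompA !hmM. Defined.

Lemma hmor_hopf_mor A B (f : hmor A B) : hopf_mor f.
Proof.
have fl := cmor_lin f; split=> //.
- apply: (bisw_ext (A := A) (B := A) (F := fun x y => f (hmulb A x y))
    (G := fun x y => hmulb B (f x) (f y))); [mlin | mlin |].
  move=> E x y e; transitivity ((f @@ (x * y)) e); last by rewrite hmM.
  by rewrite /= /csw /bisw (lin_csw (g := f)).
(* The constant point with domain [A] is evaluated at the element [hone A], whose counit is 1. *)
- have /(congr1 (fun g : cmor A B => g (hone A))) := @hm1 A B f A.
  by rewrite /= hcounit1 !scale1r.
- by move=> x U F Fb; rewrite -[LHS]/(csw (f x) F) cmor_sw // /csw /tsum big_map.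
- by move=> x; apply: cmor_eps.
Qed.

Section OfHopfMor.
Variables (A B : hopf K) (f : A -> B).
Hypothesis fm : hopf_mor f.
Let f_lin : lin f. Proof. by case: fm. Qed.
Let f_sw (x : A) (U : lmodType K) (F : B -> B -> U) : bilin F ->
  csw (f x) F = csw x (fun u v => F (f u) (f v)).
Proof. by case: fm => _ _ _ fs _ Fb; rewrite /csw /= (fs x _ _ Fb) /tsum big_map. Qed.
Let f_eps (x : A) : ceps (f x) = ceps x. Proof. by case: fm => _ _ _ _; apply. Qed.
Let fc : cmor A B := @Cmor K A B f f_lin f_sw f_eps.
Let f_mul E (x y : cmor E A) : fc @@ (x * y) = (fc @@ x) * (fc @@ y).
Proof.
case: fm => _ fM _ _ _; apply: cmor_ext => e; rewrite -[LHS]/(f ((x * y)%pt e)) !pmulE lin_csw //.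
by apply: eq_csw => u v; apply: fM.
Qed.
Definition of_hopf_mor : hmor A B := Hmor f_mul.
End OfHopfMor.

Lemma to_module_hopf B X (a : hact B X) : module_hopf a.
Proof.
have ab := bimor_bilin a; split=> //.
- apply: (trisw_ext (A := B) (B := B) (C := X) (F := fun b b' x => a (hmulb B b b') x)
    (G := fun b b' x => a b (a b' x))); [mlin | mlin |].
  by move=> E b b' x e; rewrite -ap_ap_l -ap_ap_r -haM.
- move=> x; rewrite -[RHS]/(cidm X x) -(ha1 a (cidm X)) apE /=.
  rewrite -[LHS](csw_epsl x (g := fun z => a (hone B) z)); last mlin.
  by apply: eq_csw => u v; rewrite (linZ (bilin_l _ ab (@lin_id _ _))).
- apply: (trisw_ext (A := B) (B := X) (C := X) (F := fun b x y => a b (hmulb X x y))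
    (G := fun b x y => csw b (fun b1 b2 => hmulb X (a b1 x) (a b2 y)))); [mlin | mlin |].
  by move=> E b x y e; rewrite -ap_ap_r -ap_dup1 -[ap (hmulb X) x y]/(x * y) haD.
- split.
  + move=> b; rewrite -[RHS]/((1 : cmor B X) b) -(haN a (cidm B)) apE /=.
    rewrite -[LHS](csw_epsr b (g := fun z => a z (hone X))); last mlin.
    by apply: eq_csw => u v; rewrite (linZ (bilin_r _ ab (@lin_id _ _))).
  + by move=> b x U F Fb; rewrite -[LHS]/(csw (a b x) F) bimor_sw // /csw /tsum big_allpairs_dep.
  + by move=> b x; apply: bimor_eps.
Qed.

Section OfModuleHopf.
Variables (B X : hopf K) (act : B -> X -> X).
Hypothesis am : module_hopf act.
Let act_bilin : bilin act. Proof. by case: am. Qed.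
Let act_sw (b : B) (x : X) (U : lmodType K) (F : X -> X -> U) : bilin F ->
  csw (act b x) F = csw b (fun u v => csw x (fun u' v' => F (act u u') (act v v'))).
Proof.
by case: am => _ _ _ _ [_ aD _] Fb; rewrite /csw /= (aD b x _ _ Fb) /tsum big_allpairs_dep.
Qed.
Let act_eps (b : B) (x : X) : ceps (act b x) = (ceps b * ceps x)%R.
Proof. by case: am => _ _ _ _ [_ _]; apply. Qed.
Let ab : bimor B X X := @Bimor K B X X act act_bilin act_sw act_eps.
Let actM E (b b' : cmor E B) (x : cmor E X) : ap ab (b * b') x = ap ab b (ap ab b' x).
Proof.
case: am => _ aM _ _ _; apply: cmor_ext => e; rewrite ap_ap_l ap_ap_r.
by apply: eq_trisw => u v w; apply: aM.
Qed.
Let act1 E (x : cmor E X) : ap ab 1 x = x.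
Proof.
case: am => _ _ a1 _ _; apply: cmor_ext => e; rewrite apE -[RHS](csw_epsl e (cmor_lin x)).
by apply: eq_csw => u v; rewrite /= (linZ (bilin_l _ act_bilin (@lin_id _ _))) a1.
Qed.
Let actD E (b : cmor E B) (x y : cmor E X) : ap ab b (x * y) = ap ab b x * ap ab b y.
Proof.
case: am => _ _ _ aD _; apply: cmor_ext => e; rewrite [RHS]ap_dup1 [LHS]ap_ap_r.
by apply: eq_trisw => u v w; apply: aD.
Qed.
Definition of_module_hopf : hact B X := Hact actM act1 actD.
End OfModuleHopf.

(** On points the two axioms on [d] are equivariance and the Peiffer identity of a crossed module of
    groups. [F1] and [F2] below are their Sweedler right-hand sides, identified with conjugations by
    [ap_dup_l]. *)
Lemma crossed_moduleP B X (a : hact B X) (d : hmor X B) :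
  crossed_module a d <->
  (forall E (b : cmor E B) (x : cmor E X), d @@ ap a b x = b * (d @@ x) * b^-1) /\
  (forall E (y x : cmor E X), ap a (d @@ y) x = y * x * y^-1).
Proof.
pose F1 (b : B) (x : X) := csw b (fun b1 b2 => hmulb B (hmulb B b1 (d x)) (hS B b2)).
pose F2 (y x : X) := csw y (fun b1 b2 => hmulb X (hmulb X b1 x) (hS X b2)).
have F1b : bilin F1 by rewrite /F1; mlin.
have F2b : bilin F2 by rewrite /F2; mlin.
have E1 E (b : cmor E B) (x : cmor E X) e : (b * (d @@ x) * b^-1) e = bisw F1 b x e.
  by rewrite -(ap_dup_l _ (bcomp (hmulb B) (cidm B) d)) ap_bcomp ccomp1f.
have E2 E (b : cmor E X) (x : cmor E X) e : (b * x * b^-1) e = bisw F2 b x e.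
  by rewrite -(ap_dup_l _ (hmulb X)).
have E3 E (b : cmor E B) (x : cmor E X) e : (d @@ ap a b x) e = bisw (fun b x => d (a b x)) b x e.
  by rewrite /= (lin_csw (g := d)) //; mlin.
have E4 E (b : cmor E X) (x : cmor E X) e : ap a (d @@ b) x e = bisw (fun b x => a (d b) x) b x e.
  by [].
split=> [[_ _ c1 c2] | [c1 c2]].
  by split=> E b x; apply: cmor_ext => e;
     [rewrite E1 E3; apply: eq_bisw => u v; apply: c1
     | rewrite E2 E4; apply: eq_bisw => u v; apply: c2].
split; [exact: to_module_hopf | exact: hmor_hopf_mor | |].
  apply: (bisw_ext (A := B) (B := X) (F := fun b x => d (a b x)) (G := F1)); [mlin | by [] |].
  by move=> E b x e; rewrite -E3 -E1 c1.
apply: (bisw_ext (A := X) (B := X) (F := fun b x => a (d b) x) (G := F2)); [mlin | by [] |].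
by move=> E b x e; rewrite -E4 -E2 c2.
Qed.

End HmorTheory.

(** * Constructions of Hopf algebras *)

Section MakeHopf.
Variables (K : fieldType) (Q : coalg K) (mu : bimor Q Q Q) (S : cmor Q Q).
Variables (o : Q) (og : grouplike o).
Hypothesis muA : forall E (x y z : cmor E Q), ap mu (ap mu x y) z = ap mu x (ap mu y z).
Hypothesis mu1 : forall E (x : cmor E Q), ap mu (cone E og) x = x.
Hypothesis mux1 : forall E (x : cmor E Q), ap mu x (cone E og) = x.
Hypothesis muV : forall E (x : cmor E Q), ap mu (S @@ x) x = cone E og.

(** The Hopf algebra is tied to [Q] by inverse coalgebra maps, so its carrier can stay hidden once
    [make_hopf] is closed. *)
Record hopfspec := Hopfspec {
  hs :> hopf K;
  hs_to : cmor Q hs;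
  hs_of : cmor hs Q;
  hs_toK : hs_of @@ hs_to = cidm Q;
  hs_ofK : hs_to @@ hs_of = cidm hs;
  hs_mul : forall E (x y : cmor E hs), hs_of @@ (x * y) = ap mu (hs_of @@ x) (hs_of @@ y)
}.

Definition make_hopf : hopfspec.
Proof.
have mb := bimor_bilin mu.
have gA (x y z : Q) : mu x (mu y z) = mu (mu x y) z.
  apply: (trisw_ext (F := fun x y z => mu x (mu y z)) (G := fun x y z => mu (mu x y) z));
    [mlin | mlin |] => {x y z} E x y z e.
  by rewrite -ap_ap_l -ap_ap_r muA.
have g1 (x : Q) : mu o x = x.
  rewrite -[RHS]/(cidm Q x) -(mu1 (cidm Q)) apE -[LHS](csw_epsl x (g := fun z => mu o z)); last mlin.
  by apply: eq_csw => u v; rewrite /= (linZ (bilin_l _ mb (@lin_id _ _))).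
have gx1 (x : Q) : mu x o = x.
  rewrite -[RHS]/(cidm Q x) -(mux1 (cidm Q)) apE -[LHS](csw_epsr x (g := fun z => mu z o)); last mlin.
  by apply: eq_csw => u v; rewrite /= (linZ (bilin_r _ mb (@lin_id _ _))).
have gl (a : K) (x y : Q) :
    teq (cdelta (a *: x + y)) ([seq (a *: p.1, p.2) | p <- cdelta x] ++ cdelta y).
  move=> U F Fb; rewrite (cdelta_lin Fb) /tsum big_cat big_map scaler_sumr /=.
  by congr (_ + _)%R; apply: eq_bigr => p _; rewrite (linZ (bilin_l _ Fb (@lin_id _ _))).
have gcA (x : Q) : teq3 [seq (q.1, q.2, p.2) | p <- cdelta x, q <- cdelta p.1]
         [seq (p.1, q.1, q.2) | p <- cdelta x, q <- cdelta p.2].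
  by move=> U F Ft; rewrite !big_allpairs_dep; apply: (cdeltaA x Ft).
have gcr (x : Q) : tsum (fun u v => ceps v *: u) (cdelta x) = x.
  by apply: (csw_epsr x (@lin_id K Q)).
have gcM (x y : Q) : teq (cdelta (mu x y))
    [seq (mu p.1 q.1, mu p.2 q.2) | p <- cdelta x, q <- cdelta y].
  by move=> U F Fb; rewrite -[LHS]/(csw _ F) bimor_sw // /tsum big_allpairs_dep.
have gc1 : teq (cdelta o) [:: (o, o)].
  by move=> U F Fb; rewrite -[LHS]/(csw o F) (proj2 og) // /tsum big_seq1.
have gSl (x : Q) : tsum (fun u v => mu (S u) v) (cdelta x) = ceps x *: o.
  by have := congr1 (fun f : cmor Q Q => f x) (muV (cidm Q)).
have gSr (x : Q) : tsum (fun u v => mu u (S v)) (cdelta x) = ceps x *: o.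
  rewrite -gSl -/(csw x _) -/(csw x _).
  (* A left inverse is also a right inverse: [z S(z) = S(S(z)) S(z) z S(z) = S(S(z)) S(z) = 1]. *)
  have muV' E (z : cmor E Q) : ap mu z (S @@ z) = cone E og.
    rewrite -{1}[z]mu1 -(muV (S @@ z)) !muA; congr ap.
    by rewrite -[ap mu (S @@ z) _]muA muV mu1.
  have := congr1 (fun f : cmor Q Q => f x) (muV' _ (cidm Q)).
  by rewrite apE -(muV (cidm Q)) => ->.
have gC (x : Q) : teq (cdelta x) [seq (p.2, p.1) | p <- cdelta x].
  by move=> U F Fb; rewrite (cdeltaC x Fb) /tsum big_map.
pose H := @Hopf K Q mu o (@cdelta K Q) (@ceps K Q) S mb gA g1 gx1 gl gcA (@ceps_lin K Q)
  (@cdelta_eps K Q) gcr gcM gc1 (@bimor_eps _ _ _ _ mu) (proj1 og) (cmor_lin S) gSl gSr gC.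
pose f : cmor Q H := @Cmor K Q H (fun x => x) (@lin_id K Q)
  (fun x U F _ => erefl) (fun x => erefl).
pose g : cmor H Q := @Cmor K H Q (fun x => x) (@lin_id K Q)
  (fun x U F _ => erefl) (fun x => erefl).
by exists H f g => [||E x y]; apply: cmor_ext.
Qed.

End MakeHopf.

(** * Semidirect products *)

Section Semidirect.
Variables (K : fieldType) (B X : hopf K) (a : hact B X).

Record semidirect := Semidirect {
  sdp :> hopf K;
  sd1 : cmor sdp X;
  sd2 : hmor sdp B;
  spair : forall E, cmor E X -> cmor E B -> cmor E sdp;
  sd1_pair : forall E (x : cmor E X) b, sd1 @@ spair x b = x;
  sd2_pair : forall E (x : cmor E X) b, sd2 @@ spair x b = b;
  spair_eta : forall E (q : cmor E sdp), spair (sd1 @@ q) (sd2 @@ q) = q;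
  sd1M : forall E (q r : cmor E sdp),
    sd1 @@ (q * r) = (sd1 @@ q) * ap a (sd2 @@ q) (sd1 @@ r)
}.

Definition make_semidirect : semidirect.
Proof.
pose Q := product X B.
pose p1 := pfst Q; pose p2 := psnd Q.
have pn E E' (g : cmor E' E) (x : cmor E X) (b : cmor E B) :
    ppair Q x b @@ g = ppair Q (x @@ g) (b @@ g) by rewrite !ppairE ap_comp.
pose op E (q r : cmor E Q) : cmor E Q :=
  ppair Q ((p1 @@ q) * ap a (p2 @@ q) (p1 @@ r)) ((p2 @@ q) * (p2 @@ r)).
have opn E E' (g : cmor E' E) q r : op _ q r @@ g = op _ (q @@ g) (r @@ g).
  by rewrite /op pn !ptnat -!ccompA.
pose mu := ybi op.
have muE E (q r : cmor E Q) : ap mu q r = op _ q r by exact: ap_ybi.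
have og := ppure_grouplike Q (hone_grouplike X) (hone_grouplike B).
have oE E : cone E og = ppair Q 1 1.
  apply: cmor_ext => e; rewrite ppairE apE /=.
  have pb := bimor_bilin (ppure Q).
  rewrite -(csw_epsl e (g := fun z => ceps z *: ppure Q (hone X) (hone B))); last mlin.
  apply: eq_csw => u v.
  by rewrite (linZ (bilin_l _ pb (@lin_id _ _))) (linZ (bilin_r _ pb (@lin_id _ _))).
(* The inverse of [(x, b)] is [(b^-1 |> x^-1, b^-1)]. *)
pose S : cmor Q Q := ppair Q (ap a p2^-1 p1^-1) p2^-1.
have := @make_hopf K Q mu S _ og.
case=> [E x y z|E x|E x|E x|H f g fK gK gM]; rewrite ?muE /op ?oE ?pfst_pair ?psnd_pair.
- by rewrite !(haD, haM, ptE).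
- by rewrite ha1 !ptE ppair_eta.
- by rewrite haN !ptE ppair_eta.
- by rewrite /S pn !ptnat /p1 /p2 pfst_pair psnd_pair -haD !ptE haN.
have h2M E (x y : cmor E H) : (p2 @@ g) @@ (x * y) = ((p2 @@ g) @@ x) * ((p2 @@ g) @@ y).
  by rewrite -ccompA gM muE /op /p2 psnd_pair !ccompA.
exists H (p1 @@ g) (Hmor h2M) (fun E x b => f @@ ppair Q x b) => /=.
- by move=> E x b; rewrite ccompA -(ccompA f) fK ccompf1 pfst_pair.
- by move=> E x b; rewrite ccompA -(ccompA f) fK ccompf1 psnd_pair.
- by move=> E q; rewrite -!ccompA ppair_eta ccompA gK ccomp1f.
- by move=> E q r; rewrite -!ccompA gM muE /op /p1 pfst_pair.
Qed.

End Semidirect.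

(** * Images of idempotent coalgebra maps *)

Section Image.
Variables (K : fieldType) (C : coalg K) (pi : cmor C C).
Hypothesis piK : pi @@ pi = pi.

(** The image of an idempotent is its space of fixed vectors; this boolean condition allows a
    subtype with the induced linear structure. *)
Let imp : {pred C} := fun x => pi x == x.
Let imp_closed : submod_closed imp.
Proof.
have pl := cmor_lin pi; split; first by rewrite unfold_in lin0.
by move=> c x y; rewrite !unfold_in => /eqP px /eqP py; rewrite pl px py.
Qed.
HB.instance Definition _ := GRing.isSubmodClosed.Build K C imp imp_closed.

Record imT := ImT { imval : C; imvalP : imval \in imp }.
HB.instance Definition _ := [isSub for imval].
HB.instance Definition _ := [Choice of imT by <:].
HB.instance Definition _ := [SubChoice_isSubLmodule of imT by <:].

End Image.

Section ImageCoalgebra.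
Variables (K : fieldType) (C : coalg K) (pi : cmor C C).
Hypothesis piK : pi @@ pi = pi.
Implicit Types U : lmodType K.
Let V : lmodType K := imT pi.

Let piKx x : pi (pi x) = pi x.
Proof. by rewrite -[LHS]/((pi @@ pi) x) piK. Qed.

Let r (x : C) : V := ImT (introT eqP (piKx x)).
Let v (x : V) : C := imval x.

Let vr x : v (r x) = pi x. Proof. by []. Qed.
Let piv x : pi (v x) = v x. Proof. by apply/eqP; case: x. Qed.
Let v_inj : injective v. Proof. exact: val_inj. Qed.
Let rv x : r (v x) = x. Proof. by apply: v_inj; rewrite vr piv. Qed.
Let rpi x : r (pi x) = r x. Proof. by apply: v_inj; rewrite !vr. Qed.
Let vl : lin v. Proof. by []. Qed.
Let rl : lin r.
Proof. by move=> c x y; apply: v_inj; rewrite vl !vr; apply: cmor_lin. Qed.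

(** Comultiply in [C], then retract both legs. Iterating this inserts [pi] between two retractions;
    comultiplicativity of [pi] and [rpi] absorb it, which leaves coassociativity in [C]. *)
Let delta (x : V) : seq (V * V) := [seq (r p.1, r p.2) | p <- cdelta (v x)].
Let eps (x : V) : K := ceps (v x).

Let deltaE U (F : V -> V -> U) x : tsum F (delta x) = csw (v x) (fun a b => F (r a) (r b)).
Proof. by rewrite /tsum big_map. Qed.

Let csw_pi U (F : C -> C -> U) x : bilin F -> csw (pi x) F = csw x (fun a b => F (pi a) (pi b)).
Proof. exact: cmor_sw. Qed.

Let delta_lin U (F : V -> V -> U) : bilin F -> lin (fun x => tsum F (delta x)).
Proof. by move=> Fb a x y; rewrite !deltaE vl; apply: csw_lin; mlin. Qed.

Let deltaA x U (F : V -> V -> V -> U) : trilin F ->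
  tsum (fun a b => tsum (fun c d => F c d b) (delta a)) (delta x) =
  tsum (fun a b => tsum (fun c d => F a c d) (delta b)) (delta x).
Proof.
move=> Ft; rewrite !deltaE.
transitivity (csw (v x) (fun a b => csw a (fun c d => F (r c) (r d) (r b)))).
  apply: eq_csw => a b; rewrite deltaE vr csw_pi; last mlin.
  by apply: eq_csw => c d; rewrite !rpi.
rewrite (cswA (v x) (F := fun c d b => F (r c) (r d) (r b))); last mlin.
apply: eq_csw => a b; rewrite deltaE vr csw_pi; last mlin.
by apply: eq_csw => c d; rewrite !rpi.
Qed.

Let deltaC x U (F : V -> V -> U) : bilin F ->
  tsum F (delta x) = tsum (fun a b => F b a) (delta x).
Proof. by move=> Fb; rewrite !deltaE cswC //; mlin. Qed.

Let eps_lin : @lin K V K^o eps. Proof. exact: (lin_comp (@ceps_lin K C) vl). Qed.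

Let delta_eps x : tsum (fun a b => eps a *: b) (delta x) = x.
Proof.
rewrite deltaE -[RHS]rv -[RHS](csw_epsl (v x) rl).
by apply: eq_csw => a b; rewrite /eps vr cmor_eps.
Qed.

Let imc : coalg K := Coalg delta_lin deltaA deltaC eps_lin delta_eps.

Record imcspec := Imcspec {
  ic :> coalg K;
  iinc : cmor ic C;
  iret : cmor C ic;
  iincK : iret @@ iinc = cidm ic;
  iretK : iinc @@ iret = pi
}.

Definition make_imc : imcspec.
Proof.
have vsw x U (F : C -> C -> U) : bilin F ->
    csw (v x) F = @csw K imc U x (fun a b => F (v a) (v b)).
  by move=> Fb; rewrite [RHS]deltaE -{1}piv csw_pi.
have rsw x U (F : V -> V -> U) : bilin F ->
    @csw K imc U (r x) F = csw x (fun a b => F (r a) (r b)).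
  move=> Fb; rewrite [LHS]deltaE vr csw_pi; last mlin.
  by apply: eq_csw => a b; rewrite !rpi.
have reps x : @ceps K imc (r x) = ceps x by rewrite /= /eps vr cmor_eps.
exists imc (@Cmor K imc C v vl vsw (fun=> erefl)) (@Cmor K C imc r rl rsw reps).
  by apply: cmor_ext => x /=; rewrite rv.
exact: cmor_ext.
Qed.

End ImageCoalgebra.

Section ImageHopf.
Variables (K : fieldType) (H : hopf K) (pi : cmor H H).
Hypothesis piK : pi @@ pi = pi.
Hypothesis pi1 : forall E, pi @@ (1 : cmor E H) = 1.
Hypothesis piM : forall E (x y : cmor E H),
  pi @@ x = x -> pi @@ y = y -> pi @@ (x * y) = x * y.
Hypothesis piV : forall E (x : cmor E H), pi @@ x = x -> pi @@ x^-1 = x^-1.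

Record imspec := Imspec {
  im :> hopf K;
  hinc : hmor im H;
  hret : cmor H im;
  hincK : hret @@ hinc = cidm im;
  hretK : hinc @@ hret = pi
}.

(** The product of two points of the image is formed in [H] and retracted. By [piM] the retraction
    changes nothing, so the inclusion [i] is multiplicative; as it is injective on points, the group
    laws descend from [H]. *)
Definition make_im : imspec.
Proof.
case: (make_imc piK) => I i r iK rK.
have pii E (x : cmor E I) : pi @@ i @@ x = i @@ x.
  by rewrite -rK -!ccompA (ccompK _ iK).
have iI E (x y : cmor E I) : i @@ x = i @@ y -> x = y.
  by move=> /(congr1 (ccomp r)); rewrite !ccompA iK !ccomp1f.
have ir E (x : cmor E H) : i @@ r @@ x = pi @@ x by rewrite ccompA rK.
pose op E (x y : cmor E I) : cmor E I := r @@ ((i @@ x) * (i @@ y)).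
have opn E E' (g : cmor E' E) x y : op _ x y @@ g = op _ (x @@ g) (y @@ g).
  by rewrite /op -ccompA !ptnat -!ccompA.
have iop E (x y : cmor E I) : i @@ op _ x y = (i @@ x) * (i @@ y).
  by rewrite /op ir piM.
pose mu := ybi op.
have muE E (x y : cmor E I) : ap mu x y = op _ x y by exact: ap_ybi.
have og : grouplike (r (hone H)).
  have [e1 e2] := hone_grouplike H; split; first by rewrite cmor_eps.
  by move=> U F Fb; rewrite cmor_sw // e2 //; mlin.
have oE E : cone E og = r @@ 1.
  by apply: cmor_ext => e; rewrite /= (linZ (cmor_lin r)).
have io E : i @@ cone E og = 1 by rewrite oE ir pi1.
pose S : cmor I I := r @@ i^-1.
have := @make_hopf K I mu S _ og.
case=> [E x y z|E x|E x|E x|G f g fK gK gM]; rewrite ?muE.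
- by apply: iI; rewrite !iop ptE.
- by apply: iI; rewrite !iop io ptE.
- by apply: iI; rewrite !iop io ptE.
- by apply: iI; rewrite !iop io /S -ccompA ir pinv_comp piV ?ptE.
have hM E (x y : cmor E G) : (i @@ g) @@ (x * y) = ((i @@ g) @@ x) * ((i @@ g) @@ y).
  by rewrite -!ccompA gM muE iop.
exists G (Hmor hM) (f @@ r) => /=.
  by rewrite -ccompA (ccompK _ iK) gK.
by rewrite -ccompA (ccompK _ fK) rK.
Qed.

End ImageHopf.

(** * Crossed squares and cat2-Hopf algebras in terms of points *)

Section SquarePoints.
Variable K : fieldType.

Section Laws.
Variables (L M N P : hopf K).
Variables (lam : hmor L M) (lam' : hmor L N) (mu : hmor M P) (nu : hmor N P).
Variables (aL : hact P L) (aM : hact P M) (aN : hact P N) (h : bimor M N L).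

Record square_laws := SquareLaws {
  sq_comm : forall E (l : cmor E L), mu @@ lam @@ l = nu @@ lam' @@ l;
  sq_muE : forall E (p : cmor E P) m, mu @@ ap aM p m = p * (mu @@ m) * p^-1;
  sq_muP : forall E (m m' : cmor E M), ap aM (mu @@ m) m' = m * m' * m^-1;
  sq_nuE : forall E (p : cmor E P) n, nu @@ ap aN p n = p * (nu @@ n) * p^-1;
  sq_nuP : forall E (n n' : cmor E N), ap aN (nu @@ n) n' = n * n' * n^-1;
  sq_LP : forall E (l l' : cmor E L), ap aL (mu @@ lam @@ l) l' = l * l' * l^-1;
  sq_lam : forall E (p : cmor E P) l, lam @@ ap aL p l = ap aM p (lam @@ l);
  sq_lam' : forall E (p : cmor E P) l, lam' @@ ap aL p l = ap aN p (lam' @@ l);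
  sq_3 : forall E (p : cmor E P) m n, ap h (ap aM p m) (ap aN p n) = ap aL p (ap h m n);
  sq_4 : forall E (m : cmor E M) (n : cmor E N),
    lam @@ ap h m n = m * (ap aM (nu @@ n) m)^-1;
  sq_4' : forall E (m : cmor E M) (n : cmor E N),
    lam' @@ ap h m n = ap aN (mu @@ m) n * n^-1;
  sq_5 : forall E (l : cmor E L) (n : cmor E N),
    ap h (lam @@ l) n = l * (ap aL (nu @@ n) l)^-1;
  sq_5' : forall E (m : cmor E M) (l : cmor E L),
    ap h m (lam' @@ l) = ap aL (mu @@ m) l * l^-1;
  sq_6 : forall E (m : cmor E M) (n n' : cmor E N),
    ap h m (n * n') = ap h m n * ap aL (nu @@ n) (ap h m n');
  sq_6' : forall E (m m' : cmor E M) (n : cmor E N),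
    ap h (m * m') n = ap aL (mu @@ m) (ap h m' n) * ap h m n
}.

Let F3 (p : P) (m : M) (n : N) := csw p (fun p1 p2 => h (aM p1 m) (aN p2 n)).
Let F4 (m : M) (n : N) := csw m (fun m1 m2 => hmulb M m1 (aM (nu n) (hS M m2))).
Let F4' (m : M) (n : N) := csw n (fun n1 n2 => hmulb N (aN (mu m) n1) (hS N n2)).
Let F5 (l : L) (n : N) := csw l (fun l1 l2 => hmulb L l1 (aL (nu n) (hS L l2))).
Let F5' (m : M) (l : L) := csw l (fun l1 l2 => hmulb L (aL (mu m) l1) (hS L l2)).
Let F6 (m : M) (n n' : N) := csw m (fun m1 m2 => csw n (fun n1 n2 =>
  hmulb L (h m1 n1) (aL (nu n2) (h m2 n')))).
Let F6' (m m' : M) (n : N) := csw m (fun m1 m2 => csw n (fun n1 n2 =>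
  hmulb L (aL (mu m1) (h m' n1)) (h m2 n2))).

Let E3 E (p : cmor E P) m n e : ap h (ap aM p m) (ap aN p n) e = trisw F3 p m n e.
Proof. exact: ap_dup1. Qed.
(** The antipode sits inside the action in Sweedler form and outside it in group form; [haV] moves
    it across, the action being by automorphisms. *)
Let E4 E (m : cmor E M) (n : cmor E N) e :
  (m * (ap aM (nu @@ n) m)^-1) e = bisw F4 m n e.
Proof. by rewrite -haV -(ap_dup_m (hmulb M) (bcomp aM nu (hS M))) ap_bcomp. Qed.
Let E4' E (m : cmor E M) (n : cmor E N) e :
  (ap aN (mu @@ m) n * n^-1) e = bisw F4' m n e.
Proof. by rewrite -(ap_dup_r (hmulb N) (bcomp aN mu (cidm N))) ap_bcomp ccomp1f. Qed.
Let E5 E (l : cmor E L) (n : cmor E N) e :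
  (l * (ap aL (nu @@ n) l)^-1) e = bisw F5 l n e.
Proof. by rewrite -haV -(ap_dup_m (hmulb L) (bcomp aL nu (hS L))) ap_bcomp. Qed.
Let E5' E (m : cmor E M) (l : cmor E L) e :
  (ap aL (mu @@ m) l * l^-1) e = bisw F5' m l e.
Proof. by rewrite -(ap_dup_r (hmulb L) (bcomp aL mu (cidm L))) ap_bcomp ccomp1f. Qed.
Let E6 E (m : cmor E M) (n n' : cmor E N) e :
  (ap h m n * ap aL (nu @@ n) (ap h m n')) e = trisw F6 m n n' e.
Proof.
by rewrite -(ap_dup12_r (hmulb L) (bcomp aL nu (cidm L)) h h) ap_bcomp ccomp1f.
Qed.
Let E6' E (m m' : cmor E M) (n : cmor E N) e :
  (ap aL (mu @@ m) (ap h m' n) * ap h m n) e = trisw F6' m m' n e.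
Proof.
by rewrite -(ap_dup13_l (hmulb L) (bcomp aL mu (cidm L)) h h) ap_bcomp ccomp1f.
Qed.
Let Elin D D' E (f : cmor D D') (g : bimor M N D) (m : cmor E M) (n : cmor E N) e :
  (f @@ ap g m n) e = bisw (fun m n => f (g m n)) m n e.
Proof. by rewrite /= (lin_csw (g := f)) //; mlin. Qed.

Section ToSquare.
Hypothesis s : square_laws.

Let lcomm l : mu (lam l) = nu (lam' l).
Proof. exact: (congr1 (fun f : cmor L P => f l) (sq_comm s (cidm L))). Qed.
Let cM : crossed_module aM mu.
Proof. by apply/crossed_moduleP; split; [apply: (sq_muE s) | apply: (sq_muP s)]. Qed.
Let cN : crossed_module aN nu.
Proof. by apply/crossed_moduleP; split; [apply: (sq_nuE s) | apply: (sq_nuP s)]. Qed.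
(** Equivariance of the composite [L -> P] combines the linearity of [lam] with the equivariance of
    [mu]. *)
Let cL : crossed_module aL (fun l => mu (lam l)).
Proof.
apply/(@crossed_moduleP _ _ _ aL (hcomp mu lam)); split=> E * /=; rewrite -!ccompA.
  by rewrite (sq_lam s) (sq_muE s).
exact: (sq_LP s).
Qed.

Let elin (A B C : hopf K) (f : hmor B C) (a : hact A B) (b : hact A C) :
  (forall E (p : cmor E A) l, f @@ ap a p l = ap b p (f @@ l)) ->
  forall p l, f (a p l) = b p (f l).
Proof.
move=> fab; apply: (bisw_ext (A := A) (B := B) (F := fun p l => f (a p l))
  (G := fun p l => b p (f l))); [mlin | mlin |] => E p l e.
transitivity ((f @@ ap a p l) e); last by rewrite fab.
by rewrite /= (lin_csw (g := f)) //; mlin.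
Qed.

Let c3 p m n : sw p (fun p1 p2 => h (aM p1 m) (aN p2 n)) = aL p (h m n).
Proof.
apply: (trisw_ext (A := P) (B := M) (C := N) (F := F3) (G := fun p m n => aL p (h m n)));
  [by rewrite /F3; mlin | mlin |] => E p' m' n' e.
by rewrite -E3 -ap_ap_r (sq_3 s).
Qed.
Let c4 m n : lam (h m n) = sw m (fun m1 m2 => hmul m1 (aM (nu n) (hanti m2))).
Proof.
apply: (bisw_ext (A := M) (B := N) (F := fun m n => lam (h m n)) (G := F4));
  [mlin | by rewrite /F4; mlin |] => E m' n' e.
by rewrite -E4 -Elin (sq_4 s).
Qed.
Let c4' m n : lam' (h m n) = sw n (fun n1 n2 => hmul (aN (mu m) n1) (hanti n2)).
Proof.
apply: (bisw_ext (A := M) (B := N) (F := fun m n => lam' (h m n)) (G := F4'));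
  [mlin | by rewrite /F4'; mlin |] => E m' n' e.
by rewrite -E4' -Elin (sq_4' s).
Qed.
Let c5 l n : h (lam l) n = sw l (fun l1 l2 => hmul l1 (aL (nu n) (hanti l2))).
Proof.
apply: (bisw_ext (A := L) (B := N) (F := fun l n => h (lam l) n) (G := F5));
  [mlin | by rewrite /F5; mlin |] => E l' n' e.
by rewrite -E5 -(sq_5 s).
Qed.
Let c5' m l : h m (lam' l) = sw l (fun l1 l2 => hmul (aL (mu m) l1) (hanti l2)).
Proof.
apply: (bisw_ext (A := M) (B := L) (F := fun m l => h m (lam' l)) (G := F5'));
  [mlin | by rewrite /F5'; mlin |] => E m' l' e.
by rewrite -E5' -(sq_5' s).
Qed.
Let c6 m n n' : h m (hmul n n') =
  sw m (fun m1 m2 => sw n (fun n1 n2 => hmul (h m1 n1) (aL (nu n2) (h m2 n')))).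
Proof.
apply: (trisw_ext (A := M) (B := N) (C := N) (F := fun m n n' => h m (hmulb N n n')) (G := F6));
  [mlin | by rewrite /F6; mlin |] => E x y z e.
by rewrite -E6 -(sq_6 s) -ap_ap_r.
Qed.
Let c6' m m' n : h (hmul m m') n =
  sw m (fun m1 m2 => sw n (fun n1 n2 => hmul (aL (mu m1) (h m' n1)) (h m2 n2))).
Proof.
apply: (trisw_ext (A := M) (B := M) (C := N) (F := fun m m' n => h (hmulb M m m') n) (G := F6'));
  [mlin | by rewrite /F6'; mlin |] => E x y z e.
by rewrite -E6' -(sq_6' s) -ap_ap_l.
Qed.
Let h_comul m n : teq (hcomul (h m n))
  [seq (h p.1 q.1, h p.2 q.2) | p <- hcomul m, q <- hcomul n].
Proof.
by move=> U F Fb; rewrite -[LHS]/(csw (h m n) F) bimor_sw // /tsum big_allpairs_dep.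
Qed.

Definition to_xsquare : xsquare K :=
  @XSquare K L M N P lam lam' mu nu aL aM aN h
    (hmor_hopf_mor lam) (hmor_hopf_mor lam') (hmor_hopf_mor mu) (hmor_hopf_mor nu)
    lcomm (bimor_bilin h) h_comul (@bimor_eps _ _ _ _ h) cM cN cL
    (elin (sq_lam s)) (elin (sq_lam' s)) c3 c4 c4' c5 c5' c6 c6'.

End ToSquare.

Lemma square_lawsP :
  (forall l, mu (lam l) = nu (lam' l)) ->
  crossed_module aM mu -> crossed_module aN nu -> crossed_module aL (fun l => mu (lam l)) ->
  (forall p l, lam (aL p l) = aM p (lam l)) -> (forall p l, lam' (aL p l) = aN p (lam' l)) ->
  (forall p m n, F3 p m n = aL p (h m n)) ->
  (forall m n, lam (h m n) = F4 m n) -> (forall m n, lam' (h m n) = F4' m n) ->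
  (forall l n, h (lam l) n = F5 l n) -> (forall m l, h m (lam' l) = F5' m l) ->
  (forall m n n', h m (hmul n n') = F6 m n n') ->
  (forall m m' n, h (hmul m m') n = F6' m m' n) -> square_laws.
Proof.
have elin (A B C : hopf K) (f : hmor B C) (a : hact A B) (b : hact A C) :
  (forall p l, f (a p l) = b p (f l)) ->
  forall E (p : cmor E A) l, f @@ ap a p l = ap b p (f @@ l).
  move=> fab E p l; apply: cmor_ext => e; rewrite apE /= (lin_csw (g := f)); last mlin.
  by apply: eq_csw => u v; rewrite fab.
move=> k0 /crossed_moduleP[m1 m2] /crossed_moduleP[n1 n2].
move=> /(@crossed_moduleP _ _ _ aL (hcomp mu lam)) [_ l2] e1 e2 k3 k4 k4' k5 k5' k6 k6'.
split=> //; try exact: elin.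
- by move=> E l; apply: cmor_ext => e /=.
- by move=> E l l'; rewrite -l2 /= -ccompA.
- by move=> E p m n; apply: cmor_ext => e; rewrite E3 ap_ap_r; apply: eq_trisw.
- by move=> E m n; apply: cmor_ext => e; rewrite E4 Elin; apply: eq_bisw.
- by move=> E m n; apply: cmor_ext => e; rewrite E4' Elin; apply: eq_bisw.
- by move=> E l n; apply: cmor_ext => e; rewrite E5; apply: (eq_bisw (F := fun l n => h (lam l) n)).
- by move=> E m l; apply: cmor_ext => e; rewrite E5'; apply: (eq_bisw (F := fun m l => h m (lam' l))).
- by move=> E m n n'; apply: cmor_ext => e; rewrite E6 [LHS]ap_ap_r; apply: eq_trisw.
- by move=> E m m' n; apply: cmor_ext => e; rewrite E6' [LHS]ap_ap_l; apply: eq_trisw.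
Qed.

End Laws.

Section OfXsquare.
Variable A : xsquare K.

Definition lamh : hmor (xL A) (xM A) := of_hopf_mor (xlam_mor A).
Definition lamh' : hmor (xL A) (xN A) := of_hopf_mor (xlam'_mor A).
Definition muh : hmor (xM A) (xP A) := of_hopf_mor (xmu_mor A).
Definition nuh : hmor (xN A) (xP A) := of_hopf_mor (xnu_mor A).

Let mM : module_hopf (@actM K A). Proof. by case: (CS1M A). Qed.
Let mN : module_hopf (@actN K A). Proof. by case: (CS1N A). Qed.
Let mL : module_hopf (@actL K A). Proof. by case: (CS1L A). Qed.
Definition aMh : hact (xP A) (xM A) := of_module_hopf mM.
Definition aNh : hact (xP A) (xN A) := of_module_hopf mN.
Definition aLh : hact (xP A) (xL A) := of_module_hopf mL.

Let h_sw (m : xM A) (n : xN A) (U : lmodType K) (F : xL A -> xL A -> U) : bilin F ->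
  csw (xh m n) F = csw m (fun u v => csw n (fun u' v' => F (xh u u') (xh v v'))).
Proof. by move=> Fb; rewrite /csw /= (xh_comul m n Fb) /tsum big_allpairs_dep. Qed.
Definition hh : bimor (xM A) (xN A) (xL A) :=
  @Bimor K (xM A) (xN A) (xL A) _ (@xh_bilin K A) h_sw (@xh_counit K A).

Lemma xsquare_laws : square_laws lamh lamh' muh nuh aLh aMh aNh hh.
Proof.
apply: square_lawsP.
- exact: xcomm.
- exact: CS1M.
- exact: CS1N.
- exact: CS1L.
- exact: CS2l.
- exact: CS2l'.
- exact: CS3.
- exact: CS4l.
- exact: CS4l'.
- exact: CS5l.
- exact: CS5l'.
- exact: CS6r.
- exact: CS6l.
Qed.

End OfXsquare.
End SquarePoints.

(** * Cat1-structures on points *)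

Section Cat1Points.
Variables (K : fieldType) (H N : hopf K) (s t : hmor H N) (i : hmor N H).

Record cat1_laws := Cat1Laws {
  c1_si : s @@ i = cidm N;
  c1_ti : t @@ i = cidm N;
  c1_comm : forall E (x y : cmor E H), s @@ x = 1 -> t @@ y = 1 -> x * y = y * x
}.

(** The map [x |-> x_1 i(f(S(x_2)))] fixes every element of the Hopf kernel, so such an element is a
    value of a point annihilated by [f]. *)
Let hkerP (f : hmor H N) a : f @@ i = cidm N -> hker f a ->
  (cidm H * (i @@ f)^-1) a = a.
Proof.
move=> fi fa; rewrite pmulE cswC; last mlin.
pose F (n : N) (x : H) := hmulb H x (hS H (i n)).
have Fb : bilin F by rewrite /F; mlin.
have := fa _ F Fb; rewrite /tsum big_map big_seq1 /= {2}/F.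
have -> : hS H (i (hone N)) = hone H.
  case: (hmor_hopf_mor i) => _ _ -> _ _.
  have := congr1 (fun f : cmor H H => f (hone H)) (@pinv1 K H H).
  by rewrite /= hcounit1 !scale1r.
by rewrite /= hmulx1.
Qed.

Lemma cat1_lawsP : cat1_laws <-> cat1 s t i.
Proof.
split=> [[si ti c] | [_ si ti c]].
  split; first by split; exact: hmor_hopf_mor.
  - by move=> n; rewrite -[LHS]/((s @@ i) n) si.
  - by move=> n; rewrite -[LHS]/((t @@ i) n) ti.
  move=> a b /(hkerP si) sa /(hkerP ti) tb.
  (* The points [ks] and [kt] are killed by [s] and [t]. Since [a = ks(a)] and [b = kt(b)],
     commutation of elements follows from that of these two points. *)
  pose ks := cidm H * (i @@ s)^-1; pose kt := cidm H * (i @@ t)^-1.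
  rewrite -sa -tb -/ks -/kt.
  apply: (bisw_ext (A := H) (B := H) (F := fun a b => hmulb H (ks a) (kt b))
    (G := fun a b => hmulb H (kt b) (ks a))); [mlin | mlin |] => E x y e.
  have -> : bisw (fun a b => hmulb H (ks a) (kt b)) x y e = ((ks @@ x) * (kt @@ y)) e by [].
  rewrite c.
  - by rewrite pmulE cswC //; mlin.
  - by rewrite ptnat hmM ptnat ccomp1f hmV -!ccompA (ccompK _ si) ptE.
  - by rewrite ptnat hmM ptnat ccomp1f hmV -!ccompA (ccompK _ ti) ptE.
split; [by apply: cmor_ext => n; apply: si | by apply: cmor_ext => n; apply: ti |].
(* Conversely, all values of a point killed by [f] lie in the Hopf kernel, so the elementwise
   hypothesis applies leg by leg. *)
have ker (f : hmor H N) E (x : cmor E H) e : f @@ x = 1 -> hker f (x e).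
  move=> fx U F Fb; rewrite /tsum big_map big_seq1 /=.
  rewrite -[LHS]/(csw (x e) (fun u v => F (f u) v)) cmor_sw; last mlin.
  rewrite -[RHS](csw_epsl e (g := fun z => F (hone N) (x z))); last mlin.
  apply: eq_csw => u v; rewrite -[f (x u)]/((f @@ x) u) fx /=.
  by rewrite (linZ (bilin_l _ Fb (@lin_id _ _))).
move=> E x y sx ty; apply: cmor_ext => e; rewrite !pmulE [RHS]cswC; last mlin.
by apply: eq_csw => u v; apply: c; exact: ker.
Qed.

End Cat1Points.

Section SemidirectTheory.
Variables (K : fieldType) (B X : hopf K) (a : hact B X) (S : semidirect a).

Lemma sd_ext E (q r : cmor E S) : sd1 S @@ q = sd1 S @@ r -> sd2 S @@ q = sd2 S @@ r -> q = r.
Proof. by move=> e1 e2; rewrite -(spair_eta q) e1 e2 spair_eta. Qed.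

Lemma spair_comp E E' (g : cmor E' E) x b : spair S x b @@ g = spair S (x @@ g) (b @@ g).
Proof. by apply: sd_ext; rewrite ?sd1_pair ?sd2_pair ccompA ?sd1_pair ?sd2_pair. Qed.

Lemma sd1_1 E : sd1 S @@ (1 : cmor E S) = 1.
Proof. by apply: pmul_id; rewrite -{3}[1]pmul1 sd1M hm1 ha1. Qed.

End SemidirectTheory.

Definition sdE := (sd1_1, sd1_pair, sd2_pair, sd1M).

Definition hact_pull (K : fieldType) (B B' X : hopf K) (a : hact B X) (f : hmor B' B) :
  hact B' X.
Proof.
exists (bcomp a f (cidm X)).
- by move=> E b b' x; rewrite !ap_bcomp !ccomp1f hmM haM.
- by move=> E x; rewrite !ap_bcomp !ccomp1f hm1 ha1.
- by move=> E b x y; rewrite !ap_bcomp !ccomp1f haD.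
Defined.

Lemma ap_pull (K : fieldType) (B B' X : hopf K) (a : hact B X) (f : hmor B' B)
    E (b : cmor E B') x : ap (hact_pull a f) b x = ap a (f @@ b) x.
Proof. by rewrite ap_bcomp ccomp1f. Qed.

(** * From crossed squares to cat2-Hopf algebras *)

Section SquareToCat2.
Variables (K : fieldType) (A : xsquare K).
Let s := xsquare_laws A.
Local Notation L := (xL A).
Local Notation M := (xM A).
Local Notation N := (xN A).
Local Notation P := (xP A).
Local Notation lam := (lamh A).
Local Notation lam' := (lamh' A).
Local Notation mu := (muh A).
Local Notation nu := (nuh A).
Local Notation aL := (aLh A).
Local Notation aM := (aMh A).
Local Notation aN := (aNh A).
Local Notation h := (hh A).

Let actE := (haM, haD, haV, haN, ha1, haK, haKV).

Lemma h1n E (n : cmor E N) : ap h 1 n = 1.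
Proof. by apply: pmul_id; rewrite -{3}[1]pmul1 (sq_6' s) hm1 ha1. Qed.
Lemma hn1 E (m : cmor E M) : ap h m 1 = 1.
Proof. by apply: pmul_id; rewrite -{3}[1]pmul1 (sq_6 s) hm1 ha1. Qed.

(** Conjugation by [h(m, n)] is the action of [mu(lam(h(m, n)))], and this element is the commutator
    of [mu(m)] and [nu(n)]. *)
Lemma h_swap E (m : cmor E M) (n : cmor E N) x :
  ap h m n * ap aL (nu @@ n) (ap aL (mu @@ m) x) =
  ap aL (mu @@ m) (ap aL (nu @@ n) x) * ap h m n.
Proof.
apply: (@pmulIr _ _ _ (ap h m n)^-1).
have := sq_LP s (ap h m n) (ap aL (nu @@ n) (ap aL (mu @@ m) x)).
by rewrite !ptE => <-; rewrite (sq_4 s) hmM hmV (sq_muE s) !ptE !actE.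
Qed.

Definition LN := make_semidirect (hact_pull aL nu).
Definition MP := make_semidirect aM.
Definition NP := make_semidirect aN.

(** This is conjugation of [l n] by [m p], forced by reading [h] as a commutator: [p] acts
    factorwise, [m] acts on [L] through [mu], and [m n' m^-1 = h(m, n') n'] for [n' = p |> n]. *)
Let op E (q : cmor E MP) (r : cmor E LN) : cmor E LN :=
  spair LN (ap aL (mu @@ sd1 MP @@ q) (ap aL (sd2 MP @@ q) (sd1 LN @@ r))
            * ap h (sd1 MP @@ q) (ap aN (sd2 MP @@ q) (sd2 LN @@ r)))
           (ap aN (sd2 MP @@ q) (sd2 LN @@ r)).

Let op_nat E E' (g : cmor E' E) q r : op q r @@ g = op (q @@ g) (r @@ g).
Proof. by rewrite /op spair_comp !ptnat -!ccompA. Qed.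

Let opE E (q : cmor E MP) (r : cmor E LN) : ap (ybi op) q r = op q r.
Proof. exact: ap_ybi. Qed.

Definition aMPLN : hact MP LN.
Proof.
exists (ybi op).
- move=> E q q' r; rewrite !opE /op !sdE !hmM !(sq_6' s, sq_muE s, actE, ptE, sq_3 s).
  by apply: sd_ext; rewrite !sdE.
- by move=> E r; rewrite !opE /op !sdE !hm1 !actE h1n ptE spair_eta.
- move=> E q r r'; rewrite !opE /op; apply: sd_ext; rewrite !(sdE, hmM, actE) //.
  (* [sq_6] splits [h] at a product in [N]; [h_swap] then exchanges the actions of [M] and [N] on
     [L], at the price of a conjugation by [h]. *)
  rewrite !ap_pull (sq_6 s) !pmulA; congr (_ * _).
  by rewrite -(pmulA (ap h _ _)) h_swap (sq_nuE s) !(actE, ptE).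
Defined.

Lemma ap_MPLN E (q : cmor E MP) (r : cmor E LN) : ap aMPLN q r =
  spair LN (ap aL (mu @@ sd1 MP @@ q) (ap aL (sd2 MP @@ q) (sd1 LN @@ r))
            * ap h (sd1 MP @@ q) (ap aN (sd2 MP @@ q) (sd2 LN @@ r)))
           (ap aN (sd2 MP @@ q) (sd2 LN @@ r)).
Proof. exact: opE. Qed.

Definition LNMP := make_semidirect aMPLN.

(** The coordinates of a point written as the product [l n m p], in this order. *)
Definition qL : cmor LNMP L := sd1 LN @@ sd1 LNMP.
Definition qN : cmor LNMP N := sd2 LN @@ sd1 LNMP.
Definition qM : cmor LNMP M := sd1 MP @@ sd2 LNMP.
Definition qP : cmor LNMP P := sd2 MP @@ sd2 LNMP.
Definition quad E (l : cmor E L) (n : cmor E N) (m : cmor E M) (p : cmor E P) : cmor E LNMP :=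
  spair LNMP (spair LN l n) (spair MP m p).

Section Quad.
Variables (E : coalg K).
Implicit Types q r : cmor E LNMP.

Lemma qL_quad l n m p : qL @@ @quad E l n m p = l.
Proof. by rewrite -ccompA !sdE. Qed.
Lemma qN_quad l n m p : qN @@ @quad E l n m p = n.
Proof. by rewrite -ccompA !sdE. Qed.
Lemma qM_quad l n m p : qM @@ @quad E l n m p = m.
Proof. by rewrite -ccompA !sdE. Qed.
Lemma qP_quad l n m p : qP @@ @quad E l n m p = p.
Proof. by rewrite -ccompA !sdE. Qed.

Lemma quad_ext q r : qL @@ q = qL @@ r -> qN @@ q = qN @@ r -> qM @@ q = qM @@ r ->
  qP @@ q = qP @@ r -> q = r.
Proof. by rewrite -!ccompA => *; do 2![apply: sd_ext => //]. Qed.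

Lemma quad_comp E' (g : cmor E' E) l n m p :
  quad l n m p @@ g = quad (l @@ g) (n @@ g) (m @@ g) (p @@ g).
Proof. by rewrite /quad !spair_comp. Qed.

Lemma qPM q r : qP @@ (q * r) = (qP @@ q) * (qP @@ r).
Proof. by rewrite -!ccompA !hmM. Qed.
Lemma qMM q r : qM @@ (q * r) = (qM @@ q) * ap aM (qP @@ q) (qM @@ r).
Proof. by rewrite -!ccompA !hmM !sdE. Qed.
Lemma qNM q r : qN @@ (q * r) = (qN @@ q) * ap aN (qP @@ q) (qN @@ r).
Proof. by rewrite -!ccompA sdE ap_MPLN hmM !sdE. Qed.
Lemma qLM q r : qL @@ (q * r) = (qL @@ q) * ap aL (nu @@ qN @@ q)
  (ap aL (mu @@ qM @@ q) (ap aL (qP @@ q) (qL @@ r)) *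
   ap h (qM @@ q) (ap aN (qP @@ q) (qN @@ r))).
Proof. by rewrite -!ccompA sdE ap_MPLN sdE !ap_pull !sdE. Qed.

Lemma qP1 : qP @@ (1 : cmor E LNMP) = 1.
Proof. by rewrite -!ccompA !hm1. Qed.
Lemma qM1 : qM @@ (1 : cmor E LNMP) = 1.
Proof. by rewrite -!ccompA !(hm1, sdE). Qed.
Lemma qN1 : qN @@ (1 : cmor E LNMP) = 1.
Proof. by rewrite -!ccompA !(hm1, sdE). Qed.
Lemma qL1 : qL @@ (1 : cmor E LNMP) = 1.
Proof. by rewrite -!ccompA !(hm1, sdE). Qed.
End Quad.

Let quadE := (qL_quad, qN_quad, qM_quad, qP_quad, qPM, qMM, qNM, qLM, qP1, qM1, qN1, qL1).

(** Obtained by applying the target to each factor of [l n m p]: it sends [l] to [lam(l)] and [n] to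
    [nu(n)], fixes [m] and [p], and [nu(n)] is then moved past [m]. *)
Let tMc : cmor LNMP MP := spair MP ((lam @@ qL) * ap aM (nu @@ qN) qM) ((nu @@ qN) * qP).
Lemma tM_M E (x : cmor E LNMP) :
  sd1 MP @@ tMc @@ x = (lam @@ qL @@ x) * ap aM (nu @@ qN @@ x) (qM @@ x).
Proof. by rewrite /tMc spair_comp sdE !ptnat -!ccompA. Qed.
Lemma tM_P E (x : cmor E LNMP) : sd2 MP @@ tMc @@ x = (nu @@ qN @@ x) * (qP @@ x).
Proof. by rewrite /tMc spair_comp sdE !ptnat -!ccompA. Qed.

Definition tMh : hmor LNMP MP.
Proof.
exists tMc => E x y; apply: sd_ext; rewrite !(tM_M, tM_P, sdE, hmM).
  by rewrite !(quadE, hmM, sq_lam s, sq_4 s, sq_muP s, sq_nuE s, actE, ptE).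
by rewrite !(quadE, hmM, sq_nuE s, ptE).
Defined.

Definition iMh : hmor MP LNMP.
Proof.
exists (quad 1 1 (sd1 MP) (sd2 MP)) => E x y.
apply: quad_ext; rewrite !quad_comp !(quadE, ptnat, sdE, hmM, hm1, hn1, actE, ptE) //.
Defined.

Definition sNh : hmor LNMP NP.
Proof.
exists (spair NP qN qP) => E x y.
by apply: sd_ext; rewrite !(spair_comp, sdE, quadE, hmM).
Defined.

(** Likewise for the other direction: [l] goes to [lam'(l)] and [m] to [mu(m)], and the factors are
    already in the right order. *)
Let tNc : cmor LNMP NP := spair NP ((lam' @@ qL) * qN) ((mu @@ qM) * qP).
Lemma tN_N E (x : cmor E LNMP) : sd1 NP @@ tNc @@ x = (lam' @@ qL @@ x) * (qN @@ x).
Proof. by rewrite /tNc spair_comp sdE !ptnat -!ccompA. Qed.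
Lemma tN_P E (x : cmor E LNMP) : sd2 NP @@ tNc @@ x = (mu @@ qM @@ x) * (qP @@ x).
Proof. by rewrite /tNc spair_comp sdE !ptnat -!ccompA. Qed.

Definition tNh : hmor LNMP NP.
Proof.
exists tNc => E x y; apply: sd_ext; rewrite !(tN_N, tN_P, sdE, hmM).
  by rewrite !(quadE, hmM, sq_lam' s, sq_4' s, sq_nuP s, sq_muE s, actE, ptE).
by rewrite !(quadE, hmM, sq_muE s, ptE).
Defined.

Definition iNh : hmor NP LNMP.
Proof.
exists (quad 1 (sd1 NP) 1 (sd2 NP)) => E x y.
apply: quad_ext; rewrite !quad_comp !(quadE, ptnat, sdE, hmM, hm1, h1n, actE, ptE) //.
Defined.

Lemma F_cat1M : cat1 (sd2 LNMP) tMh iMh.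
Proof.
apply/cat1_lawsP; split.
- by rewrite /= sd2_pair; apply: sd_ext; rewrite !sdE ccompf1.
- apply: sd_ext; rewrite ?tM_M ?tM_P !(quadE, hm1, actE, ptE) ccompf1 //.
- move=> E x y sx ty.
  have xM : qM @@ x = 1 by rewrite -ccompA sx sd1_1.
  have xP : qP @@ x = 1 by rewrite -ccompA sx hm1.
  have yP : qP @@ y = (nu @@ qN @@ y)^-1.
    by apply: pinvE; rewrite -tM_P ty hm1.
  have yM : ap aM (nu @@ qN @@ y) (qM @@ y) = lam @@ (qL @@ y)^-1.
    by rewrite hmV; apply: pinvE; rewrite -tM_M ty sd1_1.
  (* Write [y = l n m p]. As [p = nu(n)^-1], the product [nu(n) mu(m) p] equals
     [mu(nu(n) |> m) = mu(lam(l))^-1], which acts on [L] as conjugation by [l^-1]. *)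
  have e1 : ap aL (nu @@ qN @@ y) (ap aL (mu @@ qM @@ y) (ap aL (qP @@ y) (qL @@ x))) =
      (qL @@ y)^-1 * ((qL @@ x) * (qL @@ y)).
    have := sq_LP s (qL @@ y)^-1 (qL @@ x); rewrite -yM (sq_muE s) !(actE, ptE) => <-.
    by rewrite yP.
  (* Moving [nu(n)] inside [h] turns the first argument into [lam(l^-1)] and cancels [p] in the
     second, so [sq_5] evaluates [h]. *)
  have e2 : ap aL (nu @@ qN @@ y) (ap h (qM @@ y) (ap aN (qP @@ y) (qN @@ x))) =
      (qL @@ y)^-1 * ap aL (nu @@ qN @@ x) (qL @@ y).
    by rewrite -(sq_3 s) yM yP haK (sq_5 s) !(actE, ptE).
  apply: quad_ext; rewrite !quadE ?xM ?xP !(hm1, h1n, actE, e1, e2, ptE) //.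
  by rewrite yP -hmV (sq_nuP s) !ptE.
Qed.

Lemma F_cat1N : cat1 sNh tNh iNh.
Proof.
apply/cat1_lawsP; split.
- by rewrite /= spair_comp !quadE; apply: sd_ext; rewrite !sdE ccompf1.
- by apply: sd_ext; rewrite ?tN_N ?tN_P !(quadE, hm1, actE, ptE) ccompf1.
- move=> E x y sx ty.
  have xN : qN @@ x = 1.
    by have := congr1 (ccomp (sd1 NP)) sx; rewrite /= spair_comp !sdE.
  have xP : qP @@ x = 1.
    by have := congr1 (ccomp (sd2 NP)) sx; rewrite /= spair_comp !sdE hm1.
  have yP : qP @@ y = (mu @@ qM @@ y)^-1.
    by apply: pinvE; rewrite -tN_P ty hm1.
  have yN : qN @@ y = lam' @@ (qL @@ y)^-1.
    by rewrite hmV; apply: pinvE; rewrite -tN_N ty sd1_1.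
  (* The kernel condition gives [n = lam'(l)^-1], hence [nu(n) = mu(lam(l))^-1] by commutativity of
     the square. *)
  have e1 : ap aL (nu @@ qN @@ y) (qL @@ x) = (qL @@ y)^-1 * ((qL @@ x) * (qL @@ y)).
    by have := sq_LP s (qL @@ y)^-1 (qL @@ x); rewrite (sq_comm s) -yN !(actE, ptE).
  have e2 : ap h (qM @@ x) (qN @@ y) = (ap aL (mu @@ qM @@ x) (qL @@ y))^-1 * (qL @@ y).
    by rewrite yN (sq_5' s) !(actE, ptE).
  apply: quad_ext; rewrite !quadE ?xN ?xP !(hm1, hn1, actE, e2, yP, e1, ptE) //.
  by rewrite -hmV (sq_muP s) !ptE.
Qed.

Section Components.
Variable E : coalg K.
Implicit Types (x : cmor E LNMP) (y : cmor E MP) (z : cmor E NP).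

Lemma iM_L y : qL @@ iMh @@ y = 1. Proof. by rewrite /= quad_comp quadE ptnat. Qed.
Lemma iM_N y : qN @@ iMh @@ y = 1. Proof. by rewrite /= quad_comp quadE ptnat. Qed.
Lemma iM_M y : qM @@ iMh @@ y = sd1 MP @@ y. Proof. by rewrite /= quad_comp quadE. Qed.
Lemma iM_P y : qP @@ iMh @@ y = sd2 MP @@ y. Proof. by rewrite /= quad_comp quadE. Qed.
Lemma iN_L z : qL @@ iNh @@ z = 1. Proof. by rewrite /= quad_comp quadE ptnat. Qed.
Lemma iN_N z : qN @@ iNh @@ z = sd1 NP @@ z. Proof. by rewrite /= quad_comp quadE. Qed.
Lemma iN_M z : qM @@ iNh @@ z = 1. Proof. by rewrite /= quad_comp quadE ptnat. Qed.
Lemma iN_P z : qP @@ iNh @@ z = sd2 NP @@ z. Proof. by rewrite /= quad_comp quadE. Qed.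
Lemma sN_N x : sd1 NP @@ sNh @@ x = qN @@ x. Proof. by rewrite /= spair_comp sdE. Qed.
Lemma sN_P x : sd2 NP @@ sNh @@ x = qP @@ x. Proof. by rewrite /= spair_comp sdE. Qed.
Lemma sM_M x : sd1 MP @@ sd2 LNMP @@ x = qM @@ x. Proof. by rewrite ccompA. Qed.
Lemma sM_P x : sd2 MP @@ sd2 LNMP @@ x = qP @@ x. Proof. by rewrite ccompA. Qed.
Lemma tMh_M x : sd1 MP @@ tMh @@ x = (lam @@ qL @@ x) * ap aM (nu @@ qN @@ x) (qM @@ x).
Proof. exact: tM_M. Qed.
Lemma tMh_P x : sd2 MP @@ tMh @@ x = (nu @@ qN @@ x) * (qP @@ x).
Proof. exact: tM_P. Qed.
Lemma tNh_N x : sd1 NP @@ tNh @@ x = (lam' @@ qL @@ x) * (qN @@ x).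
Proof. exact: tN_N. Qed.
Lemma tNh_P x : sd2 NP @@ tNh @@ x = (mu @@ qM @@ x) * (qP @@ x).
Proof. exact: tN_P. Qed.
End Components.

Definition compE := (iM_L, iM_N, iM_M, iM_P, iN_L, iN_N, iN_M, iN_P, sN_N, sN_P, sM_M, sM_P,
  tMh_M, tMh_P, tNh_N, tNh_P).

Let pointwise (f g : cmor LNMP LNMP) :
  (forall E (x : cmor E LNMP), f @@ x = g @@ x) -> forall x, f x = g x.
Proof. by move=> fg x; rewrite -[f]ccompf1 fg ccompf1. Qed.

Let F_ss : forall x, iNh (sNh (iMh (sd2 LNMP x))) = iMh (sd2 LNMP (iNh (sNh x))).
Proof.
apply: (pointwise (f := iNh @@ sNh @@ iMh @@ sd2 LNMP) (g := iMh @@ sd2 LNMP @@ iNh @@ sNh)) => E x.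
by rewrite -!ccompA; apply: quad_ext; rewrite !compE.
Qed.

Let F_tt : forall x, iNh (tNh (iMh (tMh x))) = iMh (tMh (iNh (tNh x))).
Proof.
apply: (pointwise (f := iNh @@ tNh @@ iMh @@ tMh) (g := iMh @@ tMh @@ iNh @@ tNh)) => E x.
rewrite -!ccompA; apply: quad_ext; rewrite !(compE, hm1, hmM, actE, ptE) //.
(* Only the [P]-coordinate is left: both composites give [mu(lam(l)) nu(n) mu(m) p], up to
   [mu lam = nu lam']. *)
by rewrite (sq_muE s) (sq_comm s) !ptE.
Qed.

Let F_st : forall x, iNh (sNh (iMh (tMh x))) = iMh (tMh (iNh (sNh x))).
Proof.
apply: (pointwise (f := iNh @@ sNh @@ iMh @@ tMh) (g := iMh @@ tMh @@ iNh @@ sNh)) => E x.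
by rewrite -!ccompA; apply: quad_ext; rewrite !(compE, hm1, hmM, actE, ptE).
Qed.

Let F_ts : forall x, iNh (tNh (iMh (sd2 LNMP x))) = iMh (sd2 LNMP (iNh (tNh x))).
Proof.
apply: (pointwise (f := iNh @@ tNh @@ iMh @@ sd2 LNMP) (g := iMh @@ sd2 LNMP @@ iNh @@ tNh)) => E x.
by rewrite -!ccompA; apply: quad_ext; rewrite !(compE, hm1, hmM, actE, ptE).
Qed.

Definition F_obj : cat2 K := Cat2 F_cat1N F_cat1M F_ss F_tt F_st F_ts.

End SquareToCat2.

(** * From cat2-Hopf algebras to crossed squares *)

Section SubHopf.
Variables (K : fieldType) (H : hopf K).

(* Points of a sub-Hopf algebra are the points of [H] fixed by the projection. *)
Record sub := Sub {
  sb :> hopf K;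
  si : hmor sb H;
  sr : cmor H sb;
  siK : sr @@ si = cidm sb
}.

Definition in_sub (S : sub) E (x : cmor E H) := si S @@ sr S @@ x = x.

Lemma si_in (S : sub) E (x : cmor E S) : in_sub S (si S @@ x).
Proof. by rewrite /in_sub (ccompK _ (siK S)). Qed.

Lemma si_inj (S : sub) E (x y : cmor E S) : si S @@ x = si S @@ y -> x = y.
Proof. by move=> /(congr1 (ccomp (sr S))); rewrite !(ccompK _ (siK S)). Qed.

Section Mor.
Variables (S T : sub) (f : hmor H H).
Hypothesis fST : forall E (x : cmor E S), in_sub T (f @@ si S @@ x).

Definition submor : hmor S T.
Proof.
exists (sr T @@ f @@ si S) => E x y.
by apply: si_inj; rewrite hmM -!ccompA !fST !hmM.
Defined.

Lemma submorE E (x : cmor E S) : si T @@ submor @@ x = f @@ si S @@ x.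
Proof. by rewrite -[RHS]fST -!ccompA. Qed.
End Mor.

Section Act.
Variables (B X : sub).
Hypothesis BX : forall E (b : cmor E B) (x : cmor E X),
  in_sub X ((si B @@ b) * (si X @@ x) * (si B @@ b)^-1).
Let op E (b : cmor E B) (x : cmor E X) : cmor E X :=
  sr X @@ ((si B @@ b) * (si X @@ x) * (si B @@ b)^-1).
Let op_nat E E' (g : cmor E' E) b x : op b x @@ g = op (b @@ g) (x @@ g).
Proof. by rewrite /op -ccompA !ptnat -!ccompA. Qed.
Let opE E (b : cmor E B) (x : cmor E X) :
  si X @@ ap (ybi op) b x = (si B @@ b) * (si X @@ x) * (si B @@ b)^-1.
Proof. by rewrite ap_ybi // BX. Qed.

Definition subact : hact B X.
Proof.
exists (ybi op) => E *; apply: si_inj; rewrite !(opE, hmM, hm1, ptE) //.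
Defined.

Lemma subactE E (b : cmor E B) (x : cmor E X) :
  si X @@ ap subact b x = (si B @@ b) * (si X @@ x) * (si B @@ b)^-1.
Proof. exact: opE. Qed.
End Act.

Section Comm.
Variables (B C X : sub).
Hypothesis BCX : forall E (b : cmor E B) (c : cmor E C),
  in_sub X ((si B @@ b) * (si C @@ c) * (si B @@ b)^-1 * (si C @@ c)^-1).
Let op E (b : cmor E B) (c : cmor E C) : cmor E X :=
  sr X @@ ((si B @@ b) * (si C @@ c) * (si B @@ b)^-1 * (si C @@ c)^-1).
Let op_nat E E' (g : cmor E' E) b x : op b x @@ g = op (b @@ g) (x @@ g).
Proof. by rewrite /op -ccompA !ptnat -!ccompA. Qed.

Definition subcomm : bimor B C X := ybi op.

Lemma subcommE E (b : cmor E B) (c : cmor E C) :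
  si X @@ ap subcomm b c = (si B @@ b) * (si C @@ c) * (si B @@ b)^-1 * (si C @@ c)^-1.
Proof. by rewrite ap_ybi // BCX. Qed.
End Comm.

End SubHopf.

Section Cat2ToSquare.
Variables (K : fieldType) (X : cat2 K).
Local Notation H := (cH X).

Let hsN : hopf_mor (@sN K X). Proof. by case: (cat1N X) => -[]. Qed.
Let htN : hopf_mor (@tN K X). Proof. by case: (cat1N X) => -[]. Qed.
Let hiN : hopf_mor (@iN K X). Proof. by case: (cat1N X) => -[]. Qed.
Let hsM : hopf_mor (@sM K X). Proof. by case: (cat1M X) => -[]. Qed.
Let htM : hopf_mor (@tM K X). Proof. by case: (cat1M X) => -[]. Qed.
Let hiM : hopf_mor (@iM K X). Proof. by case: (cat1M X) => -[]. Qed.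
Definition gsN := of_hopf_mor hsN.
Definition gtN := of_hopf_mor htN.
Definition giN := of_hopf_mor hiN.
Definition gsM := of_hopf_mor hsM.
Definition gtM := of_hopf_mor htM.
Definition giM := of_hopf_mor hiM.

Lemma cat2_lawsN : cat1_laws gsN gtN giN. Proof. exact/cat1_lawsP/(cat1N X). Qed.
Lemma cat2_lawsM : cat1_laws gsM gtM giM. Proof. exact/cat1_lawsP/(cat1M X). Qed.

Definition eN := hcomp giN gsN.
Definition fN := hcomp giN gtN.
Definition eM := hcomp giM gsM.
Definition fM := hcomp giM gtM.

Section Endo.
Variable E : coalg K.
Implicit Types x y : cmor E H.

Lemma eNE x : eN @@ x = giN @@ gsN @@ x. Proof. by rewrite /= -ccompA. Qed.
Lemma fNE x : fN @@ x = giN @@ gtN @@ x. Proof. by rewrite /= -ccompA. Qed.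
Lemma eME x : eM @@ x = giM @@ gsM @@ x. Proof. by rewrite /= -ccompA. Qed.
Lemma fME x : fM @@ x = giM @@ gtM @@ x. Proof. by rewrite /= -ccompA. Qed.

Lemma eNeN x : eN @@ eN @@ x = eN @@ x.
Proof. by rewrite !eNE (ccompK _ (c1_si cat2_lawsN)). Qed.
Lemma fNeN x : fN @@ eN @@ x = eN @@ x.
Proof. by rewrite eNE fNE (ccompK _ (c1_ti cat2_lawsN)). Qed.
Lemma eNfN x : eN @@ fN @@ x = fN @@ x.
Proof. by rewrite eNE fNE (ccompK _ (c1_si cat2_lawsN)). Qed.
Lemma fNfN x : fN @@ fN @@ x = fN @@ x.
Proof. by rewrite !fNE (ccompK _ (c1_ti cat2_lawsN)). Qed.
Lemma eMeM x : eM @@ eM @@ x = eM @@ x.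
Proof. by rewrite !eME (ccompK _ (c1_si cat2_lawsM)). Qed.
Lemma fMeM x : fM @@ eM @@ x = eM @@ x.
Proof. by rewrite eME fME (ccompK _ (c1_ti cat2_lawsM)). Qed.
Lemma eMfM x : eM @@ fM @@ x = fM @@ x.
Proof. by rewrite eME fME (ccompK _ (c1_si cat2_lawsM)). Qed.
Lemma fMfM x : fM @@ fM @@ x = fM @@ x.
Proof. by rewrite !fME (ccompK _ (c1_ti cat2_lawsM)). Qed.
(** This rule and the next three are oriented alike: the endomorphism belonging to [N] moves
    outside, so that rewriting with them terminates. *)
Lemma eMeN x : eM @@ eN @@ x = eN @@ eM @@ x.
Proof. by apply: cmor_ext => e; apply/esym/c_sNsM. Qed.
Lemma fMfN x : fM @@ fN @@ x = fN @@ fM @@ x.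
Proof. by apply: cmor_ext => e; apply/esym/c_tNtM. Qed.
Lemma fMeN x : fM @@ eN @@ x = eN @@ fM @@ x.
Proof. by apply: cmor_ext => e; apply/esym/c_sNtM. Qed.
Lemma eMfN x : eM @@ fN @@ x = fN @@ eM @@ x.
Proof. by apply: cmor_ext => e; apply/esym/c_tNsM. Qed.

(** The point [x^-1 fN(x)] is killed by [t_N], hence commutes with [y]; so [x] and [fN(x)] conjugate
    [y] in the same way. *)
Lemma peiffer_N x y : eN @@ y = 1 -> (fN @@ x) * (y * (fN @@ x)^-1) = x * (y * x^-1).
Proof.
move=> ey; have sy : gsN @@ y = 1.
  by rewrite -(ccompK (gsN @@ y) (c1_si cat2_lawsN)) -eNE ey hm1.
have ty : gtN @@ (x^-1 * (fN @@ x)) = 1.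
  by rewrite hmM hmV fNE (ccompK _ (c1_ti cat2_lawsN)) ptE.
have := c1_comm cat2_lawsN sy ty => /(congr1 (fun z => x * (z * (fN @@ x)^-1))).
by rewrite !ptE.
Qed.

Lemma peiffer_M x y : eM @@ y = 1 -> (fM @@ x) * (y * (fM @@ x)^-1) = x * (y * x^-1).
Proof.
move=> ey; have sy : gsM @@ y = 1.
  by rewrite -(ccompK (gsM @@ y) (c1_si cat2_lawsM)) -eME ey hm1.
have ty : gtM @@ (x^-1 * (fM @@ x)) = 1.
  by rewrite hmM hmV fME (ccompK _ (c1_ti cat2_lawsM)) ptE.
have := c1_comm cat2_lawsM sy ty => /(congr1 (fun z => x * (z * (fM @@ x)^-1))).
by rewrite !ptE.
Qed.
End Endo.

Let endoE := (eMeN, fMfN, fMeN, eMfN, eNeN, fNeN, eNfN, fNfN, eMeM, fMeM, eMfM, fMfM).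
Let hmE := (hmM, hmV, hm1).

Let pP : cmor H H := eN @@ eM.
Let pM : cmor H H := eM * (eN @@ eM)^-1.
Let pN : cmor H H := eN * (eN @@ eM)^-1.
(** Solving [x = l n m p] for [l]: the factor [m p] is [eM(x)], and [n^-1] is
    [eN(eM(x)) eN(x)^-1]. *)
Let pL : cmor H H := cidm H * eM^-1 * (eN @@ eM) * eN^-1.

Section Projections.
Variable E : coalg K.
Implicit Types x : cmor E H.
Lemma pPE x : pP @@ x = eN @@ eM @@ x. Proof. by rewrite -ccompA. Qed.
Lemma pME x : pM @@ x = (eM @@ x) * (eN @@ eM @@ x)^-1.
Proof. by rewrite !ptnat -ccompA. Qed.
Lemma pNE x : pN @@ x = (eN @@ x) * (eN @@ eM @@ x)^-1.
Proof. by rewrite !ptnat -ccompA. Qed.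
Lemma pLE x : pL @@ x = x * ((eM @@ x)^-1 * ((eN @@ eM @@ x) * (eN @@ x)^-1)).
Proof. by rewrite !ptnat -ccompA ccomp1f !ptE. Qed.

(** This and its three analogues describe the fixed points by equations in the homomorphisms [eN]
    and [eM]; closure under products and inverses is then immediate, although the projection itself
    need not be multiplicative in the other cases. *)
Lemma pP_fix x : pP @@ x = x <-> eN @@ x = x /\ eM @@ x = x.
Proof.
rewrite pPE; split=> [<- | [xN xM]]; last by rewrite xM xN.
by rewrite !endoE.
Qed.
Lemma pM_fix x : pM @@ x = x <-> eN @@ x = 1 /\ eM @@ x = x.
Proof.
rewrite pME; split=> [<- | [xN xM]]; last by rewrite xM xN !ptE.
by rewrite !(hmE, endoE, ptE).
Qed.
Lemma pN_fix x : pN @@ x = x <-> eN @@ x = x /\ eM @@ x = 1.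
Proof.
rewrite pNE; split=> [<- | [xN xM]]; last by rewrite xN xM hm1 !ptE.
by rewrite !(hmE, endoE, ptE).
Qed.
Lemma pL_fix x : pL @@ x = x <-> eN @@ x = 1 /\ eM @@ x = 1.
Proof.
rewrite pLE; split=> [<- | [xN xM]]; last by rewrite xM xN hm1 !ptE.
by rewrite !(hmE, endoE, ptE).
Qed.
End Projections.

Section MakeSub.
Variable p : cmor H H.
Variable Q : forall E, cmor E H -> Prop.
Hypothesis p_fix : forall E (x : cmor E H), p @@ x = x <-> Q x.
Hypothesis Qp : forall E (x : cmor E H), Q (p @@ x).
Hypothesis Q1 : forall E, Q (1 : cmor E H).
Hypothesis QM : forall E (x y : cmor E H), Q x -> Q y -> Q (x * y).
Hypothesis QV : forall E (x : cmor E H), Q x -> Q x^-1.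

Definition make_sub : { S : sub H | forall E (x : cmor E H), si S @@ sr S @@ x = p @@ x }.
Proof.
have pK : p @@ p = p by apply/p_fix; rewrite -[p]ccompf1; apply: Qp.
have [] := @make_im K H p pK.
- by move=> E; apply/p_fix.
- by move=> E x y /p_fix Qx /p_fix Qy; apply/p_fix/QM.
- by move=> E x /p_fix Qx; apply/p_fix/QV.
move=> I i r iK rK; exists (Sub iK) => E x /=.
by rewrite ccompA rK.
Qed.
End MakeSub.

Let QP E (x : cmor E H) := eN @@ x = x /\ eM @@ x = x.
Let QM E (x : cmor E H) := eN @@ x = 1 /\ eM @@ x = x.
Let QN E (x : cmor E H) := eN @@ x = x /\ eM @@ x = 1.
Let QL E (x : cmor E H) := eN @@ x = 1 /\ eM @@ x = 1.

Definition make_P : { S : sub H | forall E (x : cmor E H), si S @@ sr S @@ x = pP @@ x }.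
Proof.
apply: (make_sub (Q := QP)) => [E x|E x|E|E x y [x1 x2] [y1 y2]|E x [x1 x2]].
- exact: pP_fix.
- by rewrite /QP pPE !(hmE, endoE, ptE).
- by rewrite /QP !hm1.
- by rewrite /QP !hmE x1 x2 y1 y2.
- by rewrite /QP !hmE x1 x2 ?ptE.
Qed.
Definition make_M : { S : sub H | forall E (x : cmor E H), si S @@ sr S @@ x = pM @@ x }.
Proof.
apply: (make_sub (Q := QM)) => [E x|E x|E|E x y [x1 x2] [y1 y2]|E x [x1 x2]].
- exact: pM_fix.
- by rewrite /QM pME !(hmE, endoE, ptE).
- by rewrite /QM !hm1.
- by rewrite /QM !hmE x1 x2 y1 y2 ?ptE.
- by rewrite /QM !hmE x1 x2 ?ptE.
Qed.
Definition make_N : { S : sub H | forall E (x : cmor E H), si S @@ sr S @@ x = pN @@ x }.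
Proof.
apply: (make_sub (Q := QN)) => [E x|E x|E|E x y [x1 x2] [y1 y2]|E x [x1 x2]].
- exact: pN_fix.
- by rewrite /QN pNE !(hmE, endoE, ptE).
- by rewrite /QN !hm1.
- by rewrite /QN !hmE x1 x2 y1 y2 ?ptE.
- by rewrite /QN !hmE x1 x2 ?ptE.
Qed.
Definition make_L : { S : sub H | forall E (x : cmor E H), si S @@ sr S @@ x = pL @@ x }.
Proof.
apply: (make_sub (Q := QL)) => [E x|E x|E|E x y [x1 x2] [y1 y2]|E x [x1 x2]].
- exact: pL_fix.
- by rewrite /QL pLE !(hmE, endoE, ptE).
- by rewrite /QL !hm1.
- by rewrite /QL !hmE x1 x2 y1 y2 ?ptE.
- by rewrite /QL !hmE x1 x2 ?ptE.
Qed.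

Definition gP := sval make_P.
Definition gM := sval make_M.
Definition gN := sval make_N.
Definition gL := sval make_L.

Section Members.
Variable E : coalg K.
Implicit Types x : cmor E H.

Lemma in_gP x : in_sub gP x <-> eN @@ x = x /\ eM @@ x = x.
Proof. by rewrite /in_sub (svalP make_P) pP_fix. Qed.
Lemma in_gM x : in_sub gM x <-> eN @@ x = 1 /\ eM @@ x = x.
Proof. by rewrite /in_sub (svalP make_M) pM_fix. Qed.
Lemma in_gN x : in_sub gN x <-> eN @@ x = x /\ eM @@ x = 1.
Proof. by rewrite /in_sub (svalP make_N) pN_fix. Qed.
Lemma in_gL x : in_sub gL x <-> eN @@ x = 1 /\ eM @@ x = 1.
Proof. by rewrite /in_sub (svalP make_L) pL_fix. Qed.

Lemma gP_sr x : si gP @@ sr gP @@ x = eN @@ eM @@ x.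
Proof. by rewrite (svalP make_P) pPE. Qed.
Lemma gM_sr x : si gM @@ sr gM @@ x = (eM @@ x) * (eN @@ eM @@ x)^-1.
Proof. by rewrite (svalP make_M) pME. Qed.
Lemma gN_sr x : si gN @@ sr gN @@ x = (eN @@ x) * (eN @@ eM @@ x)^-1.
Proof. by rewrite (svalP make_N) pNE. Qed.
Lemma gL_sr x : si gL @@ sr gL @@ x = x * ((eM @@ x)^-1 * ((eN @@ eM @@ x) * (eN @@ x)^-1)).
Proof. by rewrite (svalP make_L) pLE. Qed.

Lemma gP_eN (p : cmor E gP) : eN @@ si gP @@ p = si gP @@ p.
Proof. by have /in_gP[] := si_in p. Qed.
Lemma gP_eM (p : cmor E gP) : eM @@ si gP @@ p = si gP @@ p.
Proof. by have /in_gP[] := si_in p. Qed.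
Lemma gP_fN (p : cmor E gP) : fN @@ si gP @@ p = si gP @@ p.
Proof. by rewrite -gP_eN fNeN. Qed.
Lemma gP_fM (p : cmor E gP) : fM @@ si gP @@ p = si gP @@ p.
Proof. by rewrite -gP_eM fMeM. Qed.
Lemma gM_eN (m : cmor E gM) : eN @@ si gM @@ m = 1.
Proof. by have /in_gM[] := si_in m. Qed.
Lemma gM_eM (m : cmor E gM) : eM @@ si gM @@ m = si gM @@ m.
Proof. by have /in_gM[] := si_in m. Qed.
Lemma gM_fM (m : cmor E gM) : fM @@ si gM @@ m = si gM @@ m.
Proof. by rewrite -gM_eM fMeM. Qed.
Lemma gN_eN (n : cmor E gN) : eN @@ si gN @@ n = si gN @@ n.
Proof. by have /in_gN[] := si_in n. Qed.
Lemma gN_eM (n : cmor E gN) : eM @@ si gN @@ n = 1.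
Proof. by have /in_gN[] := si_in n. Qed.
Lemma gN_fN (n : cmor E gN) : fN @@ si gN @@ n = si gN @@ n.
Proof. by rewrite -gN_eN fNeN. Qed.
Lemma gL_eN (l : cmor E gL) : eN @@ si gL @@ l = 1.
Proof. by have /in_gL[] := si_in l. Qed.
Lemma gL_eM (l : cmor E gL) : eM @@ si gL @@ l = 1.
Proof. by have /in_gL[] := si_in l. Qed.
End Members.

Let memE := (gP_eN, gP_eM, gP_fN, gP_fM, gM_eN, gM_eM, gM_fM, gN_eN, gN_eM, gN_fN, gL_eN, gL_eM).
Let GE := (hmE, endoE, memE, ptE).

(** All four maps of the square are target endomorphisms restricted to subalgebras. Here [fM] lands
    in [gM] because it commutes with [eN] and its values are fixed by [eM]. *)
Definition Glam : hmor gL gM.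
Proof. by apply: (@submor _ _ gL gM fM) => E l; apply/in_gM; rewrite -fMeN gL_eN eMfM hm1. Defined.
Definition Glam' : hmor gL gN.
Proof. by apply: (@submor _ _ gL gN fN) => E l; apply/in_gN; rewrite !GE. Defined.
Definition Gmu : hmor gM gP.
Proof. by apply: (@submor _ _ gM gP fN) => E l; apply/in_gP; rewrite !GE. Defined.
Definition Gnu : hmor gN gP.
Proof. by apply: (@submor _ _ gN gP fM) => E l; apply/in_gP; rewrite -fMeN gN_eN eMfM. Defined.
Definition GaM : hact gP gM.
Proof. by apply: (@subact _ _ gP gM) => E p m; apply/in_gM; rewrite !GE. Defined.
Definition GaN : hact gP gN.
Proof. by apply: (@subact _ _ gP gN) => E p m; apply/in_gN; rewrite !GE. Defined.
Definition GaL : hact gP gL.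
Proof. by apply: (@subact _ _ gP gL) => E p m; apply/in_gL; rewrite !GE. Defined.
Definition Gh : bimor gM gN gL := subcomm gM gN gL.

Section GLaws.
Variable E : coalg K.
Lemma GlamE (l : cmor E gL) : si gM @@ Glam @@ l = fM @@ si gL @@ l.
Proof. exact: submorE. Qed.
Lemma Glam'E (l : cmor E gL) : si gN @@ Glam' @@ l = fN @@ si gL @@ l.
Proof. exact: submorE. Qed.
Lemma GmuE (m : cmor E gM) : si gP @@ Gmu @@ m = fN @@ si gM @@ m.
Proof. exact: submorE. Qed.
Lemma GnuE (n : cmor E gN) : si gP @@ Gnu @@ n = fM @@ si gN @@ n.
Proof. exact: submorE. Qed.
Lemma GaME (p : cmor E gP) x : si gM @@ ap GaM p x = (si gP @@ p) * (si gM @@ x) * (si gP @@ p)^-1.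
Proof. exact: subactE. Qed.
Lemma GaNE (p : cmor E gP) x : si gN @@ ap GaN p x = (si gP @@ p) * (si gN @@ x) * (si gP @@ p)^-1.
Proof. exact: subactE. Qed.
Lemma GaLE (p : cmor E gP) x : si gL @@ ap GaL p x = (si gP @@ p) * (si gL @@ x) * (si gP @@ p)^-1.
Proof. exact: subactE. Qed.
Lemma GhE (m : cmor E gM) (n : cmor E gN) : si gL @@ ap Gh m n =
  (si gM @@ m) * (si gN @@ n) * (si gM @@ m)^-1 * (si gN @@ n)^-1.
Proof. by apply: subcommE => {m n} E' m n; apply/in_gL; rewrite !GE. Qed.
End GLaws.

Let opsE := (GlamE, Glam'E, GmuE, GnuE, GaME, GaNE, GaLE, GhE).

Lemma G_laws : square_laws Glam Glam' Gmu Gnu GaL GaM GaN Gh.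
Proof.
split=> E.
- by move=> l; apply: si_inj; rewrite !opsE fMfN.
- by move=> p m; apply: si_inj; rewrite !(GE, opsE).
- by move=> m m'; apply: si_inj; rewrite !(GE, opsE) peiffer_N ?GE.
- by move=> p n; apply: si_inj; rewrite !(GE, opsE).
- by move=> n n'; apply: si_inj; rewrite !(GE, opsE) peiffer_M ?GE.
- by move=> l l'; apply: si_inj; rewrite !(GE, opsE) peiffer_N ?peiffer_M ?GE.
- by move=> p l; apply: si_inj; rewrite !(GE, opsE).
- by move=> p l; apply: si_inj; rewrite !(GE, opsE).
- by move=> p m n; apply: si_inj; rewrite !(GE, opsE).
- by move=> m n; apply: si_inj; rewrite !(GE, opsE).
- by move=> m n; apply: si_inj; rewrite !(GE, opsE).
(* Both sides equal [l n l^-1 n^-1]: the Peiffer identity replaces [fM(n)] by [n] in conjugating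
   [l], and [fM(l)] by [l] in conjugating [n], as [l] and [n] are both killed by [eM]. *)
- move=> l n; apply: si_inj; rewrite hmM hmV GhE GaLE GnuE GlamE !pmulA.
  rewrite [(fM @@ si gN @@ n) * _]peiffer_M ?GE //.
  have := @peiffer_M _ (si gL @@ l) (si gN @@ n); rewrite gN_eM => /(_ erefl).
  by move=> /(congr1 (fun z => z * (si gN @@ n)^-1)); rewrite !ptE.
- move=> m l; apply: si_inj; rewrite hmM hmV GhE GaLE GmuE Glam'E !pmulA.
  rewrite peiffer_N ?GE //.
  have := @peiffer_N _ (si gM @@ m) (si gL @@ l); rewrite gL_eN => /(_ erefl).
  by move=> /(congr1 (fun z => z * (si gL @@ l)^-1)); rewrite !ptE.
(* Once the action of [nu(n)] is conjugation by [n], what remains is the commutator identity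
   [[m, n n'] = [m, n] n [m, n'] n^-1]. *)
- move=> m n n'; apply: si_inj; rewrite hmM GaLE GnuE [(fM @@ _) * _ * _]pmulA.
  by rewrite peiffer_M ?gL_eM // !(GE, opsE).
- move=> m m' n; apply: si_inj; rewrite hmM GaLE GmuE [(fN @@ _) * _ * _]pmulA.
  by rewrite peiffer_N ?gL_eN // !(GE, opsE).
Qed.

Definition G_obj : xsquare K := to_xsquare G_laws.

End Cat2ToSquare.

(** * Morphisms *)

Section Morphisms.
Variable K : fieldType.

Lemma bimor_morP (A B D A' B' D' : coalg K) (f : bimor A B D) (f' : bimor A' B' D')
    (a : cmor A A') (b : cmor B B') (d : cmor D D') :
  (forall x y, d (f x y) = f' (a x) (b y)) <->
  (forall E (x : cmor E A) (y : cmor E B), d @@ ap f x y = ap f' (a @@ x) (b @@ y)).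
Proof.
have dE E (x : cmor E A) (y : cmor E B) e :
    (d @@ ap f x y) e = bisw (fun x y => d (f x y)) x y e.
  by rewrite /= (lin_csw (g := d)) //; mlin.
split=> [df E x y | df].
  by apply: cmor_ext => e; rewrite dE; apply: eq_csw => u v; apply: df.
by apply: bisw_ext => [||E x y e]; [mlin | mlin | rewrite -dE df].
Qed.

(* Non-morphisms are sent to the unit point, so that functors are total on raw maps. *)
Definition mkh (A B : hopf K) (f : A -> B) : cmor A B :=
  if pselect (hopf_mor f) is left fm then of_hopf_mor fm else pone A B.

Lemma mkhE (A B : hopf K) (f : A -> B) (g : cmor A B) : hopf_mor f -> f =1 g -> mkh f = g.
Proof. by rewrite /mkh => fm fg; case: pselect => // fm'; apply: cmor_ext. Qed.

Lemma mkh_hmor (A B : hopf K) (f : hmor A B) : mkh f = f.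
Proof. by apply: mkhE => //; apply: hmor_hopf_mor. Qed.

Lemma mkh_id (A : hopf K) : @mkh A A (fun x => x) = cidm A.
Proof. exact: (mkh_hmor (hid A)). Qed.

Lemma mkh_comp (A B C : hopf K) (f : hmor A B) (g : hmor B C) :
  mkh (fun x => g (f x)) = g @@ f.
Proof. exact: (mkh_hmor (hcomp g f)). Qed.

Record sqmor (A B : xsquare K) (al : hmor (xL A) (xL B)) (be : hmor (xM A) (xM B))
    (ga : hmor (xN A) (xN B)) (de : hmor (xP A) (xP B)) := Sqmor {
  sm_lam : forall E (l : cmor E (xL A)), be @@ lamh A @@ l = lamh B @@ al @@ l;
  sm_lam' : forall E (l : cmor E (xL A)), ga @@ lamh' A @@ l = lamh' B @@ al @@ l;
  sm_mu : forall E (m : cmor E (xM A)), de @@ muh A @@ m = muh B @@ be @@ m;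
  sm_nu : forall E (n : cmor E (xN A)), de @@ nuh A @@ n = nuh B @@ ga @@ n;
  sm_aL : forall E (p : cmor E (xP A)) l, al @@ ap (aLh A) p l = ap (aLh B) (de @@ p) (al @@ l);
  sm_aM : forall E (p : cmor E (xP A)) m, be @@ ap (aMh A) p m = ap (aMh B) (de @@ p) (be @@ m);
  sm_aN : forall E (p : cmor E (xP A)) n, ga @@ ap (aNh A) p n = ap (aNh B) (de @@ p) (ga @@ n);
  sm_h : forall E (m : cmor E (xM A)) n, al @@ ap (hh A) m n = ap (hh B) (be @@ m) (ga @@ n)
}.

Lemma comp_morP (A B B' D : coalg K) (f : cmor A B) (g : cmor B D) (f' : cmor A B')
    (g' : cmor B' D) :
  (forall x, g (f x) = g' (f' x)) <-> (forall E (x : cmor E A), g @@ f @@ x = g' @@ f' @@ x).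
Proof.
split=> [gf E x | gf x]; first by apply: cmor_ext => e; apply: gf.
by have /(congr1 (fun k : cmor A D => k x)) := gf _ (cidm A).
Qed.

Lemma sqmorP (A B : xsquare K) (al : hmor (xL A) (xL B)) (be : hmor (xM A) (xM B))
    (ga : hmor (xN A) (xN B)) (de : hmor (xP A) (xP B)) :
  sqmor al be ga de <-> @is_xsq_mor K A B (al : _ -> _, be : _ -> _, ga : _ -> _, de : _ -> _).
Proof.
split=> [[s1 s2 s3 s4 s5 s6 s7 s8] | [_ [s1 s2 s3 s4] [s5 s6 s7] s8]].
  split; first by split; apply: hmor_hopf_mor.
  - split; [exact/(comp_morP (lamh A) be al (lamh B)) | exact/(comp_morP (lamh' A) ga al (lamh' B))
      | exact/(comp_morP (muh A) de be (muh B)) | exact/(comp_morP (nuh A) de ga (nuh B))].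
  - by split; [exact/(bimor_morP (aLh A) (aLh B)) | exact/(bimor_morP (aMh A) (aMh B))
      | exact/(bimor_morP (aNh A) (aNh B))].
  - exact/(bimor_morP (hh A) (hh B)).
split.
- exact/(comp_morP (lamh A) be al (lamh B)).
- exact/(comp_morP (lamh' A) ga al (lamh' B)).
- exact/(comp_morP (muh A) de be (muh B)).
- exact/(comp_morP (nuh A) de ga (nuh B)).
- exact/(bimor_morP (aLh A) (aLh B)).
- exact/(bimor_morP (aMh A) (aMh B)).
- exact/(bimor_morP (aNh A) (aNh B)).
- exact/(bimor_morP (hh A) (hh B)).
Qed.

Lemma inverse_hmor (A B : hopf K) (f : hmor A B) (g : cmor B A) :
  g @@ f = cidm A -> f @@ g = cidm B ->
  forall E (x y : cmor E B), g @@ (x * y) = (g @@ x) * (g @@ y).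
Proof.
move=> gf fg E x y.
by rewrite -{1}(ccompK x fg) -{1}(ccompK y fg) -hmM (ccompK _ gf).
Qed.

(** With this, only the forward direction of the unit has to be checked against the structure of
    crossed squares. *)
Lemma inverse_sqmor (A B : xsquare K) (al : hmor (xL A) (xL B)) (be : hmor (xM A) (xM B))
    (ga : hmor (xN A) (xN B)) (de : hmor (xP A) (xP B)) (al' : hmor (xL B) (xL A))
    (be' : hmor (xM B) (xM A)) (ga' : hmor (xN B) (xN A)) (de' : hmor (xP B) (xP A)) :
  al' @@ al = cidm _ -> al @@ al' = cidm _ -> be' @@ be = cidm _ -> be @@ be' = cidm _ ->
  ga' @@ ga = cidm _ -> ga @@ ga' = cidm _ -> de' @@ de = cidm _ -> de @@ de' = cidm _ ->
  sqmor al be ga de -> sqmor al' be' ga' de'.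
Proof.
move=> a1 a2 b1 b2 g1 g2 d1 d2 [s1 s2 s3 s4 s5 s6 s7 s8]; split=> E.
- by move=> l; rewrite -{1}(ccompK l a2) -s1 (ccompK _ b1).
- by move=> l; rewrite -{1}(ccompK l a2) -s2 (ccompK _ g1).
- by move=> m; rewrite -{1}(ccompK m b2) -s3 (ccompK _ d1).
- by move=> n; rewrite -{1}(ccompK n g2) -s4 (ccompK _ d1).
- by move=> p l; rewrite -{1}(ccompK l a2) -{1}(ccompK p d2) -s5 (ccompK _ a1).
- by move=> p m; rewrite -{1}(ccompK m b2) -{1}(ccompK p d2) -s6 (ccompK _ b1).
- by move=> p n; rewrite -{1}(ccompK n g2) -{1}(ccompK p d2) -s7 (ccompK _ g1).
- by move=> m n; rewrite -{1}(ccompK m b2) -{1}(ccompK n g2) -s8 (ccompK _ a1).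
Qed.

Record c2mor (X Y : cat2 K) (f : hmor (cH X) (cH Y)) (fn : hmor (cN X) (cN Y))
    (fm : hmor (cM X) (cM Y)) := C2mor {
  cm_iN : forall E (n : cmor E (cN X)), giN Y @@ fn @@ n = f @@ giN X @@ n;
  cm_iM : forall E (m : cmor E (cM X)), giM Y @@ fm @@ m = f @@ giM X @@ m;
  cm_sN : forall E (x : cmor E (cH X)), gsN Y @@ f @@ x = fn @@ gsN X @@ x;
  cm_tN : forall E (x : cmor E (cH X)), gtN Y @@ f @@ x = fn @@ gtN X @@ x;
  cm_sM : forall E (x : cmor E (cH X)), gsM Y @@ f @@ x = fm @@ gsM X @@ x;
  cm_tM : forall E (x : cmor E (cH X)), gtM Y @@ f @@ x = fm @@ gtM X @@ x
}.

Lemma c2morP (X Y : cat2 K) (f : hmor (cH X) (cH Y)) (fn : hmor (cN X) (cN Y))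
    (fm : hmor (cM X) (cM Y)) :
  c2mor f fn fm <-> @is_cat2_mor K X Y (f : _ -> _, fn : _ -> _, fm : _ -> _).
Proof.
split=> [[s1 s2 s3 s4 s5 s6] | [_ s1 s2 [s3 s4] [s5 s6]]].
  split; first by split; apply: hmor_hopf_mor.
  - exact/(comp_morP fn (giN Y) (giN X) f).
  - exact/(comp_morP fm (giM Y) (giM X) f).
  - by split; [exact/(comp_morP f (gsN Y) (gsN X) fn) | exact/(comp_morP f (gtN Y) (gtN X) fn)].
  - by split; [exact/(comp_morP f (gsM Y) (gsM X) fm) | exact/(comp_morP f (gtM Y) (gtM X) fm)].
split.
- exact/(comp_morP fn (giN Y) (giN X) f).
- exact/(comp_morP fm (giM Y) (giM X) f).
- exact/(comp_morP f (gsN Y) (gsN X) fn).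
- exact/(comp_morP f (gtN Y) (gtN X) fn).
- exact/(comp_morP f (gsM Y) (gsM X) fm).
- exact/(comp_morP f (gtM Y) (gtM X) fm).
Qed.

Lemma inverse_c2mor (X Y : cat2 K) (f : hmor (cH X) (cH Y)) (fn : hmor (cN X) (cN Y))
    (fm : hmor (cM X) (cM Y)) (f' : hmor (cH Y) (cH X)) (fn' : hmor (cN Y) (cN X))
    (fm' : hmor (cM Y) (cM X)) :
  f' @@ f = cidm _ -> f @@ f' = cidm _ -> fn' @@ fn = cidm _ -> fn @@ fn' = cidm _ ->
  fm' @@ fm = cidm _ -> fm @@ fm' = cidm _ -> c2mor f fn fm -> c2mor f' fn' fm'.
Proof.
move=> a1 a2 b1 b2 d1 d2 [s1 s2 s3 s4 s5 s6]; split=> E x.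
- by rewrite -{2}(ccompK x b2) s1 (ccompK _ a1).
- by rewrite -{2}(ccompK x d2) s2 (ccompK _ a1).
- by rewrite -{2}(ccompK x a2) s3 (ccompK _ b1).
- by rewrite -{2}(ccompK x a2) s4 (ccompK _ b1).
- by rewrite -{2}(ccompK x a2) s5 (ccompK _ d1).
- by rewrite -{2}(ccompK x a2) s6 (ccompK _ d1).
Qed.

End Morphisms.

(** * The two functors on morphisms *)

Section Functors.
Variable K : fieldType.
Let actE := (haM, haD, haV, haN, ha1, haK, haKV).
Let hmE := (hmM, hmV, hm1).

Section FMor.
Variables A B : xsquare K.

(** Defined for arbitrary coalgebra maps, because [mkh] promises nothing more on raw data. *)
Definition F_mH (al : cmor (xL A) (xL B)) (be : cmor (xM A) (xM B)) (ga : cmor (xN A) (xN B))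
    (de : cmor (xP A) (xP B)) : cmor (LNMP A) (LNMP B) :=
  quad (al @@ qL A) (ga @@ qN A) (be @@ qM A) (de @@ qP A).
Definition F_mN (ga : cmor (xN A) (xN B)) (de : cmor (xP A) (xP B)) : cmor (NP A) (NP B) :=
  spair (NP B) (ga @@ sd1 (NP A)) (de @@ sd2 (NP A)).
Definition F_mM (be : cmor (xM A) (xM B)) (de : cmor (xP A) (xP B)) : cmor (MP A) (MP B) :=
  spair (MP B) (be @@ sd1 (MP A)) (de @@ sd2 (MP A)).

Definition F_mor (f : xsq_map A B) : cat2_map (F_obj A) (F_obj B) :=
  let: (al, be, ga, de) := f in
  (F_mH (mkh al) (mkh be) (mkh ga) (mkh de) : _ -> _, F_mN (mkh ga) (mkh de) : _ -> _,
   F_mM (mkh be) (mkh de) : _ -> _).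

Section Comp.
Variables (al : cmor (xL A) (xL B)) (be : cmor (xM A) (xM B)) (ga : cmor (xN A) (xN B)).
Variables (de : cmor (xP A) (xP B)) (E : coalg K).
Implicit Types (x : cmor E (LNMP A)) (y : cmor E (MP A)) (z : cmor E (NP A)).
Local Notation FH := (F_mH al be ga de).
Local Notation FN := (F_mN ga de).
Local Notation FM := (F_mM be de).

Lemma F_mHL x : qL B @@ FH @@ x = al @@ qL A @@ x.
Proof. by rewrite /F_mH quad_comp qL_quad -ccompA. Qed.
Lemma F_mHN x : qN B @@ FH @@ x = ga @@ qN A @@ x.
Proof. by rewrite /F_mH quad_comp qN_quad -ccompA. Qed.
Lemma F_mHM x : qM B @@ FH @@ x = be @@ qM A @@ x.
Proof. by rewrite /F_mH quad_comp qM_quad -ccompA. Qed.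
Lemma F_mHP x : qP B @@ FH @@ x = de @@ qP A @@ x.
Proof. by rewrite /F_mH quad_comp qP_quad -ccompA. Qed.
Lemma F_mN1 z : sd1 (NP B) @@ FN @@ z = ga @@ sd1 (NP A) @@ z.
Proof. by rewrite /F_mN spair_comp sd1_pair -ccompA. Qed.
Lemma F_mN2 z : sd2 (NP B) @@ FN @@ z = de @@ sd2 (NP A) @@ z.
Proof. by rewrite /F_mN spair_comp sd2_pair -ccompA. Qed.
Lemma F_mM1 y : sd1 (MP B) @@ FM @@ y = be @@ sd1 (MP A) @@ y.
Proof. by rewrite /F_mM spair_comp sd1_pair -ccompA. Qed.
Lemma F_mM2 y : sd2 (MP B) @@ FM @@ y = de @@ sd2 (MP A) @@ y.
Proof. by rewrite /F_mM spair_comp sd2_pair -ccompA. Qed.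
End Comp.
End FMor.

Let FmE := (F_mHL, F_mHN, F_mHM, F_mHP, F_mN1, F_mN2, F_mM1, F_mM2).
Let quadM := (qPM, qMM, qNM, qLM).

Section FObj.
Variable A : xsquare K.
Lemma gsN_F : gsN (F_obj A) = sNh A :> cmor _ _. Proof. exact: cmor_ext. Qed.
Lemma gtN_F : gtN (F_obj A) = tNh A :> cmor _ _. Proof. exact: cmor_ext. Qed.
Lemma giN_F : giN (F_obj A) = iNh A :> cmor _ _. Proof. exact: cmor_ext. Qed.
Lemma gsM_F : gsM (F_obj A) = sd2 (LNMP A) :> cmor _ _. Proof. exact: cmor_ext. Qed.
Lemma gtM_F : gtM (F_obj A) = tMh A :> cmor _ _. Proof. exact: cmor_ext. Qed.
Lemma giM_F : giM (F_obj A) = iMh A :> cmor _ _. Proof. exact: cmor_ext. Qed.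
End FObj.
Let FoE := (gsN_F, gtN_F, giN_F, gsM_F, gtM_F, giM_F).

Lemma F_c2mor (A B : xsquare K) al be ga de : @sqmor K A B al be ga de ->
  @is_cat2_mor K (F_obj A) (F_obj B)
    (F_mH al be ga de : _ -> _, F_mN ga de : _ -> _, F_mM be de : _ -> _).
Proof.
move=> sm; pose smE := (sm_lam sm, sm_lam' sm, sm_mu sm, sm_nu sm, sm_aL sm, sm_aM sm,
  sm_aN sm, sm_h sm).
have HM E (x y : cmor E (LNMP A)) : F_mH al be ga de @@ (x * y) =
    (F_mH al be ga de @@ x) * (F_mH al be ga de @@ y).
  by apply: quad_ext; rewrite !(FmE, quadM, hmM, smE).
have NM E (x y : cmor E (NP A)) : F_mN ga de @@ (x * y) =
    (F_mN ga de @@ x) * (F_mN ga de @@ y).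
  by apply: sd_ext; rewrite !(FmE, sd1M, hmM, smE).
have MM E (x y : cmor E (MP A)) : F_mM be de @@ (x * y) =
    (F_mM be de @@ x) * (F_mM be de @@ y).
  by apply: sd_ext; rewrite !(FmE, sd1M, hmM, smE).
apply/(c2morP (X := F_obj A) (Y := F_obj B) (Hmor HM) (Hmor NM) (Hmor MM)).
split=> E x; rewrite !FoE; cbn [hm].
- by apply: quad_ext; rewrite !(FmE, compE, hm1).
- by apply: quad_ext; rewrite !(FmE, compE, hm1).
- by apply: sd_ext; rewrite !(FmE, compE).
- by apply: sd_ext; rewrite !(FmE, compE, hmM, smE).
- by apply: sd_ext; rewrite !(FmE, compE).
- by apply: sd_ext; rewrite !(FmE, compE, hmM, smE).
Qed.

(** Replaces raw maps by bundled homomorphisms with the same underlying functions, after which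
    [mkh_hmor] removes every [mkh]. *)
Lemma xsq_morW (A B : xsquare K) (f : xsq_map A B) : is_xsq_mor f ->
  exists al be ga de, [/\ @sqmor K A B al be ga de &
    f = (al : _ -> _, be : _ -> _, ga : _ -> _, de : _ -> _)].
Proof.
case: f => [[[al be] ga] de] fm; have [[h1 h2 h3 h4] _ _ _] := fm.
exists (of_hopf_mor h1), (of_hopf_mor h2), (of_hopf_mor h3), (of_hopf_mor h4).
by split=> //; apply/sqmorP.
Qed.

Lemma cat2_morW (X Y : cat2 K) (f : cat2_map X Y) : is_cat2_mor f ->
  exists f0 fn fm, [/\ @c2mor K X Y f0 fn fm & f = (f0 : _ -> _, fn : _ -> _, fm : _ -> _)].
Proof.
case: f => [[f0 fn] fm] fmor; have [[h1 h2 h3] _ _ _ _] := fmor.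
exists (of_hopf_mor h1), (of_hopf_mor h2), (of_hopf_mor h3).
by split=> //; apply/c2morP.
Qed.

Lemma F_functor : @is_functor (XSq_cat K) (Cat2_cat K) (@F_obj K) F_mor.
Proof.
split.
- move=> A B f /xsq_morW[al [be [ga [de [sm ->]]]]].
  by rewrite /F_mor !mkh_hmor; apply: F_c2mor.
- move=> A; rewrite /F_mor /= !mkh_id.
  congr (_, _, _).
  + apply: (congr1 (@cfun _ _ _) (y := cidm (LNMP A))); rewrite -[LHS]ccompf1.
    by apply: quad_ext; rewrite FmE !ccomp1f.
  + apply: (congr1 (@cfun _ _ _) (y := cidm (NP A))); rewrite -[LHS]ccompf1.
    by apply: sd_ext; rewrite FmE !ccomp1f.
  + apply: (congr1 (@cfun _ _ _) (y := cidm (MP A))); rewrite -[LHS]ccompf1.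
    by apply: sd_ext; rewrite FmE !ccomp1f.
- move=> A B C f g /xsq_morW[al [be [ga [de [sm ->]]]]] /xsq_morW[al' [be' [ga' [de' [sm' ->]]]]].
  rewrite /F_mor /= !mkh_hmor !mkh_comp; congr (_, _, _).
  + rewrite -[RHS]/(cfun (F_mH al' be' ga' de' @@ F_mH al be ga de)); apply: (congr1 (@cfun _ _ _)).
    rewrite -[LHS]ccompf1 -[RHS]ccompf1.
    by rewrite -[RHS]ccompA; apply: quad_ext; rewrite !FmE -!ccompA.
  + rewrite -[RHS]/(cfun (F_mN ga' de' @@ F_mN ga de)); apply: (congr1 (@cfun _ _ _)).
    rewrite -[LHS]ccompf1 -[RHS]ccompf1.
    by rewrite -[RHS]ccompA; apply: sd_ext; rewrite !FmE -!ccompA.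
  + rewrite -[RHS]/(cfun (F_mM be' de' @@ F_mM be de)); apply: (congr1 (@cfun _ _ _)).
    rewrite -[LHS]ccompf1 -[RHS]ccompf1.
    by rewrite -[RHS]ccompA; apply: sd_ext; rewrite !FmE -!ccompA.
Qed.

Section GMor.
Variables X Y : cat2 K.

(** Retracting onto [T] makes this total in [f]; it is the restriction of [f] when [f] carries
    points of [S] into [T], as for morphisms of cat2-objects ([submap_L] and its analogues). *)
Definition submap (S : sub (cH X)) (T : sub (cH Y)) (f : cmor (cH X) (cH Y)) : cmor S T :=
  sr T @@ f @@ si S.

(** The components on [N] and [M] of a morphism are restrictions of [f0], so [f0] carries all the
    information. *)
Definition G_mor (f : cat2_map X Y) : xsq_map (G_obj X) (G_obj Y) :=
  let: (f0, _, _) := f in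
  (submap (gL X) (gL Y) (mkh f0) : _ -> _, submap (gM X) (gM Y) (mkh f0) : _ -> _,
   submap (gN X) (gN Y) (mkh f0) : _ -> _, submap (gP X) (gP Y) (mkh f0) : _ -> _).

Variables (f : hmor (cH X) (cH Y)) (fn : hmor (cN X) (cN Y)) (fm : hmor (cM X) (cM Y)).
Hypothesis cm : c2mor f fn fm.

Section Endo.
Variable E : coalg K.
Implicit Types x : cmor E (cH X).
Lemma cm_eN x : eN Y @@ f @@ x = f @@ eN X @@ x.
Proof. by rewrite !eNE (cm_sN cm) (cm_iN cm). Qed.
Lemma cm_fN x : fN Y @@ f @@ x = f @@ fN X @@ x.
Proof. by rewrite !fNE (cm_tN cm) (cm_iN cm). Qed.
Lemma cm_eM x : eM Y @@ f @@ x = f @@ eM X @@ x.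
Proof. by rewrite !eME (cm_sM cm) (cm_iM cm). Qed.
Lemma cm_fM x : fM Y @@ f @@ x = f @@ fM X @@ x.
Proof. by rewrite !fME (cm_tM cm) (cm_iM cm). Qed.
End Endo.

Section SubMap.
Variable E : coalg K.
Lemma submap_L (l : cmor E (gL X)) : si (gL Y) @@ submap (gL X) (gL Y) f @@ l = f @@ si (gL X) @@ l.
Proof. by rewrite -!ccompA; apply/in_gL; rewrite cm_eN cm_eM gL_eN gL_eM hm1. Qed.
Lemma submap_M (m : cmor E (gM X)) : si (gM Y) @@ submap (gM X) (gM Y) f @@ m = f @@ si (gM X) @@ m.
Proof. by rewrite -!ccompA; apply/in_gM; rewrite cm_eN cm_eM gM_eN gM_eM hm1. Qed.
Lemma submap_N (n : cmor E (gN X)) : si (gN Y) @@ submap (gN X) (gN Y) f @@ n = f @@ si (gN X) @@ n.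
Proof. by rewrite -!ccompA; apply/in_gN; rewrite cm_eN cm_eM gN_eN gN_eM hm1. Qed.
Lemma submap_P (p : cmor E (gP X)) : si (gP Y) @@ submap (gP X) (gP Y) f @@ p = f @@ si (gP X) @@ p.
Proof. by rewrite -!ccompA; apply/in_gP; rewrite cm_eN cm_eM gP_eN gP_eM. Qed.
End SubMap.
End GMor.

Section GObj.
Variables (X : cat2 K) (E : coalg K).
Local Notation A := (G_obj X).
Local Notation iL := (si (gL X)).
Local Notation iM := (si (gM X)).
Local Notation iN := (si (gN X)).
Local Notation iP := (si (gP X)).
Implicit Types (l : cmor E (xL A)) (m : cmor E (xM A)) (n : cmor E (xN A)) (p : cmor E (xP A)).

Lemma G_lamh l : iM @@ lamh A @@ l = fM X @@ iL @@ l. Proof. by rewrite -GlamE; apply: cmor_ext. Qed.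
Lemma G_lamh' l : iN @@ lamh' A @@ l = fN X @@ iL @@ l. Proof. by rewrite -Glam'E; apply: cmor_ext. Qed.
Lemma G_muh m : iP @@ muh A @@ m = fN X @@ iM @@ m. Proof. by rewrite -GmuE; apply: cmor_ext. Qed.
Lemma G_nuh n : iP @@ nuh A @@ n = fM X @@ iN @@ n. Proof. by rewrite -GnuE; apply: cmor_ext. Qed.
Lemma G_aLh p l : iL @@ ap (aLh A) p l = (iP @@ p) * (iL @@ l) * (iP @@ p)^-1.
Proof. by rewrite -GaLE; apply: cmor_ext. Qed.
Lemma G_aMh p m : iM @@ ap (aMh A) p m = (iP @@ p) * (iM @@ m) * (iP @@ p)^-1.
Proof. by rewrite -GaME; apply: cmor_ext. Qed.
Lemma G_aNh p n : iN @@ ap (aNh A) p n = (iP @@ p) * (iN @@ n) * (iP @@ p)^-1.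
Proof. by rewrite -GaNE; apply: cmor_ext. Qed.
Lemma G_hh m n : iL @@ ap (hh A) m n = (iM @@ m) * (iN @@ n) * (iM @@ m)^-1 * (iN @@ n)^-1.
Proof. by rewrite -GhE; apply: cmor_ext. Qed.
End GObj.
Local Opaque lamh lamh' muh nuh aLh aMh aNh hh.

Lemma G_sqmor (X Y : cat2 K) f fn fm : @c2mor K X Y f fn fm ->
  @is_xsq_mor K (G_obj X) (G_obj Y)
   (submap (gL X) (gL Y) f : _ -> _, submap (gM X) (gM Y) f : _ -> _,
    submap (gN X) (gN Y) f : _ -> _, submap (gP X) (gP Y) f : _ -> _).
Proof.
move=> cm; pose smE := (submap_L cm, submap_M cm, submap_N cm, submap_P cm).
have LM E (x y : cmor E (gL X)) : submap _ (gL Y) f @@ (x * y) =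
  (submap _ (gL Y) f @@ x) * (submap _ (gL Y) f @@ y).
  by apply: si_inj; rewrite !(smE, hmM).
have MM E (x y : cmor E (gM X)) : submap _ (gM Y) f @@ (x * y) =
  (submap _ (gM Y) f @@ x) * (submap _ (gM Y) f @@ y).
  by apply: si_inj; rewrite !(smE, hmM).
have NM E (x y : cmor E (gN X)) : submap _ (gN Y) f @@ (x * y) =
  (submap _ (gN Y) f @@ x) * (submap _ (gN Y) f @@ y).
  by apply: si_inj; rewrite !(smE, hmM).
have PM E (x y : cmor E (gP X)) : submap _ (gP Y) f @@ (x * y) =
  (submap _ (gP Y) f @@ x) * (submap _ (gP Y) f @@ y).
  by apply: si_inj; rewrite !(smE, hmM).
apply/(sqmorP (A := G_obj X) (B := G_obj Y) (Hmor LM) (Hmor MM) (Hmor NM) (Hmor PM)).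
split=> E; cbn [hm].
- by move=> l; apply: si_inj; rewrite (submap_M cm) !G_lamh (submap_L cm) (cm_fM cm).
- by move=> l; apply: si_inj; rewrite (submap_N cm) !G_lamh' (submap_L cm) (cm_fN cm).
- by move=> m; apply: si_inj; rewrite (submap_P cm) !G_muh (submap_M cm) (cm_fN cm).
- by move=> n; apply: si_inj; rewrite (submap_P cm) !G_nuh (submap_N cm) (cm_fM cm).
- by move=> p l; apply: si_inj; rewrite (submap_L cm) !G_aLh (submap_P cm) (submap_L cm) !hmE.
- by move=> p m; apply: si_inj; rewrite (submap_M cm) !G_aMh (submap_P cm) (submap_M cm) !hmE.
- by move=> p n; apply: si_inj; rewrite (submap_N cm) !G_aNh (submap_P cm) (submap_N cm) !hmE.
- by move=> m n; apply: si_inj; rewrite (submap_L cm) !G_hh (submap_M cm) (submap_N cm) !hmE.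
Qed.

Lemma G_functor : @is_functor (Cat2_cat K) (XSq_cat K) (@G_obj K) G_mor.
Proof.
split.
- move=> X Y f /cat2_morW[f0 [fn [fm [cm ->]]]].
  by rewrite /G_mor !mkh_hmor; apply: (G_sqmor cm).
- move=> X; rewrite /G_mor /= !mkh_id.
  have key (S : sub (cH X)) : cfun (submap S S (cidm _)) = (fun x => x).
    by rewrite -[RHS]/(cfun (cidm S)) /submap ccomp1f siK.
  by congr (_, _, _, _); apply: key.
- move=> X Y Z f g /cat2_morW[f0 [fn [fm [cm ->]]]] /cat2_morW[f0' [fn' [fm' [cm' ->]]]].
  rewrite /G_mor /= !mkh_hmor !mkh_comp.
  (* The composite on the right retracts onto [T] midway; by hypothesis the image under [f0] already
     lies in [T], so this retraction is invisible. *)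
  have key (S : sub (cH X)) (T : sub (cH Y)) (U : sub (cH Z)) :
    (forall E (x : cmor E S), si T @@ submap S T f0 @@ x = f0 @@ si S @@ x) ->
    cfun (submap S U (f0' @@ f0)) = (fun x => submap T U f0' (submap S T f0 x)).
    move=> st; rewrite -[RHS]/(cfun (submap T U f0' @@ submap S T f0)); apply: (congr1 (@cfun _ _ _)).
    by rewrite /submap -!ccompA; have := st _ (cidm S); rewrite !ccompf1 => ->.
  congr (_, _, _, _); apply: key => E x.
  + exact: (submap_L cm).
  + exact: (submap_M cm).
  + exact: (submap_N cm).
  + exact: (submap_P cm).
Qed.

End Functors.

(** * Natural isomorphisms *)

(** Clears inverses from conjugations and commutators, so that identities in [LNMP] are compared by
    the coordinates of products and no coordinates of an inverse are computed. *)
Lemma pconjE (K : fieldType) (E : coalg K) (H : hopf K) (x y w : cmor E H) :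
  x * w = y -> x = y * w^-1.
Proof. by move=> <-; rewrite !ptE. Qed.

(** * The unit of the equivalence *)

Section Unit.
Variables (K : fieldType) (A : xsquare K).
Local Notation X := (F_obj A).

Section FEndo.
Variables (E : coalg K) (x : cmor E (LNMP A)).
Lemma F_eN : eN X @@ x = quad 1 (qN A @@ x) 1 (qP A @@ x).
Proof.
rewrite eNE gsN_F giN_F; apply: quad_ext; rewrite ?qL_quad ?qN_quad ?qM_quad ?qP_quad.
- by rewrite iN_L.
- by rewrite iN_N sN_N.
- by rewrite iN_M.
- by rewrite iN_P sN_P.
Qed.
Lemma F_eM : eM X @@ x = quad 1 1 (qM A @@ x) (qP A @@ x).
Proof.
rewrite eME gsM_F giM_F; apply: quad_ext; rewrite ?qL_quad ?qN_quad ?qM_quad ?qP_quad.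
- by rewrite iM_L.
- by rewrite iM_N.
- by rewrite iM_M sM_M.
- by rewrite iM_P sM_P.
Qed.
Lemma F_fN : fN X @@ x =
  quad 1 ((lamh' A @@ qL A @@ x) * (qN A @@ x)) 1 ((muh A @@ qM A @@ x) * (qP A @@ x)).
Proof.
rewrite fNE gtN_F giN_F; apply: quad_ext; rewrite ?qL_quad ?qN_quad ?qM_quad ?qP_quad.
- by rewrite iN_L.
- by rewrite iN_N tNh_N.
- by rewrite iN_M.
- by rewrite iN_P tNh_P.
Qed.
Lemma F_fM : fM X @@ x =
  quad 1 1 ((lamh A @@ qL A @@ x) * ap (aMh A) (nuh A @@ qN A @@ x) (qM A @@ x))
    ((nuh A @@ qN A @@ x) * (qP A @@ x)).
Proof.
rewrite fME gtM_F giM_F; apply: quad_ext; rewrite ?qL_quad ?qN_quad ?qM_quad ?qP_quad.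
- by rewrite iM_L.
- by rewrite iM_N.
- by rewrite iM_M tMh_M.
- by rewrite iM_P tMh_P.
Qed.
End FEndo.

Lemma quad1 E : quad 1 1 1 1 = 1 :> cmor E (LNMP A).
Proof.
by apply: quad_ext; rewrite ?qL_quad ?qN_quad ?qM_quad ?qP_quad ?qL1 ?qN1 ?qM1 ?qP1.
Qed.

Definition etaL : cmor (xL A) (gL X) := sr (gL X) @@ quad (cidm (xL A)) 1 1 1.
Definition etaN : cmor (xN A) (gN X) := sr (gN X) @@ quad 1 (cidm (xN A)) 1 1.
Definition etaM : cmor (xM A) (gM X) := sr (gM X) @@ quad 1 1 (cidm (xM A)) 1.
Definition etaP : cmor (xP A) (gP X) := sr (gP X) @@ quad 1 1 1 (cidm (xP A)).
Definition etaL' : cmor (gL X) (xL A) := qL A @@ si (gL X).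
Definition etaN' : cmor (gN X) (xN A) := qN A @@ si (gN X).
Definition etaM' : cmor (gM X) (xM A) := qM A @@ si (gM X).
Definition etaP' : cmor (gP X) (xP A) := qP A @@ si (gP X).

Section Eta.
Variable E : coalg K.
Lemma etaLE (l : cmor E (xL A)) : si (gL X) @@ etaL @@ l = quad l 1 1 1.
Proof.
rewrite -ccompA quad_comp ccomp1f !pone_comp; apply/in_gL.
by rewrite F_eN F_eM qN_quad qM_quad qP_quad quad1.
Qed.
Lemma etaNE (n : cmor E (xN A)) : si (gN X) @@ etaN @@ n = quad 1 n 1 1.
Proof.
rewrite -ccompA quad_comp ccomp1f !pone_comp; apply/in_gN.
by rewrite F_eN F_eM qN_quad qM_quad qP_quad quad1.
Qed.
Lemma etaME (m : cmor E (xM A)) : si (gM X) @@ etaM @@ m = quad 1 1 m 1.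
Proof.
rewrite -ccompA quad_comp ccomp1f !pone_comp; apply/in_gM.
by rewrite F_eN F_eM qN_quad qM_quad qP_quad quad1.
Qed.
Lemma etaPE (p : cmor E (xP A)) : si (gP X) @@ etaP @@ p = quad 1 1 1 p.
Proof.
rewrite -ccompA quad_comp ccomp1f !pone_comp; apply/in_gP.
by rewrite F_eN F_eM qN_quad qM_quad qP_quad.
Qed.
End Eta.

Let quadE := (qL_quad, qN_quad, qM_quad, qP_quad, qPM, qMM, qNM, qLM).
Let qq := (qL_quad, qN_quad, qM_quad, qP_quad).
Let actE := (haM, haD, haV, haN, ha1, haK, haKV).
Let oneE := (hm1, h1n, hn1, actE, ptE).

Lemma etaLK : etaL' @@ etaL = cidm _.
Proof. by rewrite -[etaL]ccompf1 -ccompA etaLE qL_quad. Qed.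
Lemma etaNK : etaN' @@ etaN = cidm _.
Proof. by rewrite -[etaN]ccompf1 -ccompA etaNE qN_quad. Qed.
Lemma etaMK : etaM' @@ etaM = cidm _.
Proof. by rewrite -[etaM]ccompf1 -ccompA etaME qM_quad. Qed.
Lemma etaPK : etaP' @@ etaP = cidm _.
Proof. by rewrite -[etaP]ccompf1 -ccompA etaPE qP_quad. Qed.

Section Fixed.
Variables (E : coalg K) (x : cmor E (LNMP A)).
Lemma F_eN1 : eN X @@ x = 1 -> qN A @@ x = 1 /\ qP A @@ x = 1.
Proof.
rewrite F_eN => e; split; first by rewrite -(qN1 A E) -e qN_quad.
by rewrite -(qP1 A E) -e qP_quad.
Qed.
Lemma F_eM1 : eM X @@ x = 1 -> qM A @@ x = 1 /\ qP A @@ x = 1.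
Proof.
rewrite F_eM => e; split; first by rewrite -(qM1 A E) -e qM_quad.
by rewrite -(qP1 A E) -e qP_quad.
Qed.
Lemma F_eNx : eN X @@ x = x -> qL A @@ x = 1 /\ qM A @@ x = 1.
Proof. by rewrite F_eN => <-; rewrite qL_quad qM_quad. Qed.
Lemma F_eMx : eM X @@ x = x -> qL A @@ x = 1 /\ qN A @@ x = 1.
Proof. by rewrite F_eM => <-; rewrite qL_quad qN_quad. Qed.
End Fixed.

Lemma etaLK' : etaL @@ etaL' = cidm _.
Proof.
apply: si_inj; rewrite etaLE ccompf1.
(* For the universal point of [gL], being killed by [eN] and [eM] means that the coordinates [n],
   [m] and [p] are trivial. *)
have /in_gL[/F_eN1[n1 p1] /F_eM1[m1 _]] := si_in (cidm (gL X)).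
by move: n1 p1 m1; rewrite !ccompf1 => n1 p1 m1; apply: quad_ext; rewrite qq.
Qed.
Lemma etaNK' : etaN @@ etaN' = cidm _.
Proof.
apply: si_inj; rewrite etaNE ccompf1.
have /in_gN[/F_eNx[l1 m1] /F_eM1[_ p1]] := si_in (cidm (gN X)).
by move: l1 m1 p1; rewrite !ccompf1 => l1 m1 p1; apply: quad_ext; rewrite qq.
Qed.
Lemma etaMK' : etaM @@ etaM' = cidm _.
Proof.
apply: si_inj; rewrite etaME ccompf1.
have /in_gM[/F_eN1[n1 p1] /F_eMx[l1 _]] := si_in (cidm (gM X)).
by move: n1 p1 l1; rewrite !ccompf1 => n1 p1 l1; apply: quad_ext; rewrite qq.
Qed.
Lemma etaPK' : etaP @@ etaP' = cidm _.
Proof.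
apply: si_inj; rewrite etaPE ccompf1.
have /in_gP[/F_eNx[l1 m1] /F_eMx[_ n1]] := si_in (cidm (gP X)).
by move: l1 m1 n1; rewrite !ccompf1 => l1 m1 n1; apply: quad_ext; rewrite qq.
Qed.

Definition hetaL : hmor (xL A) (gL X).
Proof.
exists etaL => E x y; apply: si_inj; rewrite hmM !etaLE.
by apply: quad_ext; rewrite !(quadE, oneE).
Defined.
Definition hetaN : hmor (xN A) (gN X).
Proof.
exists etaN => E x y; apply: si_inj; rewrite hmM !etaNE.
by apply: quad_ext; rewrite !(quadE, oneE).
Defined.
Definition hetaM : hmor (xM A) (gM X).
Proof.
exists etaM => E x y; apply: si_inj; rewrite hmM !etaME.
by apply: quad_ext; rewrite !(quadE, oneE).
Defined.
Definition hetaP : hmor (xP A) (gP X).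
Proof.
exists etaP => E x y; apply: si_inj; rewrite hmM !etaPE.
by apply: quad_ext; rewrite !(quadE, oneE).
Defined.

Local Opaque lamh lamh' muh nuh aLh aMh aNh hh.

Lemma eta_sqmor : @sqmor K A (G_obj X) hetaL hetaM hetaN hetaP.
Proof.
split=> E; cbn [hm].
- move=> l; apply: si_inj; rewrite etaME G_lamh etaLE F_fM.
  by rewrite !(qq, oneE).
- move=> l; apply: si_inj; rewrite etaNE G_lamh' etaLE F_fN.
  by rewrite !(qq, oneE).
- move=> m; apply: si_inj; rewrite etaPE G_muh etaME F_fN.
  by rewrite !(qq, oneE).
- move=> n; apply: si_inj; rewrite etaPE G_nuh etaNE F_fM.
  by rewrite !(qq, oneE).
- move=> p l; apply: si_inj; rewrite etaLE G_aLh etaLE etaPE.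
  by apply: pconjE; apply: quad_ext; rewrite !(quadE, oneE).
- move=> p m; apply: si_inj; rewrite etaME G_aMh etaME etaPE.
  by apply: pconjE; apply: quad_ext; rewrite !(quadE, oneE).
- move=> p n; apply: si_inj; rewrite etaNE G_aNh etaNE etaPE.
  by apply: pconjE; apply: quad_ext; rewrite !(quadE, oneE).
- move=> m n; apply: si_inj; rewrite etaLE G_hh etaME etaNE.
  (* With both inverses cleared the claim reads [h(m, n) n m = m n], which is how [h] enters the
     multiplication of [LNMP]. *)
  by do 2!apply: pconjE; apply: quad_ext; rewrite !(quadE, oneE).
Qed.

End Unit.

(** * The counit of the equivalence *)

Section Counit.
Variables (K : fieldType) (X : cat2 K).
Local Notation A := (G_obj X).
Local Notation iL := (si (gL X)).
Local Notation iM := (si (gM X)).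
Local Notation iN := (si (gN X)).
Local Notation iP := (si (gP X)).
Local Opaque lamh lamh' muh nuh aLh aMh aNh hh.

Definition epsH : cmor (LNMP A) (cH X) :=
  (iL @@ qL A) * ((iN @@ qN A) * ((iM @@ qM A) * (iP @@ qP A))).
(** The Hopf algebra [cN X] is separate from [cH X]; the product [n p] lies in the image of [giN],
    and [gsN] brings it back. *)
Definition epsN : cmor (NP A) (cN X) := gsN X @@ ((iN @@ sd1 (NP A)) * (iP @@ sd2 (NP A))).
Definition epsM : cmor (MP A) (cM X) := gsM X @@ ((iM @@ sd1 (MP A)) * (iP @@ sd2 (MP A))).
Definition epsH' : cmor (cH X) (LNMP A) :=
  @quad K A _ (sr (gL X)) (sr (gN X)) (sr (gM X)) (sr (gP X)).
Definition epsN' : cmor (cN X) (NP A) := spair (NP A) (sr (gN X) @@ giN X) (sr (gP X) @@ giN X).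
Definition epsM' : cmor (cM X) (MP A) := spair (MP A) (sr (gM X) @@ giM X) (sr (gP X) @@ giM X).

Let hmE := (hmM, hmV, hm1).
Let memE := (gP_eN, gP_eM, gP_fN, gP_fM, gM_eN, gM_eM, gM_fM, gN_eN, gN_eM, gN_fN, gL_eN, gL_eM).

Lemma giN_inj E (x y : cmor E (cN X)) : giN X @@ x = giN X @@ y -> x = y.
Proof. by move=> /(congr1 (ccomp (gsN X))); rewrite !(ccompK _ (c1_si (cat2_lawsN X))). Qed.
Lemma giM_inj E (x y : cmor E (cM X)) : giM X @@ x = giM X @@ y -> x = y.
Proof. by move=> /(congr1 (ccomp (gsM X))); rewrite !(ccompK _ (c1_si (cat2_lawsM X))). Qed.

Section EpsE.
Variable E : coalg K.
Implicit Types (x : cmor E (LNMP A)) (y : cmor E (MP A)) (z : cmor E (NP A)).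
Lemma epsHE x : epsH @@ x =
  (iL @@ qL A @@ x) * ((iN @@ qN A @@ x) * ((iM @@ qM A @@ x) * (iP @@ qP A @@ x))).
Proof. by rewrite !pmul_comp -!ccompA. Qed.
Lemma epsNE z : giN X @@ epsN @@ z = (iN @@ sd1 (NP A) @@ z) * (iP @@ sd2 (NP A) @@ z).
Proof. by rewrite -ccompA pmul_comp -!ccompA -eNE hmM gN_eN gP_eN. Qed.
Lemma epsME y : giM X @@ epsM @@ y = (iM @@ sd1 (MP A) @@ y) * (iP @@ sd2 (MP A) @@ y).
Proof. by rewrite -ccompA pmul_comp -!ccompA -eME hmM gM_eM gP_eM. Qed.

Lemma epsH'L (x : cmor E (cH X)) : qL A @@ epsH' @@ x = sr (gL X) @@ x.
Proof. by rewrite quad_comp qL_quad. Qed.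
Lemma epsH'N (x : cmor E (cH X)) : qN A @@ epsH' @@ x = sr (gN X) @@ x.
Proof. by rewrite quad_comp qN_quad. Qed.
Lemma epsH'M (x : cmor E (cH X)) : qM A @@ epsH' @@ x = sr (gM X) @@ x.
Proof. by rewrite quad_comp qM_quad. Qed.
Lemma epsH'P (x : cmor E (cH X)) : qP A @@ epsH' @@ x = sr (gP X) @@ x.
Proof. by rewrite quad_comp qP_quad. Qed.

(* By the Peiffer identities, [nu n] and [mu m] act on [L] as [n] and [m] do. *)
Lemma G_nu_act n (l : cmor E (xL A)) :
  iL @@ ap (aLh A) (nuh A @@ n) l = (iN @@ n) * ((iL @@ l) * (iN @@ n)^-1).
Proof. by rewrite G_aLh G_nuh pmulA peiffer_M // gL_eM. Qed.
Lemma G_mu_act m (l : cmor E (xL A)) :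
  iL @@ ap (aLh A) (muh A @@ m) l = (iM @@ m) * ((iL @@ l) * (iM @@ m)^-1).
Proof. by rewrite G_aLh G_muh pmulA peiffer_N // gL_eN. Qed.
End EpsE.

Definition hepsH : hmor (LNMP A) (cH X).
Proof.
exists epsH => E x y; rewrite !epsHE qLM qNM qMM qPM !hmM.
(* Every action becomes a conjugation and [h] a commutator inside [cH X]; the two sides are then
   equal as words in a group. *)
rewrite G_nu_act hmM G_mu_act G_aLh G_hh !G_aNh G_aMh.
by rewrite !ptE.
Defined.
Definition hepsN : hmor (NP A) (cN X).
Proof.
by exists epsN => E x y; apply: giN_inj; rewrite hmM !epsNE sd1M !hmM G_aNh !ptE.
Defined.
Definition hepsM : hmor (MP A) (cM X).
Proof.
by exists epsM => E x y; apply: giM_inj; rewrite hmM !epsME sd1M !hmM G_aMh !ptE.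
Defined.

Lemma eps_c2mor : @c2mor K (F_obj A) X hepsH hepsN hepsM.
Proof.
split=> E x; cbn [hm].
- by rewrite epsNE giN_F epsHE iN_L iN_N iN_M iN_P !hm1 !ptE.
- by rewrite epsME giM_F epsHE iM_L iM_N iM_M iM_P !hm1 !ptE.
- apply: giN_inj; rewrite epsNE gsN_F sN_N sN_P -eNE epsHE !hmM.
  by rewrite gL_eN gN_eN gM_eN gP_eN !ptE.
- apply: giN_inj; rewrite epsNE gtN_F tNh_N tNh_P -fNE epsHE !hmM.
  by rewrite G_lamh' G_muh gN_fN gP_fN !ptE.
- apply: giM_inj; rewrite epsME gsM_F sM_M sM_P -eME epsHE !hmM.
  by rewrite gL_eM gN_eM gM_eM gP_eM !ptE.
- apply: giM_inj; rewrite epsME gtM_F tMh_M tMh_P -fME epsHE !hmM.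
  by rewrite G_lamh G_aMh G_nuh gM_fM gP_fM !ptE.
Qed.

Lemma epsHK : epsH' @@ epsH = cidm _.
Proof.
rewrite -[epsH]ccompf1; apply: quad_ext; rewrite ?(epsH'L, epsH'N, epsH'M, epsH'P);
  apply: si_inj; rewrite ?(gL_sr, gN_sr, gM_sr, gP_sr) epsHE !hmM.
- by rewrite !(hmE, memE, ptE).
- by rewrite !(hmE, memE, ptE).
- by rewrite !(hmE, memE, ptE).
- by rewrite !(hmE, memE, ptE).
Qed.

(** The product of the four projections of [x] telescopes to [x]. *)
Lemma epsHK' : epsH @@ epsH' = cidm _.
Proof.
rewrite -[epsH']ccompf1 epsHE epsH'L epsH'N epsH'M epsH'P gL_sr gN_sr gM_sr gP_sr.
by rewrite !ptE.
Qed.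

Lemma epsNK : epsN' @@ epsN = cidm _.
Proof.
rewrite -[epsN]ccompf1 spair_comp -!(ccompA _ (giN X)) epsNE.
apply: sd_ext; rewrite ?sd1_pair ?sd2_pair; apply: si_inj.
  by rewrite gN_sr !(hmE, memE, ptE).
by rewrite gP_sr !(hmE, memE, ptE).
Qed.
Lemma epsNK' : epsN @@ epsN' = cidm _.
Proof.
apply: giN_inj; rewrite epsNE sd1_pair sd2_pair gN_sr gP_sr !ptE.
by rewrite eNE (c1_si (cat2_lawsN X)).
Qed.
Lemma epsMK : epsM' @@ epsM = cidm _.
Proof.
rewrite -[epsM]ccompf1 spair_comp -!(ccompA _ (giM X)) epsME.
apply: sd_ext; rewrite ?sd1_pair ?sd2_pair; apply: si_inj.
  by rewrite gM_sr !(hmE, memE, ptE).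
by rewrite gP_sr !(hmE, memE, ptE).
Qed.
Lemma epsMK' : epsM @@ epsM' = cidm _.
Proof.
apply: giM_inj; rewrite epsME sd1_pair sd2_pair gM_sr gP_sr !ptE.
by rewrite eME (c1_si (cat2_lawsM X)).
Qed.

End Counit.

(** * Assembling the equivalence on raw maps *)

Section Equivalence.
Variable K : fieldType.

Definition eta (A : xsquare K) : xsq_map A (G_obj (F_obj A)) :=
  (etaL A : _ -> _, etaM A : _ -> _, etaN A : _ -> _, etaP A : _ -> _).
Definition eta' (A : xsquare K) : xsq_map (G_obj (F_obj A)) A :=
  (etaL' A : _ -> _, etaM' A : _ -> _, etaN' A : _ -> _, etaP' A : _ -> _).
Definition eps (X : cat2 K) : cat2_map (F_obj (G_obj X)) X :=
  (epsH X : _ -> _, epsN X : _ -> _, epsM X : _ -> _).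
Definition eps' (X : cat2 K) : cat2_map X (F_obj (G_obj X)) :=
  (epsH' X : _ -> _, epsN' X : _ -> _, epsM' X : _ -> _).

Lemma cfun_comp_id (C D : coalg K) (f : cmor C D) (g : cmor D C) :
  g @@ f = cidm C -> (fun x => g (f x)) = (fun x => x).
Proof. exact: (congr1 (@cfun K C C)). Qed.

Lemma eta_mor A : is_xsq_mor (eta A).
Proof. by have /sqmorP := eta_sqmor A. Qed.

Lemma eta'_mor A : is_xsq_mor (eta' A).
Proof.
have := inverse_sqmor (A := A) (B := G_obj (F_obj A)) (al := hetaL A) (be := hetaM A)
  (ga := hetaN A) (de := hetaP A)
  (al' := Hmor (inverse_hmor (f := hetaL A) (etaLK A) (etaLK' A)))
  (be' := Hmor (inverse_hmor (f := hetaM A) (etaMK A) (etaMK' A)))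
  (ga' := Hmor (inverse_hmor (f := hetaN A) (etaNK A) (etaNK' A)))
  (de' := Hmor (inverse_hmor (f := hetaP A) (etaPK A) (etaPK' A)))
  (etaLK A) (etaLK' A) (etaMK A) (etaMK' A) (etaNK A) (etaNK' A) (etaPK A) (etaPK' A)
  (eta_sqmor A).
by move=> /sqmorP.
Qed.

Lemma eps_mor X : is_cat2_mor (eps X).
Proof. by have /c2morP := eps_c2mor X. Qed.

Lemma eps'_mor X : is_cat2_mor (eps' X).
Proof.
have := inverse_c2mor (X := F_obj (G_obj X)) (Y := X) (f := hepsH X) (fn := hepsN X)
  (fm := hepsM X)
  (f' := Hmor (inverse_hmor (f := hepsH X) (epsHK X) (epsHK' X)))
  (fn' := Hmor (inverse_hmor (f := hepsN X) (epsNK X) (epsNK' X)))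
  (fm' := Hmor (inverse_hmor (f := hepsM X) (epsMK X) (epsMK' X)))
  (epsHK X) (epsHK' X) (epsNK X) (epsNK' X) (epsMK X) (epsMK' X) (eps_c2mor X).
by move=> /c2morP.
Qed.

Lemma eta_natural (A B : xsquare K) (f : xsq_map A B) : is_xsq_mor f ->
  xsq_comp (G_mor (F_mor f)) (eta A) = xsq_comp (eta B) f.
Proof.
move=> /xsq_morW[al [be [ga [de [sm ->]]]]].
have /cat2_morW[f0 [fn [fm [cm]]]] := F_c2mor sm.
rewrite /F_mor !mkh_hmor => fE; rewrite [X in G_mor X]fE /G_mor !mkh_hmor.
(* The bundled [f0] is known only to have the same underlying function as [F_mH]; extensionality
   identifies the two. *)
have fH : F_mH al be ga de = f0 by apply: cmor_ext => x; case: fE => ->.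
have fHE E (x : cmor E (LNMP A)) : f0 @@ x = F_mH al be ga de @@ x by rewrite fH.
rewrite /xsq_comp /=; congr (_, _, _, _).
- apply: (congr1 (@cfun _ _ _) (x := submap (gL _) (gL _) f0 @@ etaL A) (y := etaL B @@ al)).
  apply: si_inj; rewrite (submap_L cm) -[etaL A]ccompf1 !etaLE fHE.
  by apply: quad_ext; rewrite ?(F_mHL, F_mHN, F_mHM, F_mHP) !(qL_quad, qN_quad, qM_quad, qP_quad)
    ?hm1 ?ccompf1.
- apply: (congr1 (@cfun _ _ _) (x := submap (gM _) (gM _) f0 @@ etaM A) (y := etaM B @@ be)).
  apply: si_inj; rewrite (submap_M cm) -[etaM A]ccompf1 !etaME fHE.
  by apply: quad_ext; rewrite ?(F_mHL, F_mHN, F_mHM, F_mHP) !(qL_quad, qN_quad, qM_quad, qP_quad)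
    ?hm1 ?ccompf1.
- apply: (congr1 (@cfun _ _ _) (x := submap (gN _) (gN _) f0 @@ etaN A) (y := etaN B @@ ga)).
  apply: si_inj; rewrite (submap_N cm) -[etaN A]ccompf1 !etaNE fHE.
  by apply: quad_ext; rewrite ?(F_mHL, F_mHN, F_mHM, F_mHP) !(qL_quad, qN_quad, qM_quad, qP_quad)
    ?hm1 ?ccompf1.
- apply: (congr1 (@cfun _ _ _) (x := submap (gP _) (gP _) f0 @@ etaP A) (y := etaP B @@ de)).
  apply: si_inj; rewrite (submap_P cm) -[etaP A]ccompf1 !etaPE fHE.
  by apply: quad_ext; rewrite ?(F_mHL, F_mHN, F_mHM, F_mHP) !(qL_quad, qN_quad, qM_quad, qP_quad)
    ?hm1 ?ccompf1.
Qed.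

Lemma eps_natural (X Y : cat2 K) (f : cat2_map X Y) : is_cat2_mor f ->
  cat2_comp f (eps X) = cat2_comp (eps Y) (F_mor (G_mor f)).
Proof.
move=> /cat2_morW[f0 [fn [fm [cm ->]]]].
have /xsq_morW[al [be [ga [de [sm]]]]] := G_sqmor cm.
rewrite /G_mor !mkh_hmor => fE; rewrite [X in F_mor X]fE /F_mor !mkh_hmor.
(* The four restrictions of [f0] are matched with the bundled maps by projecting the equality of raw
   quadruples. *)
have [aE bE gE dE] : [/\ submap (gL X) (gL Y) f0 = al, submap (gM X) (gM Y) f0 = be,
    submap (gN X) (gN Y) f0 = ga & submap (gP X) (gP Y) f0 = de].
  split; apply: cmor_ext => x.
  - exact: (congr1 (fun t => t.1.1.1 x) fE).
  - exact: (congr1 (fun t => t.1.1.2 x) fE).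
  - exact: (congr1 (fun t => t.1.2 x) fE).
  - exact: (congr1 (fun t => t.2 x) fE).
have aI E (l : cmor E (gL X)) : si (gL Y) @@ al @@ l = f0 @@ si (gL X) @@ l.
  by rewrite -aE (submap_L cm).
have bI E (m : cmor E (gM X)) : si (gM Y) @@ be @@ m = f0 @@ si (gM X) @@ m.
  by rewrite -bE (submap_M cm).
have gI E (n : cmor E (gN X)) : si (gN Y) @@ ga @@ n = f0 @@ si (gN X) @@ n.
  by rewrite -gE (submap_N cm).
have dI E (p : cmor E (gP X)) : si (gP Y) @@ de @@ p = f0 @@ si (gP X) @@ p.
  by rewrite -dE (submap_P cm).
rewrite /cat2_comp /=; congr (_, _, _).
- apply: (congr1 (@cfun _ _ _) (x := f0 @@ epsH X) (y := epsH Y @@ F_mH al be ga de)).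
  rewrite -[epsH X]ccompf1 -[F_mH _ _ _ _]ccompf1 !epsHE F_mHL F_mHN F_mHM F_mHP !hmM.
  by rewrite aI bI gI dI.
- apply: (congr1 (@cfun _ _ _) (x := fn @@ epsN X) (y := epsN Y @@ F_mN ga de)).
  apply: giN_inj; rewrite (cm_iN cm) -[epsN X]ccompf1 -[F_mN _ _]ccompf1 !epsNE F_mN1 F_mN2 hmM.
  by rewrite gI dI.
- apply: (congr1 (@cfun _ _ _) (x := fm @@ epsM X) (y := epsM Y @@ F_mM be de)).
  apply: giM_inj; rewrite (cm_iM cm) -[epsM X]ccompf1 -[F_mM _ _]ccompf1 !epsME F_mM1 F_mM2 hmM.
  by rewrite bI dI.
Qed.

End Equivalence.

Theorem theorem3p2 (K : fieldType) : cat_equivalence (XSq_cat K) (Cat2_cat K).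
Proof.
exists (@F_obj K), (@F_mor K), (@G_obj K), (@G_mor K), (@eta K), (@eta' K), (@eps K), (@eps' K).
split; [exact: F_functor | exact: G_functor | |].
- split; [exact: eta_mor | exact: eta'_mor | | | exact: eta_natural].
  + by move=> A; congr (_, _, _, _); apply: cfun_comp_id;
      [apply: etaLK | apply: etaMK | apply: etaNK | apply: etaPK].
  + by move=> A; congr (_, _, _, _); apply: cfun_comp_id;
      [apply: etaLK' | apply: etaMK' | apply: etaNK' | apply: etaPK'].
- split; [exact: eps_mor | exact: eps'_mor | | | exact: eps_natural].
  + by move=> X; congr (_, _, _); apply: cfun_comp_id;
      [apply: epsHK | apply: epsNK | apply: epsMK].
  + by move=> X; congr (_, _, _); apply: cfun_comp_id;
      [apply: epsHK' | apply: epsNK' | apply: epsMK'].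
Qed.
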